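(* The pairing $\langle\!\langle\cdot,\cdot\rangle\!\rangle_{\mathscr{Com}}$ induces a perfect pairing between $\mathscr{P}_2(n)$ and $\mathscr{Q}_2(n)$.
   Context: Let $R$ be a commutative ring with unit, $X=\{x_1<\dots<x_n\}$. $\mathscr{P}_2(n)$ is the multilinear part of the free $R$-algebra on $X$ with two bilinear brackets $[\cdot,\cdot]$, $\langle\cdot,\cdot\rangle$ and an associative commutative product subject only to: $[x,y]+[y,x]=0$; $\langle x,y\rangle+\langle y,x\rangle=0$; $[x,[y,z]]+[y,[z,x]]+[z,[x,y]]=0$; the same for $\langle\cdot,\cdot\rangle$; $[x,\langle y,z\rangle]+[y,\langle z,x\rangle]+[z,\langle x,y\rangle]+\langle x,[y,z]\rangle+\langle y,[z,x]\rangle+\langle z,[x,y]\rangle=0$; $[x,yz]=[x,y]z+y[x,z]$; $\langle x,yz\rangle=\langle x,y\rangle z+y\langle x,z\rangle$. A 2v-colored quasi-binary tree on $X$ is a rooted tree (root at level $0$; level = distance to root) whose leaves are bijectively labeled by $X$ and all lie at odd levels, such that each internal odd-level vertex has exactly two children, ordered (left/right), and is colored red or blue, and each even-level vertex has at least one child, children unordered. These trees correspond bijectively to monomials of $\mathscr{P}_2(n)$ (up to commutativity/associativity of the product): a red (blue) odd-level vertex is the bracket $[L,R]$ ($\langle L,R\rangle$) of its left and right subtrees, an even-level vertex is the product of its children. $\Theta^{\mathscr{Com}}_n$ is the free $R$-module on these trees; $\mathscr{P}_2(n)$ is its quotient by the relations above. Oriented two-colored graphs on $X$ are directed multigraphs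 on $X$ with red/blue edges; $\Gamma_n$ is the free module on them; with $H+e$ denoting $H$ with edge $e$ added, $I^{\mathscr{Com}}_n$ is generated by: $(H+(i\to j))+(H+(j\to i))$ (same color); $\sum_{(a,b,c)}(H+(a\to b)+(b\to c))$ over cyclic rotations of distinct $(i,j,k)$, one common color; $\sum_{(a,b,c)}[(H+(a\to b)_{\mathrm{blue}}+(b\to c)_{\mathrm{red}})+(H+(a\to b)_{\mathrm{red}}+(b\to c)_{\mathrm{blue}})]$; graphs with more than one edge between some pair of vertices. $\mathscr{Q}_2(n)=\Gamma_n/I^{\mathscr{Com}}_n$. For a quasi-binary tree $T$ and graph $G$, map each edge $i\to j$ of $G$ to the nadir (vertex closest to the root) of the path between leaves $i,j$; let $N$ be the number of edges with leaf $i$ below the right child and leaf $j$ below the left child of the nadir. Set $\langle\!\langle G,T\rangle\!\rangle_{\mathscr{Com}}=(-1)^N$ if every edge is sent to an odd-level vertex of the same color as the edge and the map is a bijection from edges of $G$ onto internal odd-level vertices of $T$, and $0$ otherwise; extend bilinearly. This form vanishes on the relations defining $\mathscr{P}_2(n)$ and on $I^{\mathscr{Com}}_n$, so it induces a pairing $\mathscr{Q}_2(n)\times\mathscr{P}_2(n)\to R$. Perfect means the induced maps from each module to the $R$-dual of the other are isomorphisms. *)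

(* Defs.v *)
From HB Require Import structures.
From mathcomp Require Import all_boot all_order all_algebra.
From mathcomp Require Import boolp classical_sets functions cardinality.

Set Implicit Arguments.
Unset Strict Implicit.
Unset Printing Implicit Defensive.

Import GRing.Theory.
Local Open Scope ring_scope.
Local Open Scope quotient_scope.
Local Open Scope classical_set_scope.

Section Span.
Variables (R : pzRingType) (V : lmodType R).

Inductive lspan (S : V -> Prop) : V -> Prop :=
| lspan0 : lspan S 0
| lspan_gen v : S v -> lspan S v
| lspan_comb a u v : lspan S u -> lspan S v -> lspan S (a *: u + v).

Variable S : V -> Prop.

Definition in_lspan : {pred V} := [pred v | `[< lspan S v >]].

Lemma in_lspanP v : reflect (lspan S v) (v \in in_lspan).
Proof. exact: asboolP. Qed.

Lemma in_lspan_submod : submod_closed in_lspan.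
Proof.
split=> [|a u v /in_lspanP Su /in_lspanP Sv]; first exact/in_lspanP/lspan0.
exact/in_lspanP/lspan_comb.
Qed.

HB.instance Definition _ := GRing.isSubmodClosed.Build R V in_lspan
  (GRing.submod_closed_semi in_lspan_submod).

Record span_mod := SpanMod { span_val : V; _ : span_val \in in_lspan }.

HB.instance Definition _ := [isSub for span_val].
HB.instance Definition _ := [Choice of span_mod by <:].
HB.instance Definition _ := [SubChoice_isSubLmodule of span_mod by <:].

Definition quot_rel (u v : V) := u - v \in in_lspan.

Lemma quot_rel_equiv : equiv_class_of quot_rel.
Proof.
split=> [u|u v|v u w]; rewrite /quot_rel.
- by rewrite subrr rpred0.
- by rewrite -opprB rpredN.
- by move=> uv vw; rewrite -(subrKA v) rpredD.
Qed.

Canonical quot_equiv := EquivRelPack quot_rel_equiv.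

Definition quot_mod := {eq_quot quot_rel}.

HB.instance Definition _ := Choice.on quot_mod.
HB.instance Definition _ := EqQuotient.on quot_mod.

Implicit Types x y z : quot_mod.

Definition quot_add x y : quot_mod := \pi_quot_mod (repr x + repr y).
Definition quot_opp x : quot_mod := \pi_quot_mod (- repr x).
Definition quot_scale a x : quot_mod := \pi_quot_mod (a *: repr x).

Lemma quot_eqP u v : reflect (\pi_quot_mod u = \pi_quot_mod v) (u - v \in in_lspan).
Proof. by apply: (iffP idP) => [uv|/eqP]; [apply/eqP|]; rewrite eqmodE. Qed.

Lemma quot_reprP v : repr (\pi_quot_mod v) - v \in in_lspan.
Proof. by apply/quot_eqP; rewrite reprK. Qed.

Lemma quot_modW (P : quot_mod -> Prop) :
  (forall v, P (\pi_quot_mod v)) -> forall x, P x.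
Proof. by move=> Ppi x; rewrite -[x]reprK. Qed.

Lemma quot_addE u v :
  quot_add (\pi_quot_mod u) (\pi_quot_mod v) = \pi_quot_mod (u + v).
Proof. by apply/quot_eqP; rewrite opprD addrACA rpredD ?quot_reprP. Qed.

Lemma quot_oppE u : quot_opp (\pi_quot_mod u) = \pi_quot_mod (- u).
Proof. by apply/quot_eqP; rewrite -opprD rpredN quot_reprP. Qed.

Lemma quot_scaleE a u : quot_scale a (\pi_quot_mod u) = \pi_quot_mod (a *: u).
Proof. by apply/quot_eqP; rewrite -scalerBr rpredZ // quot_reprP. Qed.

Lemma quot_addA : associative quot_add.
Proof.
elim/quot_modW=> x; elim/quot_modW=> y; elim/quot_modW=> z.
by rewrite !quot_addE addrA.
Qed.
Lemma quot_addC : commutative quot_add.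
Proof. by elim/quot_modW=> x; elim/quot_modW=> y; rewrite !quot_addE addrC. Qed.
Lemma quot_add0 : left_id (\pi_quot_mod 0) quot_add.
Proof. by elim/quot_modW=> x; rewrite quot_addE add0r. Qed.
Lemma quot_addN : left_inverse (\pi_quot_mod 0) quot_opp quot_add.
Proof. by elim/quot_modW=> x; rewrite quot_oppE quot_addE addNr. Qed.

HB.instance Definition _ :=
  GRing.isZmodule.Build quot_mod quot_addA quot_addC quot_add0 quot_addN.

Lemma quot_scaleA a b x : quot_scale a (quot_scale b x) = quot_scale (a * b) x.
Proof. by move: x; elim/quot_modW=> x; rewrite !quot_scaleE scalerA. Qed.
Lemma quot_scale1 : left_id 1 quot_scale.
Proof. by elim/quot_modW=> x; rewrite quot_scaleE scale1r. Qed.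
Lemma quot_scaleDr : right_distributive quot_scale +%R.
Proof.
move=> a x y; rewrite -[x](@reprK _ quot_mod) -[y](@reprK _ quot_mod).
by rewrite [_ + _]quot_addE !quot_scaleE [RHS]quot_addE scalerDr.
Qed.
Lemma quot_scaleDl x : {morph quot_scale^~ x : a b / a + b}.
Proof.
move=> a b; rewrite -[x](@reprK _ quot_mod).
by rewrite !quot_scaleE [RHS]quot_addE scalerDl.
Qed.

HB.instance Definition _ := GRing.Zmodule_isLmodule.Build R quot_mod
  quot_scaleA quot_scale1 quot_scaleDr quot_scaleDl.

Definition quot_class (v : V) : quot_mod := \pi_quot_mod v.

End Span.

(* The free R-module on T: finitely supported functions from T to R. *)
Section FreeModule.
Variables (R : pzRingType) (T : choiceType).

Definition fin_supp : {pred T -> R^o} :=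
  [pred f | `[< finite_set [set t | f t != 0] >]].

Lemma fin_supp_submod : submod_closed fin_supp.
Proof.
split=> [|a f g /asboolP fin_f /asboolP fin_g]; apply/asboolP.
  by rewrite (_ : [set _ | _] = classical_sets.set0) // -subset0 => t /=; rewrite eqxx.
apply: (@sub_finite_set _ _ ([set t | f t != 0] `|` [set t | g t != 0])).
  move=> t /= fg_t; apply/orP; apply: contraNT fg_t.
  rewrite negb_or !negbK => /andP[/eqP f0 /eqP g0].
  by rewrite (_ : (a *: f + g) t = a *: f t + g t) // f0 g0 scaler0 addr0 eqxx.
by rewrite finite_setU.
Qed.

HB.instance Definition _ := GRing.isSubmodClosed.Build R (T -> R^o) fin_supp
  (GRing.submod_closed_semi fin_supp_submod).

Record free_mod := FreeMod { coef : T -> R^o; _ : coef \in fin_supp }.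

HB.instance Definition _ := [isSub for coef].
HB.instance Definition _ := [Choice of free_mod by <:].
HB.instance Definition _ := [SubChoice_isSubLmodule of free_mod by <:].

Lemma delta_fin_supp t0 : (fun t => (t == t0)%:R) \in fin_supp.
Proof.
apply/asboolP/(sub_finite_set _ (finite_set1 t0)) => t /=.
by case: (t =P t0) => // _ /eqP[].
Qed.

Definition delta t0 : free_mod := FreeMod (delta_fin_supp t0).

End FreeModule.

Definition perfect_pairing (R : comPzRingType) (M N : lmodType R)
    (B : M -> N -> R) : Prop :=
  exists (l : M -> {linear N -> R^o}) (r : N -> {linear M -> R^o}),
    [/\ forall x y, l x y = B x y, forall x y, r y x = B x y,
        bijective l & bijective r].

Variant color := red | blue.

Definition is_red c := if c is red then true else false.
Lemma is_redK : cancel is_red (fun b : bool => if b then red else blue).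
Proof. by case. Qed.
HB.instance Definition _ := Finite.copy color (can_type is_redK).

(* The free (nonunital) algebra on x_0 < ... < x_(n-1) is the set of formal
   expressions modulo the smallest congruence that makes it an R-module, makes
   the three products bilinear, and satisfies the defining identities. *)
Section FreeAlgebra.
Variables (R : comPzRingType) (n : nat).

Inductive expr :=
| Var of 'I_n
| Zero
| Add of expr & expr
| Scale of R & expr
| Bra of color & expr & expr
| Mul of expr & expr.

HB.instance Definition _ := gen_eqMixin expr.
HB.instance Definition _ := gen_choiceMixin expr.

Inductive alg_eq : expr -> expr -> Prop :=
| ae_refl x : alg_eq x x
| ae_sym x y : alg_eq x y -> alg_eq y x
| ae_trans x y z : alg_eq x y -> alg_eq y z -> alg_eq x z
| ae_Add x x' y y' :
    alg_eq x x' -> alg_eq y y' -> alg_eq (Add x y) (Add x' y')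
| ae_Scale a x x' : alg_eq x x' -> alg_eq (Scale a x) (Scale a x')
| ae_Bra c x x' y y' :
    alg_eq x x' -> alg_eq y y' -> alg_eq (Bra c x y) (Bra c x' y')
| ae_Mul x x' y y' :
    alg_eq x x' -> alg_eq y y' -> alg_eq (Mul x y) (Mul x' y')
| ae_AddA x y z : alg_eq (Add x (Add y z)) (Add (Add x y) z)
| ae_AddC x y : alg_eq (Add x y) (Add y x)
| ae_Add0 x : alg_eq (Add Zero x) x
| ae_AddN x : alg_eq (Add (Scale (-1) x) x) Zero
| ae_ScaleA a b x : alg_eq (Scale a (Scale b x)) (Scale (a * b) x)
| ae_Scale1 x : alg_eq (Scale 1 x) x
| ae_ScaleDr a x y : alg_eq (Scale a (Add x y)) (Add (Scale a x) (Scale a y))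
| ae_ScaleDl a b x : alg_eq (Scale (a + b) x) (Add (Scale a x) (Scale b x))
| ae_BraDl c x y z : alg_eq (Bra c (Add x y) z) (Add (Bra c x z) (Bra c y z))
| ae_BraZl c a x y : alg_eq (Bra c (Scale a x) y) (Scale a (Bra c x y))
| ae_BraDr c x y z : alg_eq (Bra c x (Add y z)) (Add (Bra c x y) (Bra c x z))
| ae_BraZr c a x y : alg_eq (Bra c x (Scale a y)) (Scale a (Bra c x y))
| ae_MulDl x y z : alg_eq (Mul (Add x y) z) (Add (Mul x z) (Mul y z))
| ae_MulZl a x y : alg_eq (Mul (Scale a x) y) (Scale a (Mul x y))
| ae_MulA x y z : alg_eq (Mul x (Mul y z)) (Mul (Mul x y) z)
| ae_MulC x y : alg_eq (Mul x y) (Mul y x)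
| ae_anti c x y : alg_eq (Add (Bra c x y) (Bra c y x)) Zero
| ae_jacobi c x y z :
    alg_eq (Add (Add (Bra c x (Bra c y z)) (Bra c y (Bra c z x)))
                (Bra c z (Bra c x y))) Zero
| ae_mixed x y z :
    alg_eq (Add (Add (Add (Bra red x (Bra blue y z))
                          (Bra red y (Bra blue z x)))
                     (Bra red z (Bra blue x y)))
                (Add (Add (Bra blue x (Bra red y z))
                          (Bra blue y (Bra red z x)))
                     (Bra blue z (Bra red x y)))) Zero
| ae_leibniz c x y z :
    alg_eq (Bra c x (Mul y z)) (Add (Mul (Bra c x y) z) (Mul y (Bra c x z))).

Definition alg_rel (x y : expr) := `[< alg_eq x y >].

Lemma alg_rel_equiv : equiv_class_of alg_rel.
Proof.
split=> [x|x y|y x z]; first exact/asboolP/ae_refl.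
  by apply/asboolP/asboolP; apply: ae_sym.
by move=> /asboolP xy /asboolP yz; apply/asboolP/ae_trans/yz.
Qed.

Canonical alg_equiv := EquivRelPack alg_rel_equiv.

Definition free_alg := {eq_quot alg_rel}.

HB.instance Definition _ := Choice.on free_alg.
HB.instance Definition _ := EqQuotient.on free_alg.

Definition alg_class (x : expr) : free_alg := \pi_free_alg x.

Lemma alg_classP x y : alg_class x = alg_class y <-> alg_eq x y.
Proof.
split=> [/eqP|xy]; first by rewrite eqmodE => /asboolP.
by apply/eqP; rewrite eqmodE; apply/asboolP.
Qed.

Lemma alg_reprP x : alg_eq (repr (alg_class x)) x.
Proof. by apply/alg_classP; rewrite /alg_class reprK. Qed.

Lemma repr_algK (x : free_alg) : alg_class (repr x) = x.
Proof. exact: reprK. Qed.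

Implicit Types x y z : free_alg.

Definition alg_add x y := alg_class (Add (repr x) (repr y)).
Definition alg_opp x := alg_class (Scale (-1) (repr x)).
Definition alg_scale a x := alg_class (Scale a (repr x)).

Lemma alg_addE u v : alg_add (alg_class u) (alg_class v) = alg_class (Add u v).
Proof. by apply/alg_classP/ae_Add; apply: alg_reprP. Qed.

Lemma alg_scaleE a u : alg_scale a (alg_class u) = alg_class (Scale a u).
Proof. exact/alg_classP/ae_Scale/alg_reprP. Qed.

Lemma alg_addA : associative alg_add.
Proof.
move=> x y z; rewrite -[x]repr_algK -[y]repr_algK -[z]repr_algK !alg_addE.
exact/alg_classP/ae_AddA.
Qed.
Lemma alg_addC : commutative alg_add.
Proof. by move=> x y; apply/alg_classP/ae_AddC. Qed.
Lemma alg_add0 : left_id (alg_class Zero) alg_add.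
Proof.
by move=> x; rewrite -[x]repr_algK alg_addE; apply/alg_classP/ae_Add0.
Qed.
Lemma alg_addN : left_inverse (alg_class Zero) alg_opp alg_add.
Proof.
by move=> x; rewrite -{2}[x]repr_algK alg_addE; apply/alg_classP/ae_AddN.
Qed.

HB.instance Definition _ :=
  GRing.isZmodule.Build free_alg alg_addA alg_addC alg_add0 alg_addN.

Lemma alg_scaleA a b x : alg_scale a (alg_scale b x) = alg_scale (a * b) x.
Proof. by rewrite alg_scaleE; apply/alg_classP/ae_ScaleA. Qed.
Lemma alg_scale1 : left_id 1 alg_scale.
Proof.
by move=> x; rewrite -[RHS]repr_algK; apply/alg_classP/ae_Scale1.
Qed.
Lemma alg_scaleDr : right_distributive alg_scale +%R.
Proof.
move=> a x y; rewrite [LHS]alg_scaleE [RHS]alg_addE.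
exact/alg_classP/ae_ScaleDr.
Qed.
Lemma alg_scaleDl x : {morph alg_scale^~ x : a b / a + b}.
Proof. by move=> a b; rewrite [RHS]alg_addE; apply/alg_classP/ae_ScaleDl. Qed.

HB.instance Definition _ := GRing.Zmodule_isLmodule.Build R free_alg
  alg_scaleA alg_scale1 alg_scaleDr alg_scaleDl.

Fixpoint monomial (x : expr) : bool :=
  match x with
  | Var _ => true
  | Bra _ y z | Mul y z => monomial y && monomial z
  | _ => false
  end.

Fixpoint vars (x : expr) : seq 'I_n :=
  match x with
  | Var i => [:: i]
  | Zero => [::]
  | Scale _ y => vars y
  | Add y z | Bra _ y z | Mul y z => vars y ++ vars z
  end.

Definition multilinear (x : expr) :=
  monomial x && perm_eq (vars x) (enum 'I_n).

(* As the defining identities are homogeneous in each variable, the component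
   of multidegree (1, ..., 1) is spanned by the multilinear monomials. *)
Definition P2 :=
  span_mod (fun a : free_alg => exists2 x, multilinear x & a = alg_class x).

HB.instance Definition _ := GRing.Lmodule.on P2.

End FreeAlgebra.

Arguments Var {R n}.
Arguments Zero {R n}.

(* [odd_tree] is a tree whose root sits at an odd level, [even_tree] one whose
   root sits at an even level and is given by the nonempty list of its
   children.  Thus an [even_tree] is a planar representative of a tree with
   unordered children at even levels. *)
Inductive odd_tree (n : nat) :=
| Leaf of 'I_n
| Node of color & even_tree n & even_tree n
with even_tree (n : nat) :=
| Only of odd_tree n
| More of odd_tree n & even_tree n.

Section Trees.
Variable n : nat.

Fixpoint odd_leaves (t : odd_tree n) : seq 'I_n :=
  match t with
  | Leaf i => [:: i]
  | Node _ l r => leaves l ++ leaves r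
  end
with leaves (t : even_tree n) : seq 'I_n :=
  match t with
  | Only o => odd_leaves o
  | More o e => odd_leaves o ++ leaves e
  end.

Definition tree := {t : even_tree n | perm_eq (leaves t) (enum 'I_n)}.

(* A vertex is the sequence of child indices along the path from the root; in
   particular its level is its size.  The left (right) child of an odd-level
   vertex has index 0 (1). *)
Definition vertex := seq nat.

Definition below {A : Type} (k : nat) (s : seq (A * vertex)) :=
  [seq (p.1, k :: p.2) | p <- s].

(* The leaf vertices with their labels; k is the index of the first child. *)
Fixpoint odd_leaf_vertices (t : odd_tree n) : seq ('I_n * vertex) :=
  match t with
  | Leaf i => [:: (i, [::])]
  | Node _ l r =>
      below 0 (leaf_vertices_from 0 l) ++ below 1 (leaf_vertices_from 0 r)
  end
with leaf_vertices_from (k : nat) (t : even_tree n) : seq ('I_n * vertex) :=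
  match t with
  | Only o => below k (odd_leaf_vertices o)
  | More o e => below k (odd_leaf_vertices o) ++ leaf_vertices_from k.+1 e
  end.

Fixpoint odd_nodes (t : odd_tree n) : seq (color * vertex) :=
  match t with
  | Leaf _ => [::]
  | Node c l r =>
      (c, [::]) :: below 0 (nodes_from 0 l) ++ below 1 (nodes_from 0 r)
  end
with nodes_from (k : nat) (t : even_tree n) : seq (color * vertex) :=
  match t with
  | Only o => below k (odd_nodes o)
  | More o e => below k (odd_nodes o) ++ nodes_from k.+1 e
  end.

Definition nodes (T : tree) := nodes_from 0 (val T).

Definition leaf_vertex (T : tree) (i : 'I_n) : vertex :=
  let s := leaf_vertices_from 0 (val T) in
  nth [::] (unzip2 s) (index i (unzip1 s)).

Fixpoint common_prefix (u v : vertex) : vertex :=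
  match u, v with
  | a :: u', b :: v' => if a == b then a :: common_prefix u' v' else [::]
  | _, _ => [::]
  end.

Definition nadir (T : tree) (i j : 'I_n) : vertex :=
  common_prefix (leaf_vertex T i) (leaf_vertex T j).

(* The index of the child of v below which u lies. *)
Definition branch (v u : vertex) : nat := nth 0%N u (size v).

Definition right_to_left (T : tree) (i j : 'I_n) : bool :=
  let v := nadir T i j in
  (branch v (leaf_vertex T i) == 1%N) && (branch v (leaf_vertex T j) == 0%N).

End Trees.

Section TreeMonomial.
Variables (R : comPzRingType) (n : nat).

Fixpoint odd_tree_expr (t : odd_tree n) : expr R n :=
  match t with
  | Leaf i => Var i
  | Node c l r => Bra c (tree_expr l) (tree_expr r)
  end
with tree_expr (t : even_tree n) : expr R n :=
  match t with
  | Only o => odd_tree_expr o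
  | More o e => Mul (odd_tree_expr o) (tree_expr e)
  end.

Fixpoint odd_tree_exprP (t : odd_tree n) :
  monomial (odd_tree_expr t) /\ vars (odd_tree_expr t) = odd_leaves t
with tree_exprP (t : even_tree n) :
  monomial (tree_expr t) /\ vars (tree_expr t) = leaves t.
Proof.
- case: t => //= c l r.
  by have [-> ->] := tree_exprP l; have [-> ->] := tree_exprP r.
- case: t => [o|o e] /=; have [-> ->] := odd_tree_exprP o => //.
  by have [-> ->] := tree_exprP e.
Qed.

Lemma tree_class_subproof (T : tree n) :
  alg_class (tree_expr (val T)) \in in_lspan
    (fun a : free_alg R n => exists2 x, multilinear x & a = alg_class x).
Proof.
apply/in_lspanP/lspan_gen; exists (tree_expr (val T)) => //.
by have [mT vT] := tree_exprP (val T); rewrite /multilinear mT vT (valP T).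
Qed.

Definition tree_class (T : tree n) : P2 R n := SpanMod (tree_class_subproof T).

End TreeMonomial.

Section Graphs.
Variable n : nat.

(* Graphs have no loops: the relation i -> i + i -> i = 0 would create torsion. *)
Definition edge := {e : color * ('I_n * 'I_n) | e.2.1 != e.2.2}.

Definition ecol (e : edge) : color := (val e).1.
Definition esrc (e : edge) : 'I_n := (val e).2.1.
Definition etgt (e : edge) : 'I_n := (val e).2.2.

Definition arrow (c : color) (i j : 'I_n) (ij : i != j) : edge :=
  exist _ (c, (i, j)) ij.

(* A directed multigraph, given by the multiplicity of each edge. *)
Definition graph := {ffun edge -> nat}.

Definition add_edge (H : graph) (e : edge) : graph :=
  [ffun f => H f + (f == e)]%N.

Definition edges (G : graph) : seq edge :=
  flatten [seq nseq (G e) e | e <- enum [the finType of edge]].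

Definition joins (i j : 'I_n) (e : edge) : bool :=
  ((esrc e == i) && (etgt e == j)) || ((esrc e == j) && (etgt e == i)).

Definition multi_edge (G : graph) : bool :=
  [exists i, exists j, (1 < count (joins i j) (edges G))%N].

End Graphs.

Section GraphModule.
Variables (R : comPzRingType) (n : nat).

Definition Gamma := free_mod R (graph n).
HB.instance Definition _ := GRing.Lmodule.on Gamma.

Let gen (G : graph n) : Gamma := delta R G.
Let gen2 (H : graph n) (e f : edge n) : Gamma := gen (add_edge (add_edge H e) f).

Inductive graph_rel : Gamma -> Prop :=
| rel_anti H c i j (ij : i != j) (ji : j != i) :
    graph_rel (gen (add_edge H (arrow c ij)) + gen (add_edge H (arrow c ji)))
| rel_jacobi H c i j k (ij : i != j) (jk : j != k) (ki : k != i) :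
    graph_rel (gen2 H (arrow c ij) (arrow c jk)
             + gen2 H (arrow c jk) (arrow c ki)
             + gen2 H (arrow c ki) (arrow c ij))
| rel_mixed H i j k (ij : i != j) (jk : j != k) (ki : k != i) :
    graph_rel ((gen2 H (arrow blue ij) (arrow red jk)
              + gen2 H (arrow red ij) (arrow blue jk))
             + (gen2 H (arrow blue jk) (arrow red ki)
              + gen2 H (arrow red jk) (arrow blue ki))
             + (gen2 H (arrow blue ki) (arrow red ij)
              + gen2 H (arrow red ki) (arrow blue ij)))
| rel_multi G : multi_edge G -> graph_rel (gen G).

Definition Q2 := quot_mod graph_rel.
HB.instance Definition _ := GRing.Lmodule.on Q2.

Definition graph_class (G : graph n) : Q2 := quot_class graph_rel (gen G).

End GraphModule.

Arguments tree_class R {n} T.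
Arguments graph_class R {n} G.

Section Form.
Variables (R : comPzRingType) (n : nat).

Definition edge_nadir (T : tree n) (e : edge n) : vertex :=
  nadir T (esrc e) (etgt e).

(* The vertices listed by [nodes T] are distinct, so [perm_eq] says that the
   map from edges to internal odd-level vertices is a bijection. *)
Definition com_form (G : graph n) (T : tree n) : R :=
  if all (fun e => (ecol e, edge_nadir T e) \in nodes T) (edges G)
     && perm_eq [seq edge_nadir T e | e <- edges G] (unzip2 (nodes T))
  then (-1) ^+ count (fun e => right_to_left T (esrc e) (etgt e)) (edges G)
  else 0.

End Form.

Arguments com_form R {n} G T.

(* Main.v *)
(* A graph [G] evaluates a bracket monomial on a vertex set [V] recursively: a
   bracket of colour c splits [V] into two parts and contributes the sign of the
   edge of [G] between them, provided there is exactly one and it has colour c;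
   a product requires that no edge of [G] joins the two parts.  These weights
   respect the identities defining [P2], vanish on the relations defining [Q2],
   and give [com_form] on tree monomials.

   Both modules are then indexed by rooted forests on the vertices, an arc from a
   parent to a child being blue if the parent is smaller and red otherwise.  The
   graphs of forests span [Q2]: adding an arc at the maximal vertex is
   straightened with the (mixed) Jacobi relations, a closed cycle of edges being
   zero.  Conversely, let v be the maximum of [V].  By the Leibniz and Jacobi
   identities every multilinear element is a combination of w, g * w and g with
   one variable p replaced by blue(p, w), where v does not occur in g and w is a
   left-normed word red(..red(red(v, y1), y2).., yk) in Lie monomials; by
   induction on [V], these can be chosen so that the pairing with forests is
   unitriangular for the number of vertices below v.  Hence there is a spanning
   family of [P2] dual to a spanning family of [Q2], and both are bases. *)
Require Import Defs.
From HB Require Import structures.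
From mathcomp Require Import finmap boolp classical_sets cardinality.
From mathcomp Require Import all_boot all_order all_algebra.
From mathcomp Require Import ring zify.

Set Implicit Arguments.
Unset Strict Implicit.
Unset Printing Implicit Defensive.

Import GRing.Theory.
Local Open Scope ring_scope.

(** * Spans, free modules and dual bases *)

(** Over an arbitrary commutative ring no rank count is available, so freeness on both sides comes
    from one computation: families spanning the two modules, indexed by the same finite set, with
    identity pairing matrix. The index set has the expected size, since there are (n+1)^(n-1) rooted
    forests on n labelled vertices. The colour rule makes triangularity possible: at a maximal
    vertex v all arcs leaving v are red and all arcs entering v are blue. Thus red(v, y) detects an
    arc from v into y and blue(p, w) the arc from p to v; blue(v, y) with y a bracket is what the
    mixed relation removes. A derivation of an equality between multilinear expressions may pass
    through expressions that are not multilinear. Evaluation is therefore defined on all expressions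
    and all vertex sets, as a sum over ordered splittings, and its invariance is proved for the
    whole congruence. The algebra has no unit, so the empty vertex set carries no nonzero
    multilinear element although it carries a forest; this is why the inductions on the algebra side
    keep to nonempty sets, and why n is positive. *)

Section SpanTheory.
Variable R : pzRingType.

Section OneModule.
Variable V : lmodType R.
Implicit Types (S P : V -> Prop) (u v : V).

Definition spans_closed P := P 0 /\ forall a u v, P u -> P v -> P (a *: u + v).

Lemma lspan_min S P : spans_closed P -> (forall v, S v -> P v) ->
  forall v, lspan S v -> P v.
Proof.
by move=> [P0 Pc] SP v; elim=> // [a u w _ Pu _ Pw]; apply: Pc.
Qed.

Lemma lspan_spans_closed S : spans_closed (lspan S).
Proof. by split=> [|a u v Su Sv]; [apply: lspan0|apply: lspan_comb]. Qed.

Lemma lspan_trans S S' v : (forall w, S w -> lspan S' w) -> lspan S v ->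
  lspan S' v.
Proof. by move=> SS'; apply: lspan_min SS' v; apply: lspan_spans_closed. Qed.

Lemma lspanS S S' v : (forall w, S w -> S' w) -> lspan S v -> lspan S' v.
Proof. by move=> SS'; apply: lspan_trans => w /SS'; apply: lspan_gen. Qed.

Lemma lspanD S u v : lspan S u -> lspan S v -> lspan S (u + v).
Proof. by move=> Su Sv; rewrite -[u]scale1r; apply: lspan_comb. Qed.

Lemma lspanZ S a u : lspan S u -> lspan S (a *: u).
Proof. by move=> Su; rewrite -[_ *: _]addr0; apply/lspan_comb/lspan0. Qed.

Lemma lspanN S u : lspan S u -> lspan S (- u).
Proof. by rewrite -scaleN1r; apply: lspanZ. Qed.

Lemma lspanB S u v : lspan S u -> lspan S v -> lspan S (u - v).
Proof. by move=> Su /lspanN; apply: lspanD. Qed.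

Lemma lspan_sum S (I : Type) (r : seq I) (Q : pred I) (F : I -> V) :
  (forall i, Q i -> lspan S (F i)) -> lspan S (\sum_(i <- r | Q i) F i).
Proof.
by move=> SF; elim/big_rec: _ => [|i v /SF]; [apply: lspan0|apply: lspanD].
Qed.

End OneModule.

Lemma lspan_map (V W : lmodType R) (f : V -> W) (S : V -> Prop)
    (S' : W -> Prop) v :
  f 0 = 0 -> (forall a, {morph f : x y / a *: x + y}) ->
  (forall w, S w -> lspan S' (f w)) -> lspan S v -> lspan S' (f v).
Proof.
move=> f0 fL fS; apply: (lspan_min (P := fun v => lspan S' (f v))) v => //.
split=> [|a u v Su Sv].
  by rewrite f0; apply: lspan0.
by rewrite fL; apply: lspan_comb.
Qed.

Lemma lspan_eq (V W : lmodType R) (f g : V -> W) (S : V -> Prop) v :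
  f 0 = 0 -> (forall a, {morph f : x y / a *: x + y}) ->
  g 0 = 0 -> (forall a, {morph g : x y / a *: x + y}) ->
  (forall w, S w -> f w = g w) -> lspan S v -> f v = g v.
Proof.
move=> f0 fL g0 gL fgS.
apply: (lspan_min (P := fun v => f v = g v)) v => //; split=> [|a u v Su Sv].
  by rewrite f0 g0.
by rewrite fL gL Su Sv.
Qed.

End SpanTheory.

(** * Linear maps out of free modules and quotients *)

Section Extension.
Variables (R : pzRingType) (T : choiceType) (M : lmodType R).
Variable f : T -> M.

Definition fsupport (x : free_mod R T) : seq T :=
  fset_set [set t | coef x t != 0]%classic.

Definition ext (x : free_mod R T) : M :=
  \sum_(t <- fsupport x) (coef x t : R) *: f t.

Lemma mem_fsupport x t : (t \in fsupport x) = (coef x t != 0).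
Proof.
case: x => g gP; rewrite /fsupport in_fset_set /=; last exact/asboolP.
by apply/idP/idP => [/set_mem|/mem_set].
Qed.

(** Terms outside the support have coefficient zero, so several elements can be summed over one
    common list, as linearity requires. *)
Lemma ext_widen x (r : seq T) : uniq r -> {subset fsupport x <= r} ->
  ext x = \sum_(t <- r) (coef x t : R) *: f t.
Proof.
move=> r_uniq xr; rewrite (bigID (fun t => t \in fsupport x)) /=.
rewrite [X in _ + X]big1 ?addr0; last first.
  by move=> t; rewrite mem_fsupport negbK => /eqP->; rewrite scale0r.
rewrite -big_filter; apply/perm_big/uniq_perm => [||t].
- exact: fset_uniq.
- exact: filter_uniq.
by rewrite mem_filter; case: (boolP (t \in _)) => //= /xr ->.
Qed.

Lemma ext_linear a : {morph ext : x y / a *: x + y}.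
Proof.
move=> x y; set r := undup (fsupport x ++ fsupport y ++ fsupport (a *: x + y)).
have r_uniq : uniq r by apply: undup_uniq.
rewrite !(@ext_widen _ r) //; try by move=> t; rewrite mem_undup !mem_cat => ->;
  rewrite ?orbT.
rewrite scaler_sumr -big_split /=; apply: eq_bigr => t _.
by rewrite scalerA -scalerDl.
Qed.

Lemma ext0 : ext 0 = 0.
Proof.
by rewrite /ext big1 // => t _; rewrite [coef _ _]/(0 : R) scale0r.
Qed.

Lemma ext_delta t : ext (delta R t) = f t.
Proof.
rewrite (@ext_widen _ [:: t]) // => [|u]; last first.
  rewrite mem_fsupport /= inE; by case: (u =P t) => // _; rewrite eqxx.
by rewrite big_seq1 /= eqxx scale1r.
Qed.

End Extension.

Lemma free_mod_lspan (R : pzRingType) (T : choiceType) (x : free_mod R T) :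
  lspan (fun v => exists t, v = delta R t) x.
Proof.
suff -> : x = ext (@delta R T) x.
  by apply: lspan_sum => t _; apply/lspanZ/lspan_gen; exists t.
apply: val_inj => /=; apply/funext => t.
have coef_sum r : coef (\sum_(u <- r) (coef x u : R) *: delta R u) t =
    \sum_(u <- r) coef x u * (t == u)%:R.
  elim: r => [|u r IHr]; first by rewrite !big_nil.
  by rewrite !big_cons -IHr.
rewrite [RHS]coef_sum; have [t_x|] := boolP (t \in fsupport x).
  rewrite (bigD1_seq t) ?fset_uniq //= big1 ?addr0 => [|u /negPf ut].
    by rewrite eqxx mulr1.
  by rewrite eq_sym ut mulr0.
rewrite mem_fsupport negbK => /eqP xt; rewrite [coef x t]xt big1 // => u _.
by case: eqP => [<-|]; rewrite ?mulr0 // xt mul0r.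
Qed.

Section Quotient.
Variables (R : pzRingType) (V W : lmodType R) (S : V -> Prop) (f : V -> W).
Hypotheses (f0 : f 0 = 0) (fL : forall a, {morph f : x y / a *: x + y}).
Hypothesis fS : forall v, S v -> f v = 0.

Definition quot_lift (x : quot_mod S) : W := f (repr x).

(** The chosen representative differs from [v] by an element of the span, on which [f] vanishes. *)
Lemma quot_liftE v : quot_lift (quot_class S v) = f v.
Proof.
have f_span w : lspan S w -> f w = 0.
  apply: (lspan_min (P := fun v => f v = 0)) => //; split=> // a u u' fu fu'.
  by rewrite fL fu fu' scaler0 addr0.
have /in_lspanP/f_span := quot_reprP S v.
rewrite -scaleN1r addrC fL scaleN1r => /eqP; rewrite addrC subr_eq0 => /eqP.
by [].
Qed.

Lemma quot_lift_linear a : {morph quot_lift : x y / a *: x + y}.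
Proof.
move=> x y; rewrite -[x](@reprK _ (quot_mod S)) -[y](@reprK _ (quot_mod S)).
rewrite -/(quot_class S (repr x)) -/(quot_class S (repr y)).
move: (repr x) (repr y) => u v {x y}.
have -> : a *: quot_class S u + quot_class S v = quot_class S (a *: u + v).
  by rewrite /quot_class -quot_addE -quot_scaleE.
by rewrite !quot_liftE fL.
Qed.

End Quotient.

Lemma quot_class_linear (R : pzRingType) (V : lmodType R) (S : V -> Prop) a :
  {morph quot_class S : u v / a *: u + v}.
Proof. by move=> u v; rewrite /quot_class -quot_addE -quot_scaleE. Qed.

Lemma quot_class0 (R : pzRingType) (V : lmodType R) (S : V -> Prop) v :
  lspan S v -> quot_class S v = 0.
Proof. by move=> Sv; apply/quot_eqP; rewrite subr0; apply/in_lspanP. Qed.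

(** * Dual families and triangular systems *)

Lemma dual_sum (R : pzRingType) (V : lmodType R) (I : finType) (P : pred I)
    (b : I -> V) (f : I -> V -> R) x :
  (forall i, f i 0 = 0) -> (forall i a u v, f i (a *: u + v) = a * f i u + f i v) ->
  (forall i j, P i -> P j -> f i (b j) = (i == j)%:R) ->
  lspan (fun v => exists2 i, P i & v = b i) x -> x = \sum_(i | P i) f i x *: b i.
Proof.
move=> f0 fL fb; apply: (lspan_min (P := fun x => x = \sum_(i | P i) f i x *: b i)).
  split=> [|a u v uE vE]; first by rewrite big1 // => i _; rewrite f0 scale0r.
  rewrite {1}uE {1}vE scaler_sumr -big_split /=; apply: eq_bigr => i _.
  by rewrite fL scalerA -scalerDl.
move=> _ [i Pi ->]; rewrite (bigD1 i) //= fb // eqxx scale1r big1 ?addr0 //.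
by move=> j /andP[Pj /negPf ji]; rewrite fb // ji scale0r.
Qed.

(* Subtracting from [x i] the contributions of larger rank, repeatedly, turns a
   unitriangular system into a dual one. *)
Section Triangular.
Variables (R : pzRingType) (M : lmodType R) (I : finType) (P : pred I).
Variables (rk : I -> nat) (x : I -> M) (f : I -> M -> R).
Hypothesis f0 : forall i, f i 0 = 0.
Hypothesis fL : forall i a u v, f i (a *: u + v) = a * f i u + f i v.
Hypothesis f_diag : forall i, P i -> f i (x i) = 1.
Hypothesis f_tri : forall i j, P i -> P j -> i != j -> (rk j <= rk i)%N ->
  f j (x i) = 0.

(** [t] is fuel: the recursion climbs to strictly larger ranks, and under the bound of [tri_dual]
    the value 0 at empty fuel is never reached. *)
Fixpoint tri (t : nat) (i : I) : M :=
  if t is t'.+1 then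
    x i - \sum_(j | P j && (rk i < rk j)%N) f j (x i) *: tri t' j
  else 0.

Lemma tri_span t i : P i -> lspan (fun v => exists2 j, P j & v = x j) (tri t i).
Proof.
elim: t i => [|t IHt] i Pi; first exact: lspan0.
apply: lspanB; first by apply: lspan_gen; exists i.
by apply: lspan_sum => j /andP[Pj _]; apply/lspanZ/IHt.
Qed.

Lemma tri_fsum k (Q : pred I) (c : I -> R) (y : I -> M) :
  f k (\sum_(j | Q j) c j *: y j) = \sum_(j | Q j) c j * f k (y j).
Proof.
elim/big_rec2: _ => [|j a v _ <-]; [exact: f0|exact: fL].
Qed.

Lemma tri_dual t i k : (forall j, P j -> rk j < rk i + t)%N -> P i -> P k ->
  f k (tri t i) = (k == i)%:R.
Proof.
elim: t i => [|t IHt] i ht Pi Pk; first by have := ht i Pi; rewrite addn0 ltnn.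
rewrite /= -scaleN1r addrC fL mulN1r tri_fsum.
under eq_bigr => j /andP[Pj ij].
  rewrite IHt //; last by move=> l Pl; apply: leq_trans (ht l Pl) _; lia.
  over.
(* For [k] of larger rank, the sum removes exactly the value of [f k] at [x i]; otherwise no summand
   is seen by [f k], and [f_diag] or [f_tri] decides. *)
have [ik|ki] := ltnP (rk i) (rk k).
  rewrite (bigD1 k) ?Pk //= eqxx mulr1 big1 ?addr0 => [|j /andP[_ /negPf]].
    by rewrite addNr; case: eqP ik => // ->; rewrite ltnn.
  by rewrite eq_sym => ->; rewrite mulr0.
rewrite big1 ?oppr0 ?add0r => [|j /andP[_ ij]]; last first.
  by case: eqP ij => [<-|]; rewrite ?mulr0 //; rewrite ltnNge ki.
by have [->|ki'] := eqVneq k i; [apply: f_diag|apply: f_tri; rewrite 1?eq_sym].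
Qed.

Lemma triangular_dual : exists p : I -> M,
  [/\ forall i, P i -> lspan (fun v => exists2 j, P j & v = x j) (p i),
      forall i k, P i -> P k -> f k (p i) = (k == i)%:R
    & forall i, P i -> lspan (fun v => exists2 j, P j & v = p j) (x i)].
Proof.
set N := (\max_i rk i).+1.
have rkN j : (rk j < N)%N by rewrite ltnS; apply: leq_bigmax.
have triN i k : P i -> P k -> f k (tri N i) = (k == i)%:R.
  by move=> Pi Pk; apply: tri_dual => // j _; apply: leq_trans (rkN j) (leq_addl _ _).
exists (tri N); split=> [i Pi||i Pi]; [exact: tri_span|by []|].
have -> : x i = tri N.+1 i + \sum_(j | P j && (rk i < rk j)%N) f j (x i) *: tri N j.
  by rewrite /= subrK.
apply: lspanD; last first.
  by apply: lspan_sum => j /andP[Pj _]; apply/lspanZ/lspan_gen; exists j.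
(* Since [N] exceeds every rank, one more unit of fuel changes nothing, and unfolding [tri N.+1 i]
   expresses [x i] through the dual elements. *)
suff -> : tri N.+1 i = tri N i by apply: lspan_gen; exists i.
have stab t j : (forall l, P l -> rk l < rk j + t)%N -> P j ->
    tri t.+1 j = tri t j.
  elim: t j => [|t IHt] j ht Pj; first by have := ht j Pj; rewrite addn0 ltnn.
  rewrite [LHS]/= [RHS]/=; congr (_ - _); apply: eq_bigr => l /andP[Pl jl].
  by rewrite -IHt // => l' Pl'; apply: leq_trans (ht l' Pl') _; lia.
by apply: stab => // j _; apply: leq_trans (rkN j) (leq_addl _ _).
Qed.

End Triangular.

Lemma linear_ext (R : pzRingType) (M N : lmodType R) (f g : {linear M -> N}) :
  f =1 g -> f = g.
Proof.
case: f g => f [[fA] [fZ]] [g [[gA] [gZ]]] /= /funext fg.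
by move: gA gZ; rewrite -fg => gA gZ; rewrite (Prop_irrelevance fA gA)
  (Prop_irrelevance fZ gZ).
Qed.

(** Duality yields the expansions of [x] with coefficients [B x (p j)] and of [y] with coefficients
    [B (q j) y]. A linear form is thus determined by its values on the opposite family, and these
    values are the coefficients of its preimage. *)
Lemma perfect_dual_bases (R : comPzRingType) (M N : lmodType R) (I : finType)
    (P : pred I) (B : M -> N -> R) (q : I -> M) (p : I -> N) :
  (forall y a, {morph B^~ y : u v / a *: u + v >-> a * u + v}) ->
  (forall x a, {morph B x : u v / a *: u + v >-> a * u + v}) ->
  (forall x, lspan (fun v => exists2 i, P i & v = q i) x) ->
  (forall y, lspan (fun v => exists2 i, P i & v = p i) y) ->
  (forall i j, P i -> P j -> B (q i) (p j) = (i == j)%:R) ->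
  perfect_pairing B.
Proof.
move=> BlL BrL q_span p_span Bqp.
have Bl0 y : B 0 y = 0 by have := BlL y (-1) 0 0; rewrite scaler0 addr0 mulN1r addNr.
have Br0 x : B x 0 = 0 by have := BrL x (-1) 0 0; rewrite scaler0 addr0 mulN1r addNr.
have B_suml y (c : I -> R) (z : I -> M) :
    B (\sum_(j | P j) c j *: z j) y = \sum_(j | P j) c j * B (z j) y.
  by elim/big_rec2: _ => [|j a v _ <-]; rewrite ?Bl0 ?BlL.
have B_sumr x (c : I -> R) (z : I -> N) :
    B x (\sum_(j | P j) c j *: z j) = \sum_(j | P j) c j * B x (z j).
  by elim/big_rec2: _ => [|j a v _ <-]; rewrite ?Br0 ?BrL.
have qE x : x = \sum_(j | P j) B x (p j) *: q j.
  apply: (dual_sum (f := fun j x => B x (p j))) (q_span x) => [j|j|i j Pi Pj].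
  - exact: Bl0.
  - exact: BlL.
  - by rewrite Bqp // eq_sym.
have pE y : y = \sum_(j | P j) B (q j) y *: p j.
  apply: (dual_sum (f := fun j y => B (q j) y)) (p_span y) => [j|j|i j Pi Pj].
  - exact: Br0.
  - exact: BrL.
  - exact: Bqp.
pose lmx x := GRing.isLinear.Build R N R^o _ (B x) (BrL x).
pose rmx y := GRing.isLinear.Build R M R^o _ (B^~ y) (BlL y).
pose l x : {linear N -> R^o} := HB.pack (B x : N -> R^o) (lmx x).
pose r y : {linear M -> R^o} := HB.pack (B^~ y : M -> R^o) (rmx y).
exists l, r; split=> //.
- exists (fun phi : {linear N -> R^o} => \sum_(j | P j) phi (p j) *: q j) => [x|phi].
    by rewrite -qE.
  apply: linear_ext => y; rewrite [LHS]B_suml.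
  rewrite [in RHS](pE y) linear_sum; apply: eq_bigr => j _.
  by rewrite linearZ /= mulrC.
- exists (fun phi : {linear M -> R^o} => \sum_(j | P j) phi (q j) *: p j) => [y|phi].
    by rewrite -pE.
  apply: linear_ext => x; rewrite [LHS]B_sumr.
  rewrite [in RHS](qE x) linear_sum; apply: eq_bigr => j _.
  by rewrite linearZ /= mulrC.
Qed.

(** * Evaluating expressions on a vertex set *)

Lemma disjoint_setUl (I : finType) (A B C : {set I}) :
  [disjoint A :|: B & C] = [disjoint A & C] && [disjoint B & C].
Proof. by rewrite -!setI_eq0 setIUl setU_eq0. Qed.

Lemma disjoint_setUr (I : finType) (A B C : {set I}) :
  [disjoint C & A :|: B] = [disjoint C & A] && [disjoint C & B].
Proof. by rewrite -!setI_eq0 setIUr setU_eq0. Qed.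

Section Evaluation.
Variables (R : comPzRingType) (n : nat).
Local Notation T := 'I_n.
Implicit Types (A B C V : {set T}) (x y : expr R n).

Definition part2 V A B := [disjoint A & B] && (A :|: B == V).
Definition part3 V A B C :=
  [&& [disjoint A & B], [disjoint A & C], [disjoint B & C] & A :|: B :|: C == V].

(** The convolution product of set functions, twisted by a weight on the ordered splitting; the
    brackets and the commutative product are all interpreted by it. *)
Definition conv (w : {set T} -> {set T} -> R) (f g : {set T} -> R) V : R :=
  \sum_A \sum_(B | part2 V A B) w A B * f A * g B.

Section Weights.
Variables (z : {set T} -> {set T} -> R) (s : color -> {set T} -> {set T} -> R).

Fixpoint ev x : {set T} -> R :=
  match x with
  | Var i => fun V => (V == [set i])%:R
  | Zero => fun=> 0
  | Add x y => fun V => ev x V + ev y V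
  | Scale a x => fun V => a * ev x V
  | Bra c x y => conv (s c) (ev x) (ev y)
  | Mul x y => conv z (ev x) (ev y)
  end.

End Weights.

(** [z] is symmetric and multiplicative, and each [s c] is antisymmetric and a derivation over [z]:
    this is what the identities of the algebra ask of weights. *)
Record weight_axioms (z : {set T} -> {set T} -> R)
    (s : color -> {set T} -> {set T} -> R) : Prop := WeightAxioms {
  wt_zC : forall A B, [disjoint A & B] -> z A B = z B A;
  wt_sN : forall c A B, [disjoint A & B] -> s c A B = - s c B A;
  wt_zU : forall A B C, [disjoint A & B] -> [disjoint A & C] -> [disjoint B & C] ->
    z A (B :|: C) = z A B * z A C;
  wt_sU : forall c A B C, [disjoint A & B] -> [disjoint A & C] ->
    [disjoint B & C] ->
    s c A (B :|: C) = s c A B * z A C + z A B * s c A C }.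

Lemma part2C V A B : part2 V A B = part2 V B A.
Proof. by rewrite /part2 disjoint_sym setUC. Qed.

(** The scalar is 1 for commutativity of the product and -1 for antisymmetry of a bracket. *)
Lemma conv_sym w w' f g V a :
  (forall A B, [disjoint A & B] -> w A B = a * w' B A) ->
  conv w f g V = a * conv w' g f V.
Proof.
move=> ww'; rewrite /conv (exchange_big_dep predT) //= mulr_sumr; apply: eq_bigr => B _.
rewrite mulr_sumr; apply: eq_big => [A|A]; first by rewrite part2C.
by case/andP=> dAB _; rewrite ww' // -!mulrA; congr (_ * (_ * _)); rewrite mulrC.
Qed.

Lemma convDl w f g h V :
  conv w (fun A => f A + g A) h V = conv w f h V + conv w g h V.
Proof.
rewrite -big_split; apply: eq_bigr => A _; rewrite -big_split.
by apply: eq_bigr => B _ /=; ring.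
Qed.

Lemma convDr w f g h V :
  conv w f (fun A => g A + h A) V = conv w f g V + conv w f h V.
Proof.
rewrite -big_split; apply: eq_bigr => A _; rewrite -big_split.
by apply: eq_bigr => B _ /=; ring.
Qed.

Lemma convZl w a f g V : conv w (fun A => a * f A) g V = a * conv w f g V.
Proof.
rewrite mulr_sumr; apply: eq_bigr => A _; rewrite mulr_sumr.
by apply: eq_bigr => B _ /=; ring.
Qed.

Lemma convZr w a f g V : conv w f (fun A => a * g A) V = a * conv w f g V.
Proof.
rewrite mulr_sumr; apply: eq_bigr => A _; rewrite mulr_sumr.
by apply: eq_bigr => B _ /=; ring.
Qed.

Lemma eq_conv w f f' g g' V : f =1 f' -> g =1 g' -> conv w f g V = conv w f' g' V.
Proof.
move=> ff' gg'; apply: eq_bigr => A _; apply: eq_bigr => B _.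
by rewrite ff' gg'.
Qed.

Definition conv3 (w : {set T} -> {set T} -> {set T} -> R)
    (f g h : {set T} -> R) V : R :=
  \sum_A \sum_B \sum_(C | part3 V A B C) w A B C * (f A * g B * h C).

Lemma part3_2 V A B C W :
  part2 V A W && part2 W B C = part3 V A B C && (W == B :|: C).
Proof.
rewrite /part2 /part3; have [->|] := eqVneq W (B :|: C); last first.
  by rewrite !andbF.
rewrite !andbT setUA -!setI_eq0 setIUr setU_eq0.
by case: (A :&: B == _); case: (A :&: C == _); case: (B :&: C == _) => //=; rewrite ?andbT ?andbF.
Qed.

(** The inner splitting fixes the intermediate set as [B :|: C]. Nested convolutions thereby become
    sums over ordered tripartitions, where identities can be checked weight by weight. *)
Lemma conv_conv w w' f g h V :
  conv w f (conv w' g h) V =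
  conv3 (fun A B C => w A (B :|: C) * w' B C) f g h V.
Proof.
rewrite /conv /conv3; apply: eq_bigr => A _.
under eq_bigr => W _.
  rewrite mulr_sumr; under eq_bigr => B _ do rewrite mulr_sumr big_mkcond.
  over.
rewrite (exchange_big_dep predT) //=; apply: eq_bigr => B _.
rewrite (exchange_big_dep predT) //=.
rewrite [RHS]big_mkcond; apply: eq_bigr => C _.
rewrite big_mkcond (bigD1 (B :|: C)) //= [X in _ + X]big1 ?addr0 => [|W WBC].
  have := part3_2 V A B C (B :|: C); rewrite eqxx andbT => <-.
  by case: (part2 V _ _) => //=; case: (part2 _ B C) => //=; ring.
have := part3_2 V A B C W; rewrite (negPf WBC) andbF.
by case: (part2 V A W) => //= ->.
Qed.

Lemma part3_rot V A B C : part3 V A B C = part3 V B C A.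
Proof.
rewrite /part3 [in RHS]setUC setUA ![[disjoint _ & A]]disjoint_sym.
by case: [disjoint A & B]; case: [disjoint A & C]; case: [disjoint B & C].
Qed.

Lemma part3_swap V A B C : part3 V A B C = part3 V B A C.
Proof.
rewrite /part3 [A :|: B]setUC [[disjoint B & A]]disjoint_sym.
by case: [disjoint A & B]; case: [disjoint A & C]; case: [disjoint B & C].
Qed.

Lemma conv3_rot w f g h V :
  conv3 w f g h V = conv3 (fun B C A => w A B C) g h f V.
Proof.
rewrite /conv3 exchange_big; apply: eq_bigr => B _.
under eq_bigr => A _ do rewrite big_mkcond.
rewrite exchange_big; apply: eq_bigr => C _; rewrite [RHS]big_mkcond.
by apply: eq_bigr => A _ /=; rewrite part3_rot; case: ifP => // _; ring.
Qed.

Lemma conv3_swap w f g h V :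
  conv3 w f g h V = conv3 (fun B A C => w A B C) g f h V.
Proof.
rewrite /conv3 exchange_big; apply: eq_bigr => B _; apply: eq_bigr => A _.
by apply: eq_big => [C|C _]; [apply: part3_swap|ring].
Qed.

Lemma conv3D w w' f g h V :
  conv3 w f g h V + conv3 w' f g h V =
  conv3 (fun A B C => w A B C + w' A B C) f g h V.
Proof.
rewrite -big_split; apply: eq_bigr => A _; rewrite -big_split.
apply: eq_bigr => B _; rewrite -big_split; apply: eq_bigr => C _ /=.
by rewrite -mulrDl.
Qed.

Lemma eq_conv3 w w' f g h V :
  (forall A B C, [disjoint A & B] -> [disjoint A & C] -> [disjoint B & C] ->
    w A B C = w' A B C) -> conv3 w f g h V = conv3 w' f g h V.
Proof.
move=> ww'; apply: eq_bigr => A _; apply: eq_bigr => B _; apply: eq_bigr => C.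
by case/and4P=> AB AC BC _; rewrite ww'.
Qed.

Lemma conv3_0 w f g h V :
  (forall A B C, [disjoint A & B] -> [disjoint A & C] -> [disjoint B & C] ->
    w A B C = 0) -> conv3 w f g h V = 0.
Proof.
move=> w0; rewrite /conv3 big1 // => A _; rewrite big1 // => B _.
by rewrite big1 // => C /and4P[AB AC BC _]; rewrite w0 ?mul0r.
Qed.

Section Invariance.
Variables (z : {set T} -> {set T} -> R) (s : color -> {set T} -> {set T} -> R).
Hypothesis wt : weight_axioms z s.

(** Once the three terms are rotated to the same order of arguments, [wt_sU] expands them into six
    products of two values of [s c] and one of [z], which cancel in pairs by antisymmetry. *)
Lemma conv_jacobi c f g h V :
  conv (s c) f (conv (s c) g h) V + conv (s c) g (conv (s c) h f) V
  + conv (s c) h (conv (s c) f g) V = 0.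
Proof.
rewrite !conv_conv [conv3 _ g h f V]conv3_rot ![conv3 _ h f g V]conv3_rot !conv3D.
apply: conv3_0 => A B C AB AC BC.
have [BA CA CB] : [/\ [disjoint B & A], [disjoint C & A] & [disjoint C & B]].
  by rewrite ![[disjoint C & _]]disjoint_sym [[disjoint B & _]]disjoint_sym.
rewrite !(wt_sU wt) // (wt_zC wt BA) (wt_zC wt CA) (wt_zC wt CB).
rewrite !(wt_sN wt _ BA) !(wt_sN wt _ CA) !(wt_sN wt _ CB); ring.
Qed.

(** The polarization of the Jacobi cancellation: each product now cancels against one with the two
    colours nested the other way. *)
Lemma conv_mixed c d f g h V :
  conv (s c) f (conv (s d) g h) V + conv (s c) g (conv (s d) h f) V
  + conv (s c) h (conv (s d) f g) V
  + (conv (s d) f (conv (s c) g h) V + conv (s d) g (conv (s c) h f) V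
  + conv (s d) h (conv (s c) f g) V) = 0.
Proof.
rewrite !conv_conv ![conv3 _ g h f V]conv3_rot ![conv3 _ h f g V]conv3_rot !conv3D.
apply: conv3_0 => A B C AB AC BC.
have [BA CA CB] : [/\ [disjoint B & A], [disjoint C & A] & [disjoint C & B]].
  by rewrite ![[disjoint C & _]]disjoint_sym [[disjoint B & _]]disjoint_sym.
rewrite !(wt_sU wt) // (wt_zC wt BA) (wt_zC wt CA) (wt_zC wt CB).
rewrite !(wt_sN wt _ BA) !(wt_sN wt _ CA) !(wt_sN wt _ CB); ring.
Qed.

Lemma conv_mulC f g V : conv z f g V = conv z g f V.
Proof.
by rewrite (@conv_sym z z f g V 1) ?mul1r // => A B /(wt_zC wt)->;
  rewrite mul1r.
Qed.

Lemma conv_mulA f g h V : conv z f (conv z g h) V = conv z (conv z f g) h V.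
Proof.
rewrite conv_mulC [in RHS]conv_mulC.
rewrite -[LHS]conv_mulC !conv_conv [in RHS]conv3_rot.
apply: eq_conv3 => A B C AB AC BC.
have [CA CB] : [disjoint C & A] /\ [disjoint C & B].
  by rewrite ![[disjoint C & _]]disjoint_sym.
by rewrite !(wt_zU wt) // (wt_zC wt CA) (wt_zC wt CB); ring.
Qed.

Lemma conv_leibniz c f g h V :
  conv (s c) f (conv z g h) V =
  conv z (conv (s c) f g) h V + conv z g (conv (s c) f h) V.
Proof.
rewrite [conv z (conv _ _ _) _ _]conv_mulC !conv_conv.
rewrite [conv3 _ h f g V]conv3_rot [conv3 _ g f h V]conv3_swap conv3D.
apply: eq_conv3 => A B C AB AC BC.
have [BA CA CB] : [/\ [disjoint B & A], [disjoint C & A] & [disjoint C & B]].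
  by rewrite ![[disjoint C & _]]disjoint_sym [[disjoint B & _]]disjoint_sym.
rewrite !(wt_zU wt) // (wt_sU wt) // (wt_zC wt BA) (wt_zC wt CA) (wt_zC wt CB).
ring.
Qed.

(** Every constructor of the congruence corresponds to an identity between convolutions, so
    evaluation descends to the whole free algebra. *)
Lemma ev_alg_eq x y : alg_eq x y -> ev z s x =1 ev z s y.
Proof.
move=> xy; elim: {x y}xy => /=.
- by [].
- by move=> x y _ xy V.
- by move=> x y w _ xy _ yw V; rewrite xy.
- by move=> x x' y y' _ xx' _ yy' V; rewrite xx' yy'.
- by move=> a x x' _ xx' V; rewrite xx'.
- by move=> c x x' y y' _ xx' _ yy' V; apply: eq_conv.
- by move=> x x' y y' _ xx' _ yy' V; apply: eq_conv.
- by move=> x y w V; rewrite addrA.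
- by move=> x y V; rewrite addrC.
- by move=> x V; rewrite add0r.
- by move=> x V; rewrite mulN1r addNr.
- by move=> a b x V; rewrite mulrA.
- by move=> x V; rewrite mul1r.
- by move=> a x y V; rewrite mulrDr.
- by move=> a b x V; rewrite mulrDl.
- by move=> c x y w V; rewrite convDl.
- by move=> c a x y V; rewrite convZl.
- by move=> c x y w V; rewrite convDr.
- by move=> c a x y V; rewrite convZr.
- by move=> x y w V; rewrite convDl.
- by move=> a x y V; rewrite convZl.
- by move=> x y w V; rewrite conv_mulA.
- by move=> x y V; rewrite conv_mulC.
- move=> c x y V; rewrite (@conv_sym (s c) (s c) _ _ V (-1)) ?mulN1r ?addNr //.
  by move=> A B /(wt_sN wt)->; rewrite mulN1r.
- by move=> c x y w V; rewrite conv_jacobi.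
- by move=> x y w V; rewrite conv_mixed.
- by move=> c x y w V; rewrite conv_leibniz.
Qed.

Definition aev (a : free_alg R n) V : R := ev z s (repr a) V.

Lemma aevE x V : aev (alg_class x) V = ev z s x V.
Proof. exact/ev_alg_eq/alg_reprP. Qed.

Lemma aev_linear V a : {morph aev^~ V : u v / a *: u + v >-> a * u + v}.
Proof.
move=> u v; have -> : a *: u + v = alg_class (Add (Scale a (repr u)) (repr v)).
  by rewrite -[u in LHS]repr_algK -[v in LHS]repr_algK [a *: _]alg_scaleE
    [LHS]alg_addE.
by rewrite aevE.
Qed.

Lemma aev0 V : aev 0 V = 0.
Proof. by rewrite -[0]/(alg_class Zero) aevE. Qed.

End Invariance.
End Evaluation.

(** * Weights coming from a list of edges *)

Section EdgeWeights.
Variables (R : comPzRingType) (n : nat).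
Local Notation T := 'I_n.
Local Notation cedge := (color * (T * T))%type.
Implicit Types (A B C V : {set T}) (x y : expr R n) (e : cedge) (es : seq cedge).

Definition between A B e := (e.2.1 \in A) && (e.2.2 \in B).
Definition crosses A B e := between A B e || between B A e.
Definition inside A e := (e.2.1 \in A) && (e.2.2 \in A).

Definition crossings es A B : nat := count (crosses A B) es.
Definition orientation c es A B : R :=
  \sum_(e <- es | e.1 == c) ((between A B e)%:R - (between B A e)%:R).

Definition zwt es A B : R := (crossings es A B == 0%N)%:R.
(** Edges of all colours count as crossings but only colour [c] is oriented: on disjoint sets the
    weight is a sign if the unique crossing edge has colour [c], and 0 otherwise. *)
Definition swt es c A B : R := (crossings es A B == 1%N)%:R * orientation c es A B.

Lemma crossesC A B e : crosses A B e = crosses B A e.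
Proof. by rewrite /crosses orbC. Qed.

Lemma crossings0 es A B c : crossings es A B = 0%N -> orientation c es A B = 0.
Proof.
move/eqP; rewrite -leqn0 leqNgt -has_count => /hasPn es0.
rewrite /orientation big_seq_cond big1 // => e /andP[/es0].
by rewrite negb_or => /andP[/negPf-> /negPf->] _; rewrite subrr.
Qed.

Lemma crossingsU es A B C : [disjoint A & B] -> [disjoint A & C] ->
  [disjoint B & C] ->
  crossings es A (B :|: C) = (crossings es A B + crossings es A C)%N.
Proof.
move=> AB AC BC; rewrite /crossings -count_predUI.
rewrite [X in (_ + X)%N](_ : _ = 0%N) ?addn0.
  apply: eq_count => e; rewrite /= /crosses /between !inE.
  by do 6?case: (_ \in _).
apply/eqP; rewrite -leqn0 leqNgt -has_count; apply/hasPn => e _ /=.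
have dis (D E : {set T}) u : [disjoint D & E] -> ((u \in D) && (u \in E)) = false.
  by rewrite -setI_eq0 -in_setI => /eqP->; rewrite inE.
move: (dis _ _ e.2.1 AB) (dis _ _ e.2.1 AC) (dis _ _ e.2.1 BC).
move: (dis _ _ e.2.2 AB) (dis _ _ e.2.2 AC) (dis _ _ e.2.2 BC).
by rewrite /crosses /between; do 6?case: (_ \in _).
Qed.

Lemma orientationU c es A B C : [disjoint A & B] -> [disjoint A & C] ->
  [disjoint B & C] ->
  orientation c es A (B :|: C) = orientation c es A B + orientation c es A C.
Proof.
move=> AB AC BC; rewrite -big_split; apply: eq_bigr => e _ /=.
have hU (u : T) : (u \in B :|: C)%:R = (u \in B)%:R + (u \in C)%:R :> R.
  move: BC; rewrite -setI_eq0 inE => /eqP/setP/(_ u); rewrite !inE.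
  by case: (u \in B); case: (u \in C) => //=; rewrite ?addr0 ?add0r.
by rewrite /between -!mulnb !natrM !hU; ring.
Qed.

Lemma edge_weight_axioms es : weight_axioms (zwt es) (swt es).
Proof.
have crossingsC A B : crossings es A B = crossings es B A.
  by apply: eq_count => e; apply: crossesC.
split=> [A B _|c A B _|A B C AB AC BC|c A B C AB AC BC].
- by rewrite /zwt crossingsC.
- rewrite /swt crossingsC -mulrN -sumrN; congr (_ * _).
  by apply: eq_bigr => e _; rewrite opprB.
- by rewrite /zwt crossingsU // addn_eq0 -mulnb natrM.
rewrite /swt /zwt crossingsU // orientationU //.
(* Exactly one crossing into [B :|: C] means one into one of the parts and none into the other,
   where the orientation vanishes too. *)
move: (@crossings0 es A B c) (@crossings0 es A C c).
case: (crossings es A B) => [/(_ erefl)->|[|k] _];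
  case: (crossings es A C) => [/(_ erefl)->|[|l] _];
  rewrite ?addnS ?addn0 ?add0n ?eqSS /=; by ring.
Qed.

End EdgeWeights.

(** * Vanishing of evaluations on the graph relations *)

Section Vanishing.
Variables (R : comPzRingType) (n : nat).
Local Notation T := 'I_n.
Local Notation cedge := (color * (T * T))%type.
Implicit Types (A B C V S : {set T}) (x y : expr R n) (e : cedge) (es : seq cedge).

(** The recursion only ever splits subsets of [V], so weights at other pairs are not consulted. *)
Lemma ev_local z s z' s' x V :
  (forall A B, [disjoint A & B] -> A :|: B \subset V ->
    z A B = z' A B /\ forall c, s c A B = s' c A B) ->
  ev z s x V = ev z' s' x V.
Proof.
have sub_part A B W : part2 W A B ->
    [/\ [disjoint A & B], A :|: B \subset W, A \subset W & B \subset W].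
  by case/andP=> AB /eqP <-; rewrite subxx subsetUl subsetUr.
elim: x V => //= [x IHx y IHy V zs|a x IHx V zs|c x IHx y IHy V zs|x IHx y IHy V zs].
- by rewrite IHx // IHy.
- by rewrite IHx.
- apply: eq_bigr => A _; apply: eq_bigr => B /sub_part[AB ABV AV BV].
  have [_ ->] := zs _ _ AB ABV.
  by rewrite IHx ?IHy // => C D CD /subset_trans CDA; apply: zs => //; apply: CDA.
- apply: eq_bigr => A _; apply: eq_bigr => B /sub_part[AB ABV AV BV].
  have [-> _] := zs _ _ AB ABV.
  by rewrite IHx ?IHy // => C D CD /subset_trans CDA; apply: zs => //; apply: CDA.
Qed.

(** [None] stands for the product and [Some c] for a bracket, so that one induction step covers
    both. *)
Definition wk (k : option color) es A B : R :=
  if k is Some c then swt R es c A B else zwt R es A B.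

Definition gev es x V : R := ev (zwt R es) (swt R es) x V.

Lemma wk_filter (P : pred cedge) k es A B :
  (forall e, crosses A B e -> P e) -> wk k (filter P es) A B = wk k es A B.
Proof.
move=> ABP; have cE : crossings (filter P es) A B = crossings es A B.
  rewrite /crossings count_filter; apply: eq_count => e /=.
  by case: (boolP (crosses _ _ _)) => //= /ABP.
have oE c : orientation R c (filter P es) A B = orientation R c es A B.
  rewrite /orientation big_filter_cond [RHS](bigID P) /=.
  rewrite [X in _ = _ + X]big1 ?addr0 => [|e /andP[_ eP]].
    by apply: eq_bigl => e; rewrite andbC.
  have := contra (ABP e) eP; rewrite negb_or => /andP[/negPf-> /negPf->].
  by rewrite subrr.
by case: k => [c|] /=; rewrite /swt /zwt cE ?oE.
Qed.

Lemma wk_perm k es es' A B : perm_eq es es' -> wk k es A B = wk k es' A B.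
Proof.
move=> es_es'; case: k => [c|] /=; rewrite /swt /zwt /crossings (permP es_es') //.
by congr (_ * _); apply: perm_big.
Qed.

(** A crossing edge exhausts the single crossing allowed: no other edge may cross, and [k] must be a
    bracket of its colour. *)
Lemma wk_cross k e es A B : crosses A B e ->
  wk k (e :: es) A B = zwt R es A B * (k == Some e.1)%:R *
                       ((between A B e)%:R - (between B A e)%:R).
Proof.
move=> eAB; rewrite /wk /swt /zwt /crossings /= eAB add1n.
case: k => [c|]; last by rewrite mulr0 mul0r.
have [es0|es0] := eqVneq (count (crosses A B) es) 0%N; last first.
  by rewrite eqSS (negPf es0) !mul0r.
rewrite es0 eqxx !mul1r /orientation big_cons -/(orientation R c es A B).
rewrite (_ : (Some c == Some e.1) = (e.1 == c)); last first.
  by apply/eqP/eqP => [[]|->].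
by rewrite crossings0 //; case: eqP => _; rewrite ?mul1r ?mul0r ?addr0.
Qed.

Lemma wk_nocross k e es A B : ~~ crosses A B e ->
  wk k (e :: es) A B = wk k es A B.
Proof.
move=> eAB; rewrite -[RHS](@wk_filter (crosses A B)) // -[LHS](@wk_filter (crosses A B)) //=.
by rewrite (negPf eAB).
Qed.

Lemma wk_cons k e es A B : wk k (e :: es) A B =
  if crosses A B e then zwt R es A B * (k == Some e.1)%:R *
                       ((between A B e)%:R - (between B A e)%:R)
  else wk k es A B.
Proof. by case: ifPn => eAB; [apply: wk_cross|apply: wk_nocross]. Qed.

Lemma zwt_cons e es A B : zwt R (e :: es) A B =
  if crosses A B e then 0 else zwt R es A B.
Proof. by rewrite /zwt /crossings /=; case: ifP. Qed.

Lemma gev_filter es x V : gev es x V = gev (filter (inside V) es) x V.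
Proof.
apply: ev_local => A B _ ABV.
have crossV e : crosses A B e -> inside V e.
  rewrite /inside => /orP[]/andP[e1 e2]; apply/andP;
  by split; apply: (subsetP ABV); rewrite inE ?e1 ?e2 ?orbT.
split=> [|c]; first by have := @wk_filter _ None es _ _ crossV.
by have := @wk_filter _ (Some c) es _ _ crossV.
Qed.

Lemma gev_perm es es' x V : perm_eq es es' -> gev es x V = gev es' x V.
Proof.
move=> es_es'; apply: ev_local => A B _ _; split=> [|c].
  exact: (wk_perm None).
exact: (wk_perm (Some c)).
Qed.

Section Family.
Variables (fam : seq (seq cedge)) (S : {set T}).
Hypothesis S_gt1 : (1 < #|S|)%N.
Hypothesis fam_out : {in fam &, forall es es',
  perm_eq [seq e <- es | ~~ inside S e] [seq e <- es' | ~~ inside S e]}.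
Hypothesis fam_split : forall k A B x y, [disjoint A & B] -> S \subset A :|: B ->
  ~~ (S \subset A) -> ~~ (S \subset B) ->
  \sum_(es <- fam) wk k es A B * gev es x A * gev es y B = 0.

(** When [S] lies on one side, no edge inside [S] crosses, and the family agrees on all other
    edges. *)
Lemma fam_wk k A B : [disjoint A & B] -> S \subset A \/ S \subset B ->
  {in fam &, forall es es', wk k es A B = wk k es' A B}.
Proof.
move=> AB SAB es es' /fam_out h /h {h}es_es'.
have outS e : crosses A B e -> ~~ inside S e.
  move=> eAB; apply/negP => /andP[e1 e2].
  have dis u : u \in A -> u \in B -> False by move=> /(disjointFr AB)->.
  by case: SAB => /subsetP SA; case/orP: eAB => /andP[] *;
    [apply: (dis e.2.2)|apply: (dis e.2.1)|apply: (dis e.2.1)|apply: (dis e.2.2)];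
    rewrite ?SA.
by rewrite -(wk_filter k es outS) -(wk_filter k es' outS); apply: wk_perm.
Qed.

Lemma fam_gev x V : [disjoint V & S] ->
  {in fam &, forall es es', gev es x V = gev es' x V}.
Proof.
move=> VS es es' /fam_out h /h {h}es_es'.
have VSE es'' : filter (inside V) es'' =
    filter (inside V) (filter (fun e => ~~ inside S e) es'').
  rewrite -filter_predI; apply: eq_filter => e /=.
  by rewrite /inside; case: (boolP (e.2.1 \in V)) => //= /(disjointFr VS)->;
    rewrite andbT.
rewrite gev_filter [RHS]gev_filter VSE [in RHS]VSE; apply: gev_perm.
exact: perm_filter.
Qed.

(** The lists of the family differ only inside [S]. While descending through an expression, as long
    as [S] stays in one part, the crossing weight and the value on the other part are common to the
    family and factor out; where [S] is first separated, [fam_split] applies. A variable cannot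
    carry [S], which has at least two elements. *)
Lemma family_vanish x V : S \subset V -> \sum_(es <- fam) gev es x V = 0.
Proof.
have step k x' y' : (forall V, S \subset V -> \sum_(es <- fam) gev es x' V = 0) ->
    (forall V, S \subset V -> \sum_(es <- fam) gev es y' V = 0) ->
    forall V, S \subset V -> \sum_(es <- fam)
      \sum_A \sum_(B | part2 V A B) wk k es A B * gev es x' A * gev es y' B = 0.
  move=> IHx IHy W SW; rewrite exchange_big big1 //= => A _.
  rewrite exchange_big big1 //= => B /andP[AB /eqP ABW].
  have pull (F : seq cedge -> R) (G : seq cedge -> R) :
      {in fam &, forall es es', F es = F es'} -> \sum_(es <- fam) G es = 0 ->
      \sum_(es <- fam) F es * G es = 0.
    case: (fam) => [|es0 fam'] FE; first by rewrite !big_nil.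
    move=> G0; rewrite big_seq (eq_bigr (fun es => F es0 * G es)).
      by rewrite -big_seq -mulr_sumr G0 mulr0.
    by move=> es es_fam; rewrite (FE es es0) // mem_head.
  have [SA|SA] := boolP (S \subset A).
    under eq_bigr => es _ do rewrite mulrAC.
    apply: pull (IHx A SA) => es es' he he'; congr (_ * _).
      by apply: fam_wk => //; left.
    apply: fam_gev he he'; rewrite disjoint_sym; apply: disjointWl SA AB.
  have [SB|SB] := boolP (S \subset B).
    apply: pull (IHy B SB) => es es' he he'; congr (_ * _).
      by apply: fam_wk => //; right.
    by apply: fam_gev he he'; apply: disjointWr SB AB.
  by apply: fam_split; rewrite ?ABW.
elim: x V => [i||x IHx y IHy|a x IHx|c x IHx y IHy|x IHx y IHy] V SV.
- rewrite big1 // => es _; rewrite /gev /=; case: eqP => // Vi.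
  by have := leq_trans S_gt1 (subset_leq_card SV); rewrite Vi cards1.
- by rewrite big1.
- by rewrite big_split /= IHx // IHy // addr0.
- by rewrite -mulr_sumr IHx // mulr0.
- exact: (step (Some c)).
- exact: (step None).
Qed.

End Family.

Lemma gev_anti c i j es x V : i != j -> i \in V -> j \in V ->
  gev ((c, (i, j)) :: es) x V + gev ((c, (j, i)) :: es) x V = 0.
Proof.
move=> ij iV jV; pose fam := [:: (c, (i, j)) :: es; (c, (j, i)) :: es].
have -> : gev ((c, (i, j)) :: es) x V + gev ((c, (j, i)) :: es) x V =
    \sum_(es' <- fam) gev es' x V by rewrite !big_cons big_nil addr0.
apply: (@family_vanish fam [set i; j]).
- by rewrite cards2 ij.
- move=> e1 e2; rewrite !inE => /orP[]/eqP-> /orP[]/eqP-> /=;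
  by rewrite /inside /= !inE !eqxx !orbT.
- move=> k A B x' y' AB SAB SA SB.
  under eq_bigr => es' _ do rewrite gev_filter [gev es' y' B]gev_filter.
  rewrite !big_cons big_nil addr0.
  have dis u : (u \in A) && (u \in B) = false.
    by rewrite -in_setI; move: AB; rewrite -setI_eq0 => /eqP->; rewrite inE.
  move: SAB SA SB (dis i) (dis j); rewrite !subUset !sub1set !inE.
  case iA: (i \in A); case iB: (i \in B); case jA: (j \in A); case jB: (j \in B) => //= _ _ _ _ _.
  + by rewrite !wk_cons /crosses /between /= /inside /= ?iA ?iB ?jA ?jB /=; ring.
  + by rewrite !wk_cons /crosses /between /= /inside /= ?iA ?iB ?jA ?jB /=; ring.
- by apply/subsetP => u; rewrite !inE => /orP[]/eqP->.
Qed.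

(** A list of colour pairs stable under exchange treats both relations at once: the pair (c, c)
    gives Jacobi, the pairs (blue, red) and (red, blue) give the mixed relation. *)
Lemma gev_cycle (cds : seq (color * color)) i j k es x V :
  perm_eq [seq (p.2, p.1) | p <- cds] cds -> i != j ->
  i \in V -> j \in V -> k \in V ->
  \sum_(p <- cds) (gev ((p.1, (i, j)) :: (p.2, (j, k)) :: es) x V
    + gev ((p.1, (j, k)) :: (p.2, (k, i)) :: es) x V
    + gev ((p.1, (k, i)) :: (p.2, (i, j)) :: es) x V) = 0.
Proof.
move=> cds_swap ij iV jV kV.
pose fam := flatten [seq [:: (p.1, (i, j)) :: (p.2, (j, k)) :: es;
  (p.1, (j, k)) :: (p.2, (k, i)) :: es; (p.1, (k, i)) :: (p.2, (i, j)) :: es]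
  | p <- cds].
have famE (F : seq cedge -> R) : \sum_(es' <- fam) F es' =
    \sum_(p <- cds) (F ((p.1, (i, j)) :: (p.2, (j, k)) :: es)
    + F ((p.1, (j, k)) :: (p.2, (k, i)) :: es)
    + F ((p.1, (k, i)) :: (p.2, (i, j)) :: es)).
  rewrite big_flatten big_map; apply: eq_bigr => p _.
  by rewrite !big_cons big_nil /= addr0 addrA.
have swapE (F : color -> color -> R) :
    \sum_(p <- cds) F p.1 p.2 = \sum_(p <- cds) F p.2 p.1.
  by rewrite -(perm_big _ cds_swap) big_map.
rewrite -(famE (fun es' => gev es' x V)); apply: (@family_vanish fam [set i; j; k]).
- by apply: leq_trans (subset_leq_card (subsetUl _ _)); rewrite cards2 ij.
- move=> e1 e2 /flattenP[_ /mapP[p _ ->] h1] /flattenP[_ /mapP[q _ ->] h2].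
  move: h1 h2; rewrite !inE.
  by case/or3P=> /eqP-> /or3P[]/eqP-> /=; rewrite /inside /= !inE !eqxx !orbT.
- move=> l A B x' y' AB SAB SA SB.
  under eq_bigr => es' _ do rewrite gev_filter [gev es' y' B]gev_filter.
  rewrite famE.
  have dis u : (u \in A) && (u \in B) = false.
    by rewrite -in_setI; move: AB; rewrite -setI_eq0 => /eqP->; rewrite inE.
  move: SAB SA SB (dis i) (dis j) (dis k); rewrite !subUset !sub1set !inE.
  have comb1 (F1 F2 F3 : color -> color -> R) :
      (forall c d, F1 c d + F2 c d + F3 d c = 0) ->
      \sum_(p <- cds) (F1 p.1 p.2 + F2 p.1 p.2 + F3 p.1 p.2) = 0.
    by move=> F0; rewrite big_split (swapE F3) -big_split big1 => //= p _.
  have comb2 (F1 F2 F3 : color -> color -> R) :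
      (forall c d, F1 c d + F2 d c + F3 c d = 0) ->
      \sum_(p <- cds) (F1 p.1 p.2 + F2 p.1 p.2 + F3 p.1 p.2) = 0.
    move=> F0; rewrite 2!big_split (swapE F2) -2!big_split big1 => //= p _.
  pose F es' := wk l es' A B * gev (filter (inside A) es') x' A *
    gev (filter (inside B) es') y' B.
  case iA: (i \in A); case iB: (i \in B); case jA: (j \in A); case jB: (j \in B);
    case kA: (k \in A); case kB: (k \in B) => //= _ _ _ _ _ _;
  (* One of the three vertices is alone on its side. The term with two crossing edges vanishes; the
     other two share the internal edge, and their crossing edges run in opposite directions. To
     match their colours, the pair is exchanged in the second term when [i] is alone, and in the
     third one otherwise. *)
  match type of jA with (_ = ?b) => match type of kA with
    (_ = b) => apply: (@comb2
      (fun c d => F ((c, (i, j)) :: (d, (j, k)) :: es))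
      (fun c d => F ((c, (j, k)) :: (d, (k, i)) :: es))
      (fun c d => F ((c, (k, i)) :: (d, (i, j)) :: es)))
  | _ => apply: (@comb1
      (fun c d => F ((c, (i, j)) :: (d, (j, k)) :: es))
      (fun c d => F ((c, (j, k)) :: (d, (k, i)) :: es))
      (fun c d => F ((c, (k, i)) :: (d, (i, j)) :: es))) end end => c d;
  rewrite /F !wk_cons !zwt_cons /crosses /between /= /inside /= ?iA ?iB ?jA ?jB ?kA ?kB /=;
  by ring.
- by apply/subsetP => u; rewrite !inE => /orP[/orP[]|]/eqP->.
Qed.

(** Two edges joining [i] and [j] cross together as soon as these vertices are separated, while
    every weight allows at most one crossing. *)
Lemma gev_multi es i j x V : i != j -> i \in V -> j \in V ->
  (1 < count (fun e => (e.2 == (i, j)) || (e.2 == (j, i))) es)%N ->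
  gev es x V = 0.
Proof.
move=> ij iV jV es2; rewrite -[LHS](big_seq1 +%R es (fun es' => gev es' x V)).
apply: (@family_vanish _ [set i; j]).
- by rewrite cards2 ij.
- by move=> e1 e2; rewrite !inE => /eqP-> /eqP->.
- move=> k A B x' y' AB SAB SA SB; rewrite big_seq1.
  suff -> : wk k es A B = 0 by rewrite !mul0r.
  have dis u : (u \in A) && (u \in B) = false.
    by rewrite -in_setI; move: AB; rewrite -setI_eq0 => /eqP->; rewrite inE.
  have : (1 < crossings es A B)%N.
    apply: leq_trans es2 (sub_count _ _) => -[c [a b]] /=.
    move: SAB SA SB (dis i) (dis j); rewrite !subUset !sub1set !inE.
    rewrite /crosses /between => + + + + + /orP[]/eqP[-> ->] /=;
    by case: (i \in A); case: (i \in B); case: (j \in A); case: (j \in B).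
  by case: k => [c|] /=; rewrite /swt /zwt; case: (crossings es A B) => [|[|m]];
    rewrite ?mul0r.
- by apply/subsetP => u; rewrite !inE => /orP[]/eqP->.
Qed.

End Vanishing.

(** * The pairing *)

Section GraphLists.
Variable n : nat.
Local Notation T := 'I_n.
Local Notation cedge := (color * (T * T))%type.
Implicit Types (G H : graph n) (es : seq cedge).

Definition elist G : seq cedge := [seq val e | e <- edges G].
Definition list_graph es : graph n := [ffun f => count_mem (val f) es].

Lemma count_edges (P : pred (edge n)) G :
  count P (edges G) = (\sum_(e | P e) G e)%N.
Proof.
rewrite /edges count_flatten -map_comp sumnE big_map big_enum [RHS]big_mkcond.
by apply: eq_bigr => e _ /=; rewrite count_nseq; case: (P e); rewrite ?mul1n.
Qed.

Lemma edges_add_edge G e : perm_eq (edges (add_edge G e)) (e :: edges G).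
Proof.
apply/permP => P /=; rewrite !count_edges.
under eq_bigr do rewrite ffunE.
rewrite big_split addnC /=; congr (_ + _)%N.
rewrite big_mkcond (bigD1 e) //= eqxx big1 => [|f /negPf->]; last by case: (P f).
by rewrite addn0; case: (P e).
Qed.

Lemma elist_add_edge G e : perm_eq (elist (add_edge G e)) (val e :: elist G).
Proof. by rewrite -map_cons; apply/perm_map/edges_add_edge. Qed.

Lemma elistK G : list_graph (elist G) = G.
Proof.
apply/ffunP => f; rewrite ffunE count_map.
rewrite (eq_count (a2 := pred1 f)) => [|e]; last by rewrite /= (inj_eq val_inj).
by rewrite count_edges (big_pred1 f).
Qed.

Lemma list_graph_cons es c i j (ij : i != j) :
  list_graph ((c, (i, j)) :: es) = add_edge (list_graph es) (arrow c ij).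
Proof.
by apply/ffunP => f; rewrite !ffunE /= addnC eq_sym.
Qed.

Lemma list_graph_perm es es' : perm_eq es es' -> list_graph es = list_graph es'.
Proof. by move=> /permP ees'; apply/ffunP => f; rewrite !ffunE. Qed.

Lemma elist_list_graph es : all (fun e => e.2.1 != e.2.2) es ->
  perm_eq (elist (list_graph es)) es.
Proof.
elim: es => [|[c [i j]] es IHes] /=.
  move=> _; have -> : list_graph [::] = [ffun=> 0%N].
    by apply/ffunP => f; rewrite !ffunE.
  rewrite /elist; suff -> : edges [ffun=> 0%N] = [::] :> seq (edge n) by [].
  by apply/nilP; rewrite /nilp -count_predT count_edges big1 // => e _; rewrite ffunE.
case/andP=> ij /IHes es_es; rewrite (list_graph_cons es c ij).
by apply: (perm_trans (elist_add_edge _ _)); rewrite perm_cons.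
Qed.

Lemma multi_edgeP G : multi_edge G -> exists i j, i != j /\
  (1 < count (fun e => (e.2 == (i, j)) || (e.2 == (j, i))) (elist G))%N.
Proof.
case/existsP=> i /existsP[j]; rewrite (eq_count
  (a2 := fun e : edge n => ((val e).2 == (i, j)) || ((val e).2 == (j, i)))) => [ij2|e].
  exists i, j; rewrite count_map; split=> //.
  have /hasP[[[c [a b]] ab] _ /=] : has (fun e : edge n =>
      ((val e).2 == (i, j)) || ((val e).2 == (j, i))) (edges G).
    by rewrite has_count (ltn_trans _ ij2).
  by move: ab => /= ab /orP[]/eqP[<- <-] //; rewrite eq_sym.
by rewrite /joins /esrc /etgt; case: (val e) => c [a b] /=; rewrite !xpair_eqE.
Qed.

Lemma multi_add_edge G e : multi_edge G -> multi_edge (add_edge G e).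
Proof.
case/existsP=> i /existsP[j ij]; apply/existsP; exists i; apply/existsP; exists j.
rewrite (permP (edges_add_edge G e)) /=; exact: leq_trans ij (leq_addl _ _).
Qed.

Lemma list_multi es i j : i != j ->
  (1 < count (fun e => (e.2 == (i, j)) || (e.2 == (j, i))) es)%N ->
  multi_edge (list_graph es).
Proof.
move=> ij es2; apply/existsP; exists i; apply/existsP; exists j.
(* [list_graph] forgets loops, so these are discarded before multiplicities are compared. *)
pose es' := filter (fun e => e.2.1 != e.2.2) es.
have -> : list_graph es = list_graph es'.
  apply/ffunP => -[[c [a b]] /= ab]; rewrite !ffunE /= /es' count_filter.
  apply: eq_count => e /=; case: eqP => // ->; exact/esym.
have := elist_list_graph (filter_all (fun e => e.2.1 != e.2.2) es).
move: es2; rewrite -/es' => es2 /permP cE.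
have : (1 < count (fun e => (e.2 == (i, j)) || (e.2 == (j, i))) es')%N.
  rewrite count_filter; apply: leq_trans es2 _; apply: sub_count => e /=.
  by case/orP=> /eqP->; rewrite eqxx ?orbT //= 1?eq_sym.
rewrite -cE count_map (eq_count (a2 := joins i j)) // => e.
Qed.

End GraphLists.

(** * The bilinear form, and adding an edge in the quotient *)

Section Pairing.
Variables (R : comPzRingType) (n : nat).
Local Notation T := 'I_n.
Local Notation cedge := (color * (T * T))%type.

Lemma gev_graph_rel (x : expr R n) (v : Gamma R n) : graph_rel v ->
  ext (M := R^o) (fun G => gev (elist G) x setT) v = 0.
Proof.
have gE1 H (e : edge n) : gev (elist (add_edge H e)) x setT =
    gev (val e :: elist H) x setT by apply/gev_perm/elist_add_edge.
have gE2 H (e f : edge n) : gev (elist (add_edge (add_edge H e) f)) x setT =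
    gev (val e :: val f :: elist H) x setT.
  rewrite gE1; apply/gev_perm/(perm_trans (y := val f :: val e :: elist H)).
    by rewrite perm_cons elist_add_edge.
  by rewrite (perm_catCA [:: val f] [:: val e]).
have extD u w : ext (M := R^o) (fun G => gev (elist G) x setT) (u + w) =
    ext (M := R^o) (fun G => gev (elist G) x setT) u +
    ext (M := R^o) (fun G => gev (elist G) x setT) w.
  by have := ext_linear (M := R^o) (fun G => gev (elist G) x setT) 1 u w;
    rewrite !scale1r.
case=> [H c i j ij ji|H c i j k ij jk ki|H i j k ij jk ki|G /multi_edgeP[i [j [ij G2]]]].
- by rewrite extD !ext_delta !gE1; apply: (@gev_anti R n c i j (elist H) x setT ij);
    rewrite inE.
- rewrite !extD !ext_delta !gE2 /=.
  have := @gev_cycle R n [:: (c, c)] i j k (elist H) x setT.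
  by rewrite big_seq1 /=; apply; rewrite ?inE.
- rewrite !extD !ext_delta !gE2 /=.
  have := @gev_cycle R n [:: (blue, red); (red, blue)] i j k (elist H) x setT.
  rewrite !big_cons big_nil /= addr0 => h.
  by rewrite -[RHS]h ?inE //; ring.
- by rewrite ext_delta; apply: (@gev_multi R n (elist G) i j x setT ij) G2; rewrite inE.
Qed.

(** Evaluation on the set of all vertices; the representative chosen for [val p] does not matter, by
    invariance under [alg_eq]. *)
Definition pairing (q : Q2 R n) (p : P2 R n) : R :=
  quot_lift (S := @graph_rel R n) (W := R^o)
    (ext (fun G => gev (elist G) (repr (val p)) setT : R^o)) q.

Lemma pairing_class G p : pairing (graph_class R G) p =
  aev (zwt R (elist G)) (swt R (elist G)) (val p) setT.
Proof.
rewrite /pairing /graph_class quot_liftE ?ext_delta //.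
- exact: ext0.
- exact: ext_linear.
- exact: gev_graph_rel.
Qed.

Lemma pairing_linearl p a : {morph pairing^~ p : u v / a *: u + v >-> a * u + v}.
Proof.
exact: (quot_lift_linear (W := R^o) (ext0 _) (ext_linear _)
  (@gev_graph_rel (repr (val p))) a).
Qed.

Lemma pairing_linearr q a : {morph pairing q : u v / a *: u + v >-> a * u + v}.
Proof.
move=> u v; rewrite /pairing /quot_lift /ext mulr_sumr -big_split /=.
apply: eq_bigr => G _.
have := aev_linear (edge_weight_axioms R (elist G)) setT a (val u) (val v).
by rewrite /aev /gev => ->; rewrite /GRing.scale /= mulrDr mulrCA.
Qed.

(** The relations carry an arbitrary ambient graph and multiple edges persist, so adding an edge
    preserves them and acts on the quotient. *)
Definition qcons (e : edge n) : Q2 R n -> Q2 R n :=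
  quot_lift (S := @graph_rel R n)
    (fun v => quot_class (@graph_rel R n) (ext (fun G => delta R (add_edge G e)) v)).

Lemma add_edgeC (G : graph n) e f : add_edge (add_edge G e) f = add_edge (add_edge G f) e.
Proof. by apply/ffunP => h; rewrite !ffunE addnAC. Qed.

Lemma qcons_rel e v : graph_rel v ->
  quot_class (@graph_rel R n) (ext (fun G => delta R (add_edge G e)) v) = 0.
Proof.
move=> v_rel; apply/quot_class0/lspan_gen; move: v_rel.
have extD u w : ext (fun G => delta R (add_edge G e)) (u + w) =
    ext (fun G => delta R (add_edge G e)) u + ext (fun G => delta R (add_edge G e)) w.
  by have := ext_linear (fun G => delta R (add_edge G e)) 1 u w; rewrite !scale1r.
have C2 H f g : add_edge (add_edge (add_edge H f) g) e =
    add_edge (add_edge (add_edge H e) f) g by rewrite [LHS]add_edgeC (add_edgeC H).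
case=> [H c i j ij ji|H c i j k ij jk ki|H i j k ij jk ki|G G2].
- by rewrite extD !ext_delta ![add_edge (add_edge H _) e]add_edgeC; apply: rel_anti.
- by rewrite !extD !ext_delta !C2; apply: rel_jacobi.
- by rewrite !extD !ext_delta !C2; apply: rel_mixed.
- by rewrite ext_delta; apply/rel_multi/multi_add_edge.
Qed.

Lemma qcons_class e G : qcons e (graph_class R G) = graph_class R (add_edge G e).
Proof.
rewrite /qcons quot_liftE ?ext_delta //.
- by rewrite ext0; apply/quot_class0/lspan0.
- by move=> a u v; rewrite ext_linear quot_class_linear.
- exact: qcons_rel.
Qed.

Lemma qcons_linear e a : {morph qcons e : u v / a *: u + v}.
Proof.
apply: quot_lift_linear.
- by rewrite ext0; apply/quot_class0/lspan0.
- by move=> b u v; rewrite ext_linear quot_class_linear.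
- exact: qcons_rel.
Qed.

Lemma qcons0 e : qcons e 0 = 0.
Proof.
have := qcons_linear e (-1) 0 0; rewrite scaler0 addr0 => {1}->.
by rewrite scaleN1r addNr.
Qed.

Lemma Q2_span (q : Q2 R n) : lspan (fun v => exists G, v = graph_class R G) q.
Proof.
rewrite -[q](@reprK _ (quot_mod _)) -/(quot_class _ (repr q)).
apply: (lspan_map (f := quot_class (@graph_rel R n))) (free_mod_lspan (repr q)).
- exact/quot_class0/lspan0.
- exact: quot_class_linear.
- by move=> w [G ->]; apply: lspan_gen; exists G.
Qed.

End Pairing.

(** * Rooted forests *)

Section Forests.
Variable n : nat.
Local Notation T := 'I_n.
Implicit Types (u v w p : T) (A D S U V : {set T}) (F : {set T * T}).

(** Acyclicity is expressed as well-foundedness: every nonempty set has a vertex without parent in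
    it. This also excludes loops and avoids reasoning on paths. *)
Definition forest V F : bool :=
  [&& [forall a in F, (a.1 \in V) && (a.2 \in V)],
      [forall a in F, forall b in F, (a.2 == b.2) ==> (a.1 == b.1)]
    & [forall S : {set T}, (S != set0) ==>
        [exists v in S, [forall u in S, (u, v) \notin F]]]].

Definition parent_closed F v S :=
  forall w, w \in S -> w != v -> exists2 u, u \in S & (u, w) \in F.

Lemma forestP V F :
  reflect [/\ forall u v, (u, v) \in F -> u \in V /\ v \in V,
              forall u u' v, (u, v) \in F -> (u', v) \in F -> u = u'
            & forall S, S != set0 ->
                exists2 v, v \in S & forall u, u \in S -> (u, v) \notin F]
          (forest V F).
Proof.
apply: (iffP and3P) => [[/forall_inP FV /forall_inP Fi /forallP Fa]|[FV Fi Fa]].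
  split=> [u v /FV /andP[]//|u u' v uF u'F|S S0].
    by have /forall_inP/(_ _ u'F) := Fi _ uF; rewrite eqxx => /eqP.
  have /implyP/(_ S0)/exists_inP[v vS /forall_inP vr] := Fa S.
  by exists v.
split.
- by apply/forall_inP => -[u v] /FV[-> ->].
- apply/forall_inP => -[u v] uF; apply/forall_inP => -[u' v'] u'F /=.
  by apply/implyP => /eqP vv'; apply/eqP; apply: Fi uF _; rewrite vv'.
- apply/forallP => S; apply/implyP => /Fa[v vS vr].
  by apply/exists_inP; exists v => //; apply/forall_inP.
Qed.

Lemma forest_sub V V' F F' : forest V F -> F' \subset F ->
  (forall u v, (u, v) \in F' -> u \in V' /\ v \in V') -> forest V' F'.
Proof.
case/forestP=> _ Fi Fa /subsetP FF' FV'; apply/forestP; split=> // [u u' v /FF' + /FF'|S /Fa[v vS vr]].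
  exact: Fi.
by exists v => // u /vr; apply/contra/FF'.
Qed.

Lemma forest_mono V V' F : V \subset V' -> forest V F -> forest V' F.
Proof.
move=> /subsetP VV' FV; apply: (forest_sub FV) => // u v uv.
by case/forestP: FV => FV _ _; have [/VV'-> /VV'->] := FV _ _ uv.
Qed.

Lemma forest0 V : forest V set0.
Proof.
apply/forestP; split=> [u v|u u' v|S /set0Pn[v vS]]; rewrite ?inE //.
by exists v => // u; rewrite inE.
Qed.

Definition restr A F := [set a in F | (a.1 \in A) && (a.2 \in A)].

Lemma in_restr A F u v : ((u, v) \in restr A F) = [&& (u, v) \in F, u \in A & v \in A].
Proof. by rewrite inE. Qed.

Lemma restr_sub A F : restr A F \subset F.
Proof. by apply/subsetP => a; rewrite inE => /andP[]. Qed.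

Lemma forest_restr V A F : forest V F -> forest A (restr A F).
Proof.
move=> FV; apply: (forest_sub FV (restr_sub _ _)) => u v.
by rewrite in_restr => /and3P[].
Qed.

Lemma restr_id V F : forest V F -> restr V F = F.
Proof.
case/forestP=> FV _ _; apply/setP => -[u v]; rewrite in_restr.
by case: (boolP (_ \in F)) => // /FV[-> ->].
Qed.

Definition reach F v := [set w | connect (fun a b => (a, b) \in F) v w].

Lemma reach_refl F v : v \in reach F v.
Proof. by rewrite inE connect0. Qed.

Lemma reach_step F v u w : u \in reach F v -> (u, w) \in F -> w \in reach F v.
Proof. by rewrite !inE => vu uw; apply: connect_trans vu (connect1 uw). Qed.

Lemma reach_trans F u v w : v \in reach F u -> w \in reach F v -> w \in reach F u.
Proof. by rewrite !inE; apply: connect_trans. Qed.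

Lemma reach_sub F F' v : F \subset F' -> reach F v \subset reach F' v.
Proof.
move=> /subsetP FF'; apply/subsetP => w; rewrite !inE.
by apply: connect_sub => a b /FF' ab; apply: connect1.
Qed.

Lemma reach_ind F v (S : {set T}) : v \in S ->
  (forall u w, u \in S -> (u, w) \in F -> w \in S) -> reach F v \subset S.
Proof.
move=> vS Scl; apply/subsetP => w; rewrite inE => /connectP[s].
elim: s v vS => [|u s IHs] v vS /=; first by move=> _ ->.
by case/andP=> vu us wE; apply: (IHs u _ us wE); apply: Scl vu.
Qed.

Lemma reach_parent_closed F v : parent_closed F v (reach F v).
Proof.
move=> w; rewrite inE => /connectP[s]; case/lastP: s => [_ ->|s u].
  by rewrite eqxx.
rewrite rcons_path last_rcons => /andP[vs su] -> _; exists (last v s) => //.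
by rewrite inE; apply/connectP; exists s.
Qed.

(** In the part of [S] not reached from [v], some vertex has no parent. Its parent in [S] is then
    reached from [v], and so is the vertex itself, a contradiction. *)
Lemma parent_closed_reach V F v S : forest V F -> parent_closed F v S ->
  S \subset reach F v.
Proof.
case/forestP=> _ _ Fa Scl; apply/subsetP => w wS; apply/negPn/negP => wD.
have /Fa[u] : S :\: reach F v != set0 by apply/set0Pn; exists w; rewrite inE wD.
rewrite inE => /andP[uD uS] ur.
have uv : u != v by apply: contraNneq uD => ->; apply: reach_refl.
have [p pS pu] := Scl u uS uv.
have := ur p; rewrite inE pS pu andbT; case: (boolP (p \in _)) => [pD _|_ /(_ isT)//].
by rewrite (reach_step pD pu) in uD.
Qed.

Lemma forest_acyclic V F u v : forest V F -> (u, v) \in F -> u \notin reach F v.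
Proof.
case/forestP=> _ _ Fa uv; apply/negP => vu.
have /Fa[w] : [set w in reach F v | u \in reach F w] != set0.
  by apply/set0Pn; exists u; rewrite inE vu reach_refl.
rewrite inE => /andP[vw wu] wr.
have [wv|wv] := eqVneq w v.
  by have := wr u; rewrite inE vu reach_refl wv uv => /(_ isT).
have [p vp pw] := reach_parent_closed vw wv.
have := wr p; rewrite inE vp pw; suff -> : u \in reach F p by move/(_ isT).
exact: reach_trans (reach_step (reach_refl _ _) pw) wu.
Qed.

Lemma forest_irrefl V F v : forest V F -> (v, v) \notin F.
Proof.
by move=> FV; apply/negP => /(forest_acyclic FV); rewrite reach_refl.
Qed.

Definition is_root F v := [forall u, (u, v) \notin F].

Lemma is_rootP F v : reflect (forall u, (u, v) \notin F) (is_root F v).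
Proof. exact: forallP. Qed.

Lemma rootN F u v : is_root F v -> (u, v) \notin F.
Proof. by move/is_rootP. Qed.

Lemma root_sub F F' v : F' \subset F -> is_root F v -> is_root F' v.
Proof.
move=> /subsetP FF' /is_rootP vr; apply/is_rootP => u.
exact: contra (FF' _) (vr u).
Qed.

Lemma parentP F v : ~~ is_root F v -> exists p, (p, v) \in F.
Proof. by rewrite negb_forall => /existsP[p]; rewrite negbK; exists p. Qed.

Lemma forest_add V F y v : forest V F -> y \in V -> v \in V -> is_root F v ->
  y \notin reach F v -> forest V ((y, v) |: F).
Proof.
move=> FV yV vV /is_rootP vr yv; have [FVV Fi Fa] := forestP _ _ FV.
apply/forestP; split=> [u w|u u' w|S S0].
- by rewrite !inE => /orP[/eqP[-> ->]|/FVV].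
- rewrite !inE !xpair_eqE => /orP[/andP[/eqP-> /eqP wv]|uw] /orP[/andP[/eqP-> /eqP wv']|u'w] //.
  + by have := vr u'; rewrite -wv u'w.
  + by have := vr u; rewrite -wv' uw.
  + exact: Fi uw u'w.
(* If [S] lies below [v], the new arc does not start in it, as [y] is not below [v]. Otherwise a
   vertex of [S] not below [v] is taken, which neither the new arc nor an arc from below [v] can
   enter. *)
have [S1|S1] := eqVneq (S :\: reach F v) set0.
  have SD u : u \in S -> u \in reach F v.
    by move=> uS; have /setP/(_ u) := S1; rewrite !inE uS andbT => /negbFE.
  have [w wS wr] := Fa S S0; exists w => // u uS; rewrite !inE negb_or wr // andbT.
  by apply: contraNneq yv => -[<- _]; apply: SD.
have [w] := Fa _ S1; rewrite inE => /andP[wD wS] wr; exists w => // u uS.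
rewrite !inE negb_or; apply/andP; split.
  by apply: contraNneq wD => -[_ ->]; apply: reach_refl.
have [uD|uD] := boolP (u \in reach F v); last by apply: wr; rewrite inE uD.
by apply: contra wD; apply: reach_step.
Qed.

Lemma forestU V1 V2 F1 F2 : [disjoint V1 & V2] -> forest V1 F1 ->
  forest V2 F2 -> forest (V1 :|: V2) (F1 :|: F2).
Proof.
move=> V12 /forestP[FV1 Fi1 Fa1] /forestP[FV2 Fi2 Fa2].
have dis u : u \in V1 -> u \in V2 -> False by move=> /(disjointFr V12)->.
apply/forestP; split=> [u v|u u' v|S S0].
- by rewrite !inE => /orP[/FV1|/FV2] [-> ->]; rewrite ?orbT.
- rewrite !inE => /orP[h|h] /orP[h'|h'].
  + exact: Fi1 h h'.
  + by case: (dis v); [case: (FV1 _ _ h)|case: (FV2 _ _ h')].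
  + by case: (dis v); [case: (FV1 _ _ h')|case: (FV2 _ _ h)].
  + exact: Fi2 h h'.
have [S1|S1] := eqVneq (S :&: V1) set0.
  have [v vS vr] := Fa2 S S0; exists v => // u uS; rewrite !inE negb_or vr // andbT.
  apply/negP => /FV1[uV1 _]; have /setP/(_ u) := S1.
  by rewrite !inE uS uV1.
have [v] := Fa1 _ S1; rewrite inE => /andP[vS vV1] vr; exists v => // u uS.
rewrite !inE negb_or; apply/andP; split; last first.
  by apply/negP => /FV2[_]; apply: dis.
by apply/negP => uv; have [uV1 _] := FV1 _ _ uv; move: (vr u); rewrite inE uS uV1 uv => /(_ isT).
Qed.

(** The number of ancestors is the decreasing measure in [xop_out_root]. *)
Definition anc F v := [set u | v \in reach F u].

Lemma anc_parent V F q x : forest V F -> (q, x) \in F -> anc F q \proper anc F x.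
Proof.
move=> FV qx; apply/properP; split.
  by apply/subsetP => u; rewrite !inE => uq; apply: connect_trans uq (connect1 qx).
exists x; rewrite !inE ?connect0 //.
by have := forest_acyclic FV qx; rewrite inE.
Qed.

Lemma reach_subV V F v : forest V F -> v \in V -> reach F v \subset V.
Proof. by case/forestP=> FV _ _ vV; apply: reach_ind => // u w _ /FV[]. Qed.

Lemma reach_split V F v : forest V F -> is_root F v ->
  F = restr (reach F v) F :|: restr (V :\: reach F v) F.
Proof.
case/forestP=> FV Fi _ /is_rootP vr; apply/setP => -[u w].
rewrite inE !in_restr !in_setD; have [uw|//] := boolP (_ \in F) => /=.
have [-> ->] := FV _ _ uw; rewrite !andbT /=.
have [uD|uD] /= := boolP (u \in reach F v); first by rewrite (reach_step uD uw).
have [wD|//] := boolP (w \in reach F v).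
have wv : w != v by apply: contraTneq uw => ->; apply: vr.
have [p pD pw] := reach_parent_closed wD wv.
by rewrite (Fi _ _ _ uw pw) pD in uD.
Qed.

Lemma disjointD (I : finType) (D V : {set I}) : [disjoint D & V :\: D].
Proof.
by rewrite -setI_eq0; apply/eqP/setP => a; rewrite !inE; case: (a \in D).
Qed.

Lemma ex_max_vertex V : V != set0 ->
  exists2 v, v \in V & forall u, u \in V -> (u <= v)%N.
Proof.
by case/set0Pn=> v0 v0V; case: (arg_maxnP (fun v : T => v : nat) v0V) => v; exists v.
Qed.

End Forests.

(** * Forests span the graphs *)

Section EdgeOperators.
Variables (R : comPzRingType) (n : nat).
Local Notation T := 'I_n.
Local Notation cedge := (color * (T * T))%type.
Implicit Types (i j k m x y p q : T) (c d : color) (u v w : Q2 R n) (es : seq cedge).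

Definition qE es : Q2 R n := graph_class R (list_graph es).

Lemma qE_perm es es' : perm_eq es es' -> qE es = qE es'.
Proof. by move=> /list_graph_perm ees'; rewrite /qE ees'. Qed.

(** Adding an edge, extended by zero to equal end points, so that the operators are total and
    commute without side conditions. *)
Definition qop c i j : Q2 R n -> Q2 R n :=
  if insub (c, (i, j)) is Some e then qcons (e : edge n) else fun=> 0.

Lemma qopE c i j es : i != j -> qop c i j (qE es) = qE ((c, (i, j)) :: es).
Proof.
rewrite /qop; case: insubP => [e _ eE|/=]; last by case: eqP.
move=> ij; have -> : e = arrow c ij by apply: val_inj.
by rewrite /qE qcons_class -list_graph_cons.
Qed.

Lemma qopii c i v : qop c i i v = 0.
Proof. by rewrite /qop; case: insubP => //= e; rewrite eqxx. Qed.

Lemma qop_linear c i j a : {morph qop c i j : u v / a *: u + v}.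
Proof.
rewrite /qop; case: insubP => [e _ _|_] u v; last by rewrite scaler0 addr0.
exact: qcons_linear.
Qed.

Lemma qop0 c i j : qop c i j 0 = 0.
Proof. by rewrite /qop; case: insubP => // e _ _; apply: qcons0. Qed.

Lemma qopN c i j u : qop c i j (- u) = - qop c i j u.
Proof. by rewrite -[- u]addr0 -scaleN1r qop_linear qop0 addr0 scaleN1r. Qed.

Lemma qopD c i j u v : qop c i j (u + v) = qop c i j u + qop c i j v.
Proof. by have := qop_linear c i j 1 u v; rewrite !scale1r. Qed.

Definition is_lin (f : Q2 R n -> Q2 R n) := forall a, {morph f : x y / a *: x + y}.

Lemma is_lin0 f : is_lin f -> f 0 = 0.
Proof. by move=> /(_ (-1) 0 0); rewrite scaler0 addr0 scaleN1r addNr. Qed.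

Lemma is_lin_qop c i j f : is_lin f -> is_lin (fun v => qop c i j (f v)).
Proof. by move=> fL a u v; rewrite fL qop_linear. Qed.

Lemma is_linD f g : is_lin f -> is_lin g -> is_lin (fun v => f v + g v).
Proof. by move=> fL gL a u v; rewrite fL gL scalerDr addrACA. Qed.

Lemma is_lin_id : is_lin id. Proof. by []. Qed.

Lemma eq_on_qE f g : is_lin f -> is_lin g ->
  (forall es, all (fun e => e.2.1 != e.2.2) es -> f (qE es) = g (qE es)) -> f =1 g.
Proof.
move=> fL gL fg v.
apply: (lspan_eq (is_lin0 fL) fL (is_lin0 gL) gL _ (Q2_span v)) => _ [G ->].
rewrite -[G]elistK; apply: fg; apply/allP => _ /mapP[e _ ->]; exact: (valP e).
Qed.

Lemma zero_on_qE f : is_lin f ->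
  (forall es, all (fun e => e.2.1 != e.2.2) es -> f (qE es) = 0) ->
  forall v, f v = 0.
Proof.
move=> fL fE; apply: (eq_on_qE (g := fun=> 0)) => // a u v.
by rewrite scaler0 addr0.
Qed.

Lemma qopC c d i j k l v :
  qop c i j (qop d k l v) = qop d k l (qop c i j v).
Proof.
have [->|ij] := eqVneq i j; first by rewrite !qopii qop0.
have [->|kl] := eqVneq k l; first by rewrite !qopii qop0.
move: v; apply: eq_on_qE; do ?[exact: is_lin_id|apply: is_lin_qop].
by move=> es _; rewrite !qopE //; apply/qE_perm; rewrite (perm_catCA [:: _] [:: _]).
Qed.

Lemma qop_anti c i j v : qop c i j v = - qop c j i v.
Proof.
have [->|ij] := eqVneq i j; first by rewrite !qopii oppr0.
have ji : j != i by rewrite eq_sym.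
apply/eqP; rewrite -addr_eq0; apply/eqP; move: v; apply: zero_on_qE.
  by do ?[exact: is_lin_id|apply: is_lin_qop|apply: is_linD].
move=> es _; rewrite !qopE // /qE (list_graph_cons _ _ ij) (list_graph_cons _ _ ji).
rewrite /graph_class -[quot_class _ _]scale1r -quot_class_linear scale1r.
exact/quot_class0/lspan_gen/rel_anti.
Qed.

Lemma qop_multi c d i j v : qop c i j (qop d i j v) = 0.
Proof.
have [->|ij] := eqVneq i j; first by rewrite !qopii.
move: v; apply: zero_on_qE.
  by do ?[exact: is_lin_id|apply: is_lin_qop|apply: is_linD].
move=> es _; rewrite !qopE //; apply/quot_class0/lspan_gen/rel_multi.
by apply: (list_multi ij) => /=; rewrite !eqxx /= !add1n.
Qed.

Lemma quot_classD (s t : Gamma R n) :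
  quot_class (@graph_rel R n) s + quot_class (@graph_rel R n) t =
  quot_class (@graph_rel R n) (s + t).
Proof. by rewrite -[s in RHS]scale1r quot_class_linear scale1r. Qed.

Lemma gen2E c d i j k l (ij : i != j) (kl : k != l) es :
  qop c i j (qop d k l (qE es)) = quot_class (@graph_rel R n)
    (delta R (add_edge (add_edge (list_graph es) (arrow c ij)) (arrow d kl))).
Proof. by rewrite qopC !qopE // /qE !list_graph_cons. Qed.

Lemma qop_arnold c i j k v : i != j -> j != k -> k != i ->
  qop c i j (qop c j k v) + qop c j k (qop c k i v) + qop c k i (qop c i j v) = 0.
Proof.
move=> ij jk ki; move: v; apply: zero_on_qE.
  by do ?[exact: is_lin_id|apply: is_lin_qop|apply: is_linD].
move=> es _; rewrite !gen2E.
have := quot_class0 (lspan_gen (@rel_jacobi R n (list_graph es) c i j k ij jk ki)).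
by rewrite -!quot_classD.
Qed.

Lemma qop_mixed i j k v : i != j -> j != k -> k != i ->
  (qop blue i j (qop red j k v) + qop red i j (qop blue j k v))
  + (qop blue j k (qop red k i v) + qop red j k (qop blue k i v))
  + (qop blue k i (qop red i j v) + qop red k i (qop blue i j v)) = 0.
Proof.
move=> ij jk ki; move: v; apply: zero_on_qE.
  by do ?[exact: is_lin_id|apply: is_lin_qop|apply: is_linD].
move=> es _; rewrite !gen2E.
have := quot_class0 (lspan_gen (@rel_mixed R n (list_graph es) i j k ij jk ki)).
by rewrite -!quot_classD.
Qed.

Lemma qop_mixed_colors c d i j k v : c != d -> i != j -> j != k -> k != i ->
  (qop c i j (qop d j k v) + qop d i j (qop c j k v))
  + (qop c j k (qop d k i v) + qop d j k (qop c k i v))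
  + (qop c k i (qop d i j v) + qop d k i (qop c i j v)) = 0.
Proof.
move=> cd ij jk ki; have := qop_mixed v ij jk ki.
case: c cd; case: d => // _ h; rewrite -[RHS]h //.
by congr (_ + _ + _); rewrite addrC.
Qed.

End EdgeOperators.

(** * Closed cycles of edges are zero *)

Section CycleVanishing.
Variables (R : comPzRingType) (n : nat).
Local Notation T := 'I_n.
Implicit Types (i j k m x y z p q : T) (c d : color) (u v w : Q2 R n).

Fixpoint chain y (s : seq (color * T)) v : Q2 R n :=
  if s is (c, x) :: s' then qop c y x (chain x s' v) else v.

Lemma qop_chain c i j y s v : qop c i j (chain y s v) = chain y s (qop c i j v).
Proof. by elim: s y => //= -[d x] s IHs y; rewrite qopC IHs. Qed.

(** The one-colour relation in the form of the Arnold relation: the path through [j] becomes two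
    terms, both containing the chord from [i] to [k]. *)
Lemma qop_arnoldE c i j k v : i != j -> j != k -> k != i ->
  qop c i j (qop c j k v) = qop c i j (qop c i k v) + qop c j k (qop c i k v).
Proof.
move=> ij jk ki; move/eqP: (qop_arnold c v ij jk ki).
rewrite [qop c k i v]qop_anti qopN [qop c k i _]qop_anti [qop c i k (qop _ _ _ _)]qopC.
by rewrite -addrA -opprD subr_eq0 => /eqP->; rewrite addrC.
Qed.

(* Two edges of the same colour meeting at a vertex of the cycle are traded for
   cycles one shorter; two edges of different colours may be swapped modulo
   those, and among three consecutive edges two have the same colour. *)
Lemma cycle_vanish c y s v : s != [::] -> uniq (y :: [seq a.2 | a <- s]) ->
  qop c (last y [seq a.2 | a <- s]) y (chain y s v) = 0.
Proof.
move: {2}(size s) (leqnn (size s)) => N; elim: N c y s v => [|N IHN] c y0 s v.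
  by case: s.
case: s => // -[c1 y1] [|[c2 y2] s] sN _ /=.
  by rewrite inE andbT => _; rewrite qop_anti qop_multi oppr0.
set z := last y2 _; case/and3P; rewrite !inE !negb_or.
case/and3P=> y01 y02 y0s /andP[y12 y1s] /andP[y2s s_uniq].
have zs : z \in y2 :: [seq a.2 | a <- s] by apply: mem_last.
have zy0 : z != y0.
  by apply: contraTneq zs => ->; rewrite inE negb_or y02.
have zy1 : z != y1.
  by apply: contraTneq zs => ->; rewrite inE negb_or y12.
(* [I1] and [I2] are the shorter cycles that bypass [y0] and [y1] respectively, for arbitrary
   colours of the two edges involved. *)
have I1 d d' v' : qop d z y1 (qop d' y1 y2 (chain y2 s v')) = 0.
  apply: (IHN d y1 ((d', y2) :: s) v') => //.
  by rewrite /= inE negb_or y12 y1s y2s s_uniq.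
have I2 d d' v' : qop d z y0 (qop d' y0 y2 (chain y2 s v')) = 0.
  apply: (IHN d y0 ((d', y2) :: s) v') => //.
  by rewrite /= inE negb_or y02 y0s y2s s_uniq.
have I1' a i j d d' v' :
    qop d z y1 (qop a i j (qop d' y1 y2 (chain y2 s v'))) = 0.
  by rewrite [qop a _ _ _]qopC qop_chain I1.
have same12 d e v' :
    qop d z y0 (qop e y0 y1 (qop e y1 y2 (chain y2 s v'))) = 0.
  rewrite qop_arnoldE // 1?eq_sym // qopD [qop e y0 y1 _]qopC qop_chain I2 add0r.
  by rewrite [qop e y1 y2 _]qopC qop_chain I2.
have swap d e v' : d != e ->
    qop d z y0 (qop e y0 y1 (qop c2 y1 y2 (chain y2 s v'))) =
    - qop e z y0 (qop d y0 y1 (qop c2 y1 y2 (chain y2 s v'))).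
  move=> de; apply/eqP; rewrite -addr_eq0; apply/eqP.
  set w := qop c2 y1 y2 _.
  have := @qop_mixed_colors R n d e z y0 y1 w de zy0 y01; rewrite eq_sym zy1.
  have wz a b i j : qop a i j (qop b y1 z w) = 0.
    by rewrite [qop b y1 z _]qop_anti I1 oppr0 qop0.
  have wz' a b i j : qop a y1 z (qop b i j w) = 0.
    by rewrite [qop a y1 z _]qop_anti I1' oppr0.
  by rewrite !wz !wz' !addr0 => /(_ isT).
have [cc1|cc1] := eqVneq c c1.
  rewrite -cc1 qop_arnoldE // 1?eq_sym //.
  by rewrite !I1 !qop0 addr0.
have [c12|c12] := eqVneq c1 c2; first by rewrite c12 same12.
have cc2 : c = c2 by move: cc1 c12; case: (c); case: (c1); case: (c2).
by rewrite swap // -cc2 same12 oppr0.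
Qed.

End CycleVanishing.

(** * Straightening a new arc at the maximal vertex *)

Section ForestSpan.
Variables (R : comPzRingType) (n : nat).
Local Notation T := 'I_n.
Implicit Types (i j k m x y z p q u : T) (c d : color) (v w : Q2 R n).
Implicit Types (V D S : {set T}) (F A H : {set T * T}).

(* The arc (i, j) of a forest stands for the edge from i to j, blue if i < j
   and red if i > j; these graphs, with indegrees at most one, form a basis. *)
Definition arc_color (a : T * T) : color := if (a.1 < a.2)%N then blue else red.
Definition arc_edges F := [seq (arc_color a, a) | a <- enum F].
Definition qF F : Q2 R n := qE R (arc_edges F).
Definition xop i j : Q2 R n -> Q2 R n := qop (arc_color (i, j)) i j.

Lemma enum_setU1 F a : a \notin F -> perm_eq (enum (a |: F)) (a :: enum F).
Proof.
move=> aF; apply: uniq_perm => [||b]; first exact: enum_uniq.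
  by rewrite /= mem_enum aF enum_uniq.
by rewrite inE !mem_enum !inE.
Qed.

Lemma xop_qF F i j : i != j -> (i, j) \notin F -> xop i j (qF F) = qF ((i, j) |: F).
Proof.
move=> ij ijF; rewrite /xop /qF qopE //; apply: qE_perm.
by rewrite perm_sym; apply: (perm_map _ (enum_setU1 ijF)).
Qed.

Lemma qF_remove F i j : i != j -> (i, j) \in F -> qF F = xop i j (qF (F :\ (i, j))).
Proof. by move=> ij ijF; rewrite xop_qF // ?setD1K // !inE eqxx. Qed.

Lemma xop_linear i j a : {morph xop i j : v w / a *: v + w}.
Proof. exact: qop_linear. Qed.

Definition fop F w : Q2 R n := foldr (fun a v => xop a.1 a.2 v) w (enum F).

Lemma fop_linear F a : {morph fop F : v w / a *: v + w}.
Proof.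
by rewrite /fop => u v; elim: (enum F) => //= b s ->; rewrite xop_linear.
Qed.

Lemma fop0 F : fop F 0 = 0.
Proof. by rewrite /fop; elim: (enum F) => //= b s ->; rewrite /xop qop0. Qed.

Lemma qop_fop c i j F w : qop c i j (fop F w) = fop F (qop c i j w).
Proof. by rewrite /fop; elim: (enum F) => //= b s <-; rewrite qopC. Qed.

Lemma fop_qF V F H A : forest V F -> F = A :|: H -> [disjoint A & H] ->
  qF F = fop A (qF H).
Proof.
move=> FV FAH AH; rewrite /fop.
(* Only the enumeration of [A] is kept, since the induction shortens this list while [H] stays
   fixed. *)
have {FAH} [sA FE] : {subset enum A <= A} /\ F = [set a in enum A] :|: H.
  by split=> [a|]; [rewrite mem_enum|rewrite set_enum].
have sF a : a \in enum A -> a \in F by rewrite FE !inE => ->.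
elim: (enum A) (enum_uniq A) sA F FV FE sF => [|[i j] s IHs] /=.
  by move=> _ _ F _ -> _; rewrite (_ : [set a in [::]] = set0) ?set0U //;
    apply/setP => a; rewrite !inE.
case/andP=> ijs s_uniq sA F FV FE sF.
have ijF : (i, j) \in F by apply: sF; rewrite mem_head.
have ij : i != j by apply: contraTneq ijF => ->; apply: (forest_irrefl _ FV).
have ijH : (i, j) \notin H by rewrite (disjointFr AH) ?sA ?mem_head.
rewrite (qF_remove ij ijF) (IHs s_uniq) //.
- by move=> a a_s; apply: sA; rewrite inE a_s orbT.
- by apply: (forest_sub FV (subD1set _ _)) => u v /setD1P[_]; case/forestP: FV => h _ _ /h.
- rewrite FE; apply/setP => a; rewrite !inE; have [->|//] := eqVneq a (i, j).
  by rewrite (negPf ijs) (negPf ijH).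
- move=> a a_s; rewrite FE !inE a_s orbT andbT /=.
  by apply: contraNneq ijs => <-.
Qed.

Lemma path_chain m s F : uniq (m :: s) -> path (fun a b => (a, b) \in F) m s ->
  exists2 t, [seq a.2 | a <- t] = s & exists v, qF F = chain m t v.
Proof.
elim: s m F => [|x s IHs] m F /=; first by exists [::] => //; exists (qF F).
case/andP=> mxs xs_uniq /andP[mxF xsF].
have mx : m != x by move: mxs; rewrite inE negb_or => /andP[].
have [|t ts [v vE]] := IHs x (F :\ (m, x)) xs_uniq.
  apply: (sub_in_path (P := mem (x :: s))) _ xsF; last exact/allP.
  move=> a b /= a_xs _ ab; rewrite !inE ab andbT xpair_eqE negb_and.
  by apply/orP; left; apply: contraNneq mxs => <-.
exists ((arc_color (m, x), x) :: t); first by rewrite /= ts.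
by exists v; rewrite (qF_remove mx mxF) vE.
Qed.

(** The path of the forest from [m] down to [x] is closed to a cycle by the new edge. *)
Lemma reach_cycle F c m x : x \in reach F m -> x != m ->
  qop c m x (qF F) = 0 /\ qop c x m (qF F) = 0.
Proof.
move=> xm x_m; suff h : qop c x m (qF F) = 0.
  by rewrite qop_anti h oppr0.
move: xm x_m; rewrite inE => /connectP[s0 /shortenP[s ms s_uniq _] ->] xm.
have [t tE [v ->]] := path_chain s_uniq ms.
rewrite -tE; apply: cycle_vanish; last by rewrite tE.
by apply: contraNneq xm => t0; rewrite -tE t0.
Qed.

Definition fspan V := lspan (fun v => exists2 F, forest V F & v = qF F).

Lemma fspan_qF V F : forest V F -> fspan V (qF F).
Proof. by move=> FV; apply: lspan_gen; exists F. Qed.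

Lemma fspan_mono V V' v : V \subset V' -> fspan V v -> fspan V' v.
Proof.
by move=> VV'; apply: lspanS => w [F FV ->]; exists F => //; apply: forest_mono FV.
Qed.

Definition edge_closed V := forall c i j v, i \in V -> j \in V -> fspan V v ->
  fspan V (qop c i j v).

Lemma blue_arc i j : (i < j)%N -> arc_color (i, j) = blue.
Proof. by rewrite /arc_color /= => ->. Qed.

Lemma red_arc i j : (j < i)%N -> arc_color (i, j) = red.
Proof. by rewrite /arc_color /= => ji; rewrite ltnNge ltnW. Qed.

Section InductionStep.
Variables (V : {set T}) (m : T).
Hypotheses (mV : m \in V) (m_max : forall x, x \in V -> (x <= m)%N).
Hypothesis closed_below : forall V', (#|V'| < #|V|)%N -> edge_closed V'.

Lemma lt_max x : x \in V -> x != m -> (x < m)%N.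
Proof. by move=> /m_max xm x_m; rewrite ltn_neqAle xm andbT. Qed.

(** The arcs of the tree at [m], the forest on the other vertices and the arc from [y] to [m]
    together form a forest again; linearity then allows any combination of forests in place of
    [w]. *)
Lemma attach D A y w : D \subset V -> forest D A -> is_root A m -> m \in D ->
  y \in V :\: D -> fspan (V :\: D) w -> fspan V (xop y m (fop A w)).
Proof.
move=> DV AD Am mD yVD; have [yV yD] := setDP yVD => w_span.
apply: (lspan_map (f := fun w => xop y m (fop A w))) w_span.
- by rewrite fop0 /xop qop0.
- by move=> a u v; rewrite fop_linear xop_linear.
move=> _ [H HVD ->]; have dis := disjointD D V.
have FV : forest V (A :|: H).
  apply: forest_mono (forestU dis AD HVD).
  by rewrite subUset DV subDset subsetUr.
have [AV _ _] := forestP _ _ AD; have [HV _ _] := forestP _ _ HVD.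
have AH : [disjoint A & H].
  rewrite -setI_eq0 -subset0; apply/subsetP => -[a b]; rewrite inE.
  by case/andP=> /AV[aD _] /HV[]; rewrite inE aD.
have Hm a : (a, m) \notin H by apply/negP => /HV[_]; rewrite inE mD.
have ym : y != m by apply: contraNneq yD => ->.
have rm : is_root (A :|: H) m.
  by apply/is_rootP => a; rewrite inE negb_or Hm andbT; exact: rootN Am.
rewrite -(fop_qF FV) // xop_qF //; last exact: rootN rm.
apply/fspan_qF/forest_add => //; apply: contra yD; apply/subsetP/reach_ind => // a b aD.
by rewrite inE => /orP[/AV[]|/HV[]] //; rewrite inE aD.
Qed.

(* Above a root [m], a tree can be detached, the remaining forest changed, and
   the tree attached again. *)
Lemma attach_qop F c i j y : forest V F -> is_root F m ->
  i \in V :\: reach F m -> j \in V :\: reach F m -> y \in V :\: reach F m ->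
  fspan V (xop y m (qop c i j (qF F))).
Proof.
move=> FV Fm iD jD yD; set D := reach F m.
have DV : D \subset V by apply: reach_subV FV mV.
rewrite (fop_qF FV (reach_split FV Fm)); last first.
  rewrite -setI_eq0 -subset0; apply/subsetP => -[a b]; rewrite !inE.
  by case/andP=> /and3P[_ aD _] /and3P[_ /andP[]]; rewrite aD.
rewrite qop_fop; apply: (attach DV) => //.
- exact: forest_restr FV.
- exact: root_sub (restr_sub _ _) Fm.
- exact: reach_refl.
apply: closed_below => //; last exact/fspan_qF/(forest_restr _ FV).
by apply/proper_card/properP; split; [apply: subsetDl|exists m; rewrite // inE reach_refl].
Qed.

Lemma remove_parent F p : forest V F -> (p, m) \in F ->
  [/\ forest V (F :\ (p, m)), is_root (F :\ (p, m)) m, p \in V & p \notin reach F m].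
Proof.
move=> FV pm; have [FVV Fi _] := forestP _ _ FV; split.
- by apply: (forest_sub FV (subD1set _ _)) => a b /setD1P[_ /FVV].
- apply/is_rootP => a; rewrite in_setD1; apply/negP => /andP[/eqP am amF].
  by case: am; rewrite (Fi _ _ _ amF pm).
- by have [] := FVV _ _ pm.
- exact: forest_acyclic FV pm.
Qed.

(** If [m] already has a parent [p], both arcs into [m] are blue since [m] is maximal. The Arnold
    relation keeps one of them and adds an edge between [y] and [p], which lies outside the tree at
    [m] and is absorbed by [closed_below]. *)
Lemma xop_in y v : y \in V -> y != m -> fspan V v -> fspan V (xop y m v).
Proof.
move=> yV ym; apply: (lspan_map (f := xop y m)) => [||_ [F FV ->]].
- by rewrite /xop qop0.
- exact: xop_linear.
have [yD|yD] := boolP (y \in reach F m).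
  by rewrite /xop (reach_cycle _ yD ym).2; apply: lspan0.
have [Fm|/parentP[p pm]] := boolP (is_root F m).
  rewrite xop_qF //; last exact: rootN Fm.
  exact/fspan_qF/forest_add.
have [F'V F'm pV pD] := remove_parent FV pm; set F' := F :\ _ in F'V F'm.
have p_m : p != m by apply: contraTneq pm => ->; apply: (forest_irrefl _ FV).
rewrite (qF_remove p_m pm) -/F'; have [<-|py] := eqVneq y p.
  by rewrite /xop qop_multi; apply: lspan0.
have D'D : reach F' m \subset reach F m by apply/reach_sub/subD1set.
have yD' : y \in V :\: reach F' m by rewrite inE yV andbT (contra (subsetP D'D y)).
have pD' : p \in V :\: reach F' m by rewrite inE pV andbT (contra (subsetP D'D p)).
have ypE : xop y m (xop p m (qF F')) = xop p m (qop blue y p (qF F')) -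
    xop y m (qop blue y p (qF F')).
  rewrite /xop !blue_arc ?lt_max // qopC; apply/eqP; rewrite eq_sym subr_eq.
  rewrite [X in _ == _ + X]qopC [X in X == _]qopC qop_arnoldE // 1?eq_sym //.
  by rewrite addrC [X in _ + X]qopC.
by rewrite ypE; apply: lspanB; apply: attach_qop.
Qed.

(** [b] bounds the number of ancestors of [x]. If [x] has a parent [q], a relation on [q], [x], [m]
    trades the arc from [m] to [x] for arcs from [m] to [q], which has fewer ancestors, and for blue
    arcs into [m], which are already settled. *)
Lemma xop_out_root (b : nat) F x : forest V F -> is_root F m -> x \in V ->
  x \notin reach F m -> (#|anc F x| < b)%N -> fspan V (xop m x (qF F)).
Proof.
elim: b F x => // k IHk F x FV Fm xV xD x_k.
have [FVV Fi _] := forestP _ _ FV.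
have xm : x != m by apply: contraNneq xD => ->; apply: reach_refl.
have m_reach F' z : is_root F' m -> z != m -> m \notin reach F' z.
  move=> F'm zm; apply/negP => mz.
  have [|p _ pm] := reach_parent_closed mz; first by rewrite eq_sym.
  by have := rootN p F'm; rewrite pm.
have [Fx|/parentP[q qx]] := boolP (is_root F x).
  rewrite xop_qF 1?eq_sym //; last exact: rootN Fx.
  by apply/fspan_qF/forest_add => //; apply: m_reach.
have [qV _] := FVV _ _ qx.
have q_x : q != x by apply: contraTneq qx => ->; apply: (forest_irrefl _ FV).
have qD : q \notin reach F m by apply: contra xD => /reach_step/(_ qx).
have qm : q != m by apply: contraNneq qD => ->; apply: reach_refl.
set F0 := F :\ (q, x); have F0F : F0 \subset F by apply: subD1set.
have F0V : forest V F0.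
  by apply: (forest_sub FV F0F) => a b /setD1P[_ /FVV].
have F0m : is_root F0 m by apply: root_sub F0F Fm.
have F0x : is_root F0 x.
  apply/is_rootP => a; rewrite in_setD1; apply/negP => /andP[/eqP ax axF].
  by case: ax; rewrite (Fi _ _ _ axF qx).
have qD0 : q \notin reach F0 m by apply: contra qD; apply/subsetP/reach_sub.
have xD0 : x \notin reach F0 m by apply: contra xD; apply/subsetP/reach_sub.
have qx0 : q \notin reach F0 x.
  by apply: contra (forest_acyclic FV qx); apply/subsetP/reach_sub.
have anc_q : (#|anc F q| < k)%N.
  by rewrite -ltnS; apply: leq_ltn_trans (proper_card (anc_parent FV qx)) x_k.
have S_qF : fspan V (xop m q (qF F)) by apply: IHk.
pose F2 := (m, x) |: F0.
have F2V : forest V F2 by apply: forest_add => //; apply: m_reach.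
have mxF0 : (m, x) \notin F0 by apply: rootN F0x.
have F2E : xop m x (qF F0) = qF F2 by rewrite xop_qF // eq_sym.
have FE : qF F = xop q x (qF F0) by rewrite (qF_remove q_x qx).
have F2m : is_root F2 m.
  apply/is_rootP => a; rewrite !inE negb_or xpair_eqE [m == x]eq_sym (negPf xm) andbF /=.
  by have := rootN a F0m; rewrite !inE.
have reach2 u : reach F2 u \subset reach F u :|: reach F0 x.
  apply: reach_ind => [|a b]; first by rewrite inE reach_refl.
  rewrite !in_setU in_set1 => ab /orP[/eqP[_ ->]|abF].
    by rewrite reach_refl orbT.
  case/orP: ab => [au|ax]; last by rewrite (reach_step ax abF) orbT.
  by rewrite (reach_step au (subsetP F0F _ abF)).
have q2 u : q \in reach F2 u -> q \in reach F u.
  by move/(subsetP (reach2 u)); rewrite inE (negPf qx0) orbF.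
have S_qF2 : fspan V (xop m q (qF F2)).
  apply: IHk => //; first by apply: contra qD; apply: q2.
  apply: leq_ltn_trans anc_q; apply/subset_leq_card/subsetP => u.
  by rewrite !inE => h; have := q2 u; rewrite !inE; apply.
(* For [x] below [q] in the order, all arcs involved are red and one Jacobi relation is enough;
   otherwise the arc from [q] to [x] is blue and the mixed relation is needed. *)
have [xq|qx_lt|/val_inj/eqP] := ltngtP x q; last by rewrite eq_sym (negPf q_x).
  suff -> : xop m x (qF F) = xop m q (qF F) - xop m q (qF F2) by apply: lspanB.
  have mq : m != q by rewrite eq_sym.
  rewrite FE -F2E /xop !red_arc ?lt_max // (qop_arnoldE _ _ mq q_x xm).
  by rewrite addrC addKr qopC.
have S_in0 : fspan V (xop m q (qF F0)).
  apply: IHk => //; apply: leq_ltn_trans anc_q; apply/subset_leq_card/subsetP => u.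
  by rewrite !inE => h; have := subsetP (reach_sub u F0F) q; rewrite !inE; apply.
have qVD0 : q \in V :\: reach F0 m by rewrite inE qD0.
have xVD0 : x \in V :\: reach F0 m by rewrite inE xD0.
(* This is the mixed relation on [q], [x], [m] solved for the wanted term. After reorienting edges,
   the five others carry exactly the colours prescribed by [arc_color], so they are again expressed
   through [xop]. *)
suff -> : xop m x (qF F) = - xop x m (xop x q (qF F0)) + xop x m (xop m q (qF F0))
    + xop q m (qF F2) + xop q m (xop x q (qF F0)) + xop m q (qF F).
  apply: lspanD => //; apply: lspanD; last exact: attach_qop.
  apply: lspanD; last by apply: xop_in => //; apply: fspan_qF.
  apply: lspanD; last exact: xop_in.
  by apply: lspanN; apply: attach_qop.
have [xm_lt qm_lt] := (lt_max xV xm, lt_max qV qm).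
rewrite FE -F2E /xop (blue_arc qx_lt) (red_arc qx_lt) (blue_arc xm_lt) (blue_arc qm_lt).
rewrite (red_arc xm_lt) (red_arc qm_lt).
have mq : m != q by rewrite eq_sym.
move/eqP: (qop_mixed (qF F0) q_x xm mq).
rewrite ![qop red x m _]qop_anti ![qop red q x _]qop_anti ![qop blue m q _]qop_anti.
rewrite !qopN !opprK.
rewrite [qop blue q x (qop red m x _)]qopC [qop red x q (qop blue x m _)]qopC.
rewrite [qop red m x (qop blue q m _)]qopC -!addrA addrC subr_eq0 => /eqP <-.
by rewrite !addrA.
Qed.

(** An arc from a parent to [m] is set aside, the root case is applied, and the arc is restored by
    [xop_in]. *)
Lemma xop_out x v : x \in V -> x != m -> fspan V v -> fspan V (xop m x v).
Proof.
move=> xV xm; apply: (lspan_map (f := xop m x)) => [||_ [F FV ->]].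
- by rewrite /xop qop0.
- exact: xop_linear.
have [xD|xD] := boolP (x \in reach F m).
  by rewrite /xop (reach_cycle _ xD xm).1; apply: lspan0.
have [Fm|/parentP[p pm]] := boolP (is_root F m).
  exact: (xop_out_root FV Fm xV xD (ltnSn _)).
have [F'V F'm pV pD] := remove_parent FV pm.
have p_m : p != m by apply: contraTneq pm => ->; apply: (forest_irrefl _ FV).
rewrite (qF_remove p_m pm) /xop qopC; apply: xop_in => //.
apply: (xop_out_root F'V F'm xV _ (ltnSn _)).
exact: contra (subsetP (reach_sub _ (subD1set _ _)) x) xD.
Qed.

Lemma edge_closed_step : edge_closed V.
Proof.
have closed_m c x v : x \in V -> fspan V v ->
    fspan V (qop c m x v) /\ fspan V (qop c x m v).
  move=> xV v_span; suff h : fspan V (qop c m x v).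
    by rewrite [qop c x m v]qop_anti; split=> //; apply: lspanN.
  have [->|xm] := eqVneq x m; first by rewrite qopii; apply: lspan0.
  case: c; first by rewrite -(red_arc (lt_max xV xm)); apply: xop_out.
  by rewrite qop_anti -(blue_arc (lt_max xV xm)); apply/lspanN/xop_in.
move=> c i j v iV jV v_span.
have [->|im] := eqVneq i m; first by case: (closed_m c j v jV v_span).
have [->|jm] := eqVneq j m; first by case: (closed_m c i v iV v_span).
apply: (lspan_map (f := qop c i j)) v_span => [||_ [F FV ->]].
- exact: qop0.
- exact: qop_linear.
(* The arcs meeting [m] are lifted off, the new edge is added within [V :\ m] by [closed_below], and
   the arcs are put back one at a time by [closed_m]. *)
rewrite (fop_qF FV (A := F :\: restr (V :\ m) F) (H := restr (V :\ m) F)).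
- have : {in enum (F :\: restr (V :\ m) F), forall a,
      forall v, fspan V v -> fspan V (xop a.1 a.2 v)}.
    case=> a b; rewrite mem_enum inE in_restr !inE; case: (boolP (_ \in F)); last first.
      by rewrite andbF.
    case/forestP: FV => FVV _ _ /FVV[aV bV]; rewrite aV bV /= !andbT negb_and !negbK.
    move=> /orP[]/eqP-> w w_span /=; first by case: (closed_m (arc_color (m, b)) b w bV w_span).
    by case: (closed_m (arc_color (a, m)) a w aV w_span).
  rewrite qop_fop /fop; elim: (enum _) => [|a s IHs] /= s_cl.
    apply: (fspan_mono (subD1set V m)); apply: closed_below.
    + by rewrite [X in (_ < X)%N](cardsD1 m) mV.
    + by rewrite !inE im.
    + by rewrite !inE jm.
    + exact/fspan_qF/(forest_restr _ FV).
  apply: (s_cl a); first exact: mem_head.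
  by apply: IHs => b b_s; apply: s_cl; rewrite inE b_s orbT.
- by rewrite -[LHS](setID F (restr (V :\ m) F)) (setIidPr (restr_sub _ _)) setUC.
- by rewrite disjoint_sym disjointD.
Qed.

End InductionStep.

Lemma edge_closed_all V : edge_closed V.
Proof.
move: {2}(#|V|.+1) (ltnSn #|V|) => N; elim: N V => // N IHN V VN.
have [->|/ex_max_vertex[m mV m_max]] := eqVneq V set0.
  by move=> c i j v; rewrite inE.
apply: (edge_closed_step mV m_max) => V' V'V; apply: IHN.
by apply: leq_trans V'V _.
Qed.

Lemma Q2_forest_span (q : Q2 R n) :
  lspan (fun v => exists2 F, forest setT F & v = qF F) q.
Proof.
apply: lspan_trans (Q2_span q) => _ [G ->]; rewrite -[G]elistK -/(qE R _).
have : all (fun e => e.2.1 != e.2.2) (elist G).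
  by apply/allP => _ /mapP[e _ ->]; apply: (valP e).
elim: (elist G) => [_|[c [i j]] es IHes /= /andP[ij /IHes]].
  suff -> : qE R [::] = qF set0 by apply/fspan_qF/forest0.
  by rewrite /qF /arc_edges enum_set0.
by rewrite -qopE //; apply: edge_closed_all; rewrite inE.
Qed.

End ForestSpan.

(** * The free algebra and its evaluations *)

Section FreeAlgebraOps.
Variables (R : comPzRingType) (n : nat).
Local Notation T := 'I_n.
Local Notation FA := (free_alg R n).
Implicit Types (x y w f g : FA) (c : color) (i p : T) (A B C D E V : {set T}).

Definition avar i : FA := alg_class (Var i).
Definition abra c x y : FA := alg_class (Bra c (repr x) (repr y)).
Definition amul x y : FA := alg_class (Mul (repr x) (repr y)).

Lemma abraE c (u v : expr R n) :
  abra c (alg_class u) (alg_class v) = alg_class (Bra c u v).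
Proof. by apply/alg_classP/ae_Bra; apply: alg_reprP. Qed.

Lemma amulE (u v : expr R n) : amul (alg_class u) (alg_class v) = alg_class (Mul u v).
Proof. by apply/alg_classP/ae_Mul; apply: alg_reprP. Qed.

Lemma aaddE (u v : expr R n) : alg_class u + alg_class v = alg_class (Add u v).
Proof. exact: alg_addE. Qed.

Lemma ascaleE a (u : expr R n) : a *: alg_class u = alg_class (Scale a u).
Proof. exact: alg_scaleE. Qed.

Lemma free_algW (P : FA -> Prop) : (forall u, P (alg_class u)) -> forall x, P x.
Proof. by move=> Pu x; rewrite -[x]repr_algK. Qed.

Lemma abra_linearl c y a : {morph abra c ^~ y : u v / a *: u + v}.
Proof.
move=> u v; move: u v y; do 3 elim/free_algW => ?.
rewrite ascaleE aaddE !abraE ascaleE aaddE; apply/alg_classP.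
apply: ae_trans (ae_BraDl _ _ _ _) _; exact: (ae_Add (ae_BraZl _ _ _ _) (ae_refl _)).
Qed.

Lemma abra_linearr c y a : {morph abra c y : u v / a *: u + v}.
Proof.
move=> u v; move: u v y; do 3 elim/free_algW => ?.
rewrite ascaleE aaddE !abraE ascaleE aaddE; apply/alg_classP.
apply: ae_trans (ae_BraDr _ _ _ _) _; exact: (ae_Add (ae_BraZr _ _ _ _) (ae_refl _)).
Qed.

Lemma amulC x y : amul x y = amul y x.
Proof. by apply/alg_classP/ae_MulC. Qed.

Lemma amul_linearl y a : {morph amul^~ y : u v / a *: u + v}.
Proof.
move=> u v; move: u v y; do 3 elim/free_algW => ?.
rewrite ascaleE aaddE !amulE ascaleE aaddE; apply/alg_classP.
apply: ae_trans (ae_MulDl _ _ _) _; exact: (ae_Add (ae_MulZl _ _ _) (ae_refl _)).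
Qed.

Lemma amul_linearr y a : {morph amul y : u v / a *: u + v}.
Proof. by move=> u v; rewrite amulC amul_linearl !(amulC y). Qed.

Lemma amulA x y w : amul x (amul y w) = amul (amul x y) w.
Proof.
move: x y w; do 3 elim/free_algW => ?.
rewrite !amulE; apply/alg_classP/ae_MulA.
Qed.

Lemma abra_anti c x y : abra c x y = - abra c y x.
Proof.
apply/eqP; rewrite -addr_eq0; apply/eqP; move: x y; do 2 elim/free_algW => ?.
by rewrite !abraE aaddE; apply/alg_classP/ae_anti.
Qed.

Lemma abraN c x y : abra c x (- y) = - abra c x y.
Proof.
have := abra_linearr c x (-1) y 0; rewrite !scaleN1r !addr0 => ->.
have := abra_linearr c x (-1) 0 0; rewrite scaler0 addr0 => {1}->.
by rewrite scaleN1r addNr addr0.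
Qed.

Lemma abra_jacobi c x y w :
  abra c x (abra c y w) = abra c (abra c x y) w + abra c y (abra c x w).
Proof.
have : abra c x (abra c y w) + abra c y (abra c w x) + abra c w (abra c x y) = 0.
  move: x y w; do 3 elim/free_algW => ?.
  by rewrite !abraE !aaddE; apply/alg_classP/ae_jacobi.
rewrite (abra_anti c w x) abraN (abra_anti c w) -addrA => /eqP.
by rewrite addr_eq0 opprD !opprK addrC => /eqP.
Qed.

(** The mixed relation is solved for blue outside red because in [split_base] all terms on the right
    are already under control. *)
Lemma abra_mixed x y w :
  abra blue x (abra red y w) = - abra red x (abra blue y w)
    + (abra red (abra blue x y) w + abra red y (abra blue x w))
    + (abra blue (abra red x y) w + abra blue y (abra red x w)).
Proof.
have : abra red x (abra blue y w) + abra red y (abra blue w x)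
    + abra red w (abra blue x y)
    + (abra blue x (abra red y w) + abra blue y (abra red w x)
    + abra blue w (abra red x y)) = 0.
  move: x y w; do 3 elim/free_algW => ?.
  by rewrite !abraE !aaddE; apply/alg_classP/ae_mixed.
rewrite (abra_anti blue w x) (abra_anti red w x) !abraN.
rewrite (abra_anti red w) (abra_anti blue w).
set a := abra red x _; set b := abra red y _; set d := abra red _ w.
set e := abra blue x _; set f := abra blue y _; set g := abra blue _ w => h.
apply/eqP; rewrite -subr_eq0 -[X in _ == X]h; apply/eqP.
rewrite !opprD opprK.
by rewrite [LHS](AC (1*((1*2)*2)) (2*4*3*(1*6*5))).
Qed.

Lemma abra_leibniz c x y w :
  abra c x (amul y w) = amul (abra c x y) w + amul y (abra c x w).
Proof.
move: x y w; do 3 elim/free_algW => ?.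
by rewrite amulE !abraE !amulE aaddE; apply/alg_classP/ae_leibniz.
Qed.

Fixpoint esub p (u : expr R n) (v : expr R n) : expr R n :=
  match v with
  | Var i => if i == p then u else Var i
  | Zero => Zero
  | Add v w => Add (esub p u v) (esub p u w)
  | Scale a v => Scale a (esub p u v)
  | Bra c v w => Bra c (esub p u v) (esub p u w)
  | Mul v w => Mul (esub p u v) (esub p u w)
  end.

Lemma esub_alg_eq p u u' v v' : alg_eq u u' -> alg_eq v v' ->
  alg_eq (esub p u v) (esub p u' v').
Proof.
move=> uu' vv'; apply: (@ae_trans _ _ _ (esub p u v')).
  by elim: {v v'}vv' => /=; eauto using alg_eq.
elim: v' {vv'} => /=; eauto using alg_eq.
by move=> i; case: eqP => // _; apply: ae_refl.
Qed.

(** Partial composition in the sense of operads, at the input named [p]; the substituted element may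
    contain [p] again. *)
Definition asub p y x : FA := alg_class (esub p (repr y) (repr x)).

Lemma asubE p (u v : expr R n) :
  asub p (alg_class u) (alg_class v) = alg_class (esub p u v).
Proof. by apply/alg_classP/esub_alg_eq; apply: alg_reprP. Qed.

Lemma asub_linear p y a : {morph asub p y : u v / a *: u + v}.
Proof.
move=> u v; move: u v y; do 3 elim/free_algW => ?.
by rewrite ascaleE aaddE !asubE ascaleE aaddE.
Qed.

Lemma asub_abra p y c u v : asub p y (abra c u v) = abra c (asub p y u) (asub p y v).
Proof.
move: u v y; do 3 elim/free_algW => ?.
by rewrite abraE !asubE abraE.
Qed.

Lemma asub_amul p y u v : asub p y (amul u v) = amul (asub p y u) (asub p y v).
Proof.
move: u v y; do 3 elim/free_algW => ?.
by rewrite amulE !asubE amulE.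
Qed.

Lemma asub_avar p y i : asub p y (avar i) = if i == p then y else avar i.
Proof.
move: y; elim/free_algW => y; rewrite asubE /=.
by case: (i == p).
Qed.

Lemma linear_at0 (M N : lmodType R) (h : M -> N) :
  (forall a, {morph h : u v / a *: u + v}) -> h 0 = 0.
Proof. by move=> /(_ (-1) 0 0); rewrite scaler0 addr0 scaleN1r addNr. Qed.

Lemma lspan2 (op : FA -> FA -> FA) (S S' W : FA -> Prop) x y :
  (forall y a, {morph op^~ y : u v / a *: u + v}) ->
  (forall x a, {morph op x : u v / a *: u + v}) ->
  (forall u v, S u -> S' v -> lspan W (op u v)) ->
  lspan S x -> lspan S' y -> lspan W (op x y).
Proof.
move=> opl opr opW Sx Sy; apply: (lspan_map (f := op^~ y)) Sx => //.
  exact: (linear_at0 (opl y)).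
move=> u Su; apply: (lspan_map (f := op u)) Sy => // [|v S'v].
  exact: (linear_at0 (opr u)).
exact: opW.
Qed.

Inductive monom : {set T} -> FA -> Prop :=
| monom_var i : monom [set i] (avar i)
| monom_bra c A B x y : [disjoint A & B] -> monom A x -> monom B y ->
    monom (A :|: B) (abra c x y)
| monom_mul A B x y : [disjoint A & B] -> monom A x -> monom B y ->
    monom (A :|: B) (amul x y).

Inductive lie_monom : {set T} -> FA -> Prop :=
| lie_var i : lie_monom [set i] (avar i)
| lie_bra c A B x y : [disjoint A & B] -> lie_monom A x -> lie_monom B y ->
    lie_monom (A :|: B) (abra c x y).

Lemma lie_monomW A x : lie_monom A x -> monom A x.
Proof.
by elim=> {A x} [i|c A B x y AB _ xm _ ym]; [apply: monom_var|apply: monom_bra].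
Qed.

Lemma monom_neq0 A x : monom A x -> A != set0.
Proof.
elim=> {A x} [i|c A B x y _ _ A0 _ _|A B x y _ _ A0 _ _].
- by apply/set0Pn; exists i; rewrite inE.
- by rewrite setU_eq0 negb_and A0.
- by rewrite setU_eq0 negb_and A0.
Qed.

(** The multilinear component on the variables of [A]. Without a unit it has no generator for empty
    [A] and is then zero. *)
Definition PV A := lspan (monom A).

Lemma PV_monom A x : monom A x -> PV A x. Proof. exact: lspan_gen. Qed.

Lemma PV_bra c A B x y : [disjoint A & B] -> PV A x -> PV B y ->
  PV (A :|: B) (abra c x y).
Proof.
move=> AB; apply: lspan2 => [u a|u a|u v xm ym]; [exact: abra_linearl|exact: abra_linearr|].
exact/PV_monom/monom_bra.
Qed.

Lemma PV_mul A B x y : [disjoint A & B] -> PV A x -> PV B y ->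
  PV (A :|: B) (amul x y).
Proof.
move=> AB; apply: lspan2 => [u a|u a|u v xm ym]; [exact: amul_linearl|exact: amul_linearr|].
exact/PV_monom/monom_mul.
Qed.

Lemma asub_id p y A x : PV A x -> p \notin A -> asub p y x = x.
Proof.
move=> xA pA.
apply: (lspan_eq (f := asub p y) (g := id) _ _ _ _ _ xA) => //.
- exact/linear_at0/asub_linear.
- exact: asub_linear.
move=> {x xA} w wm; elim: wm pA => {A w} [i|c A B u v _ _ IHu _ IHv|A B u v _ _ IHu _ IHv].
- by rewrite inE asub_avar eq_sym => /negPf->.
- by rewrite inE negb_or asub_abra => /andP[/IHu-> /IHv->].
- by rewrite inE negb_or asub_amul => /andP[/IHu-> /IHv->].
Qed.

(** In a multilinear monomial containing [p] this variable occurs exactly once, which makes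
    substitution linear in the inserted element as well. *)
Lemma asub_linear2 p A x a u v : PV A x -> p \in A ->
  asub p (a *: u + v) x = a *: asub p u x + asub p v x.
Proof.
move=> xA pA.
apply: (lspan_eq (f := asub p (a *: u + v)) (g := fun x => a *: asub p u x + asub p v x)
  _ _ _ _ _ xA) => //; try exact/linear_at0/asub_linear; try exact: asub_linear.
- by rewrite !(linear_at0 (asub_linear p _)) scaler0 addr0.
- move=> b s t; rewrite !asub_linear !scalerDr !scalerA [a * b]mulrC.
  by rewrite addrACA.
move=> {x xA} w wm; elim: wm pA => {A w} [i|c A B s t AB sm IHs tm IHt|A B s t AB sm IHs tm IHt].
- by rewrite inE !asub_avar eq_sym => ->.
- rewrite !asub_abra inE; have [pA _|pA /= pB] := boolP (p \in A).
    have pB : p \notin B by rewrite (disjointFr AB).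
    by rewrite IHs // !(asub_id _ (PV_monom tm) pB) abra_linearl.
  by rewrite IHt // !(asub_id _ (PV_monom sm) pA) abra_linearr.
- rewrite !asub_amul inE; have [pA _|pA /= pB] := boolP (p \in A).
    have pB : p \notin B by rewrite (disjointFr AB).
    by rewrite IHs // !(asub_id _ (PV_monom tm) pB) amul_linearl.
  by rewrite IHt // !(asub_id _ (PV_monom sm) pA) amul_linearr.
Qed.

Lemma subst_domain p A B E : p \in A -> [disjoint A & B] ->
  [disjoint (A :|: B) :\ p & E] ->
  [/\ (A :|: B) :\ p :|: E = (A :\ p :|: E) :|: B,
      [disjoint A :\ p & E], [disjoint A :\ p :|: E & B] & p \notin B].
Proof.
move=> pA AB dE; have pB : p \notin B by rewrite (disjointFr AB).
move: AB dE; rewrite -!setI_eq0 => /eqP/setP AB /eqP/setP dE; split=> //.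
- apply/setP => k; move: (AB k); rewrite !inE; have [->|_] /= := eqVneq k p.
    by rewrite (negPf pB) orbF.
  by case: (k \in A); case: (k \in B); case: (k \in E).
- apply/eqP/setP => k; move: (dE k); rewrite !inE.
  by case: (k == p); case: (k \in A); case: (k \in E); rewrite //= ?orbT.
apply/eqP/setP => k; move: (AB k) (dE k); rewrite !inE; have [->|_] /= := eqVneq k p.
  by rewrite (negPf pB) !andbF.
by case: (k \in A); case: (k \in B); case: (k \in E).
Qed.

Lemma asub_monom p y A E x : monom A x -> p \in A -> monom E y ->
  [disjoint A :\ p & E] -> monom ((A :\ p) :|: E) (asub p y x).
Proof.
move=> xm pA yE.
have step (op : FA -> FA -> FA) B C s t :
    (forall A B x y, [disjoint A & B] -> monom A x -> monom B y ->
      monom (A :|: B) (op x y)) ->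
    (forall u v, asub p y (op u v) = op (asub p y u) (asub p y v)) ->
    [disjoint B & C] -> monom B s -> monom C t ->
    (p \in B -> [disjoint B :\ p & E] -> monom (B :\ p :|: E) (asub p y s)) ->
    (p \in C -> [disjoint C :\ p & E] -> monom (C :\ p :|: E) (asub p y t)) ->
    p \in B :|: C -> [disjoint (B :|: C) :\ p & E] ->
    monom ((B :|: C) :\ p :|: E) (asub p y (op s t)).
  move=> opm opE BC sm tm IHs IHt; rewrite inE opE => /orP[pB|pC] dE.
    have [-> BE BEC pC] := subst_domain pB BC dE.
    by rewrite (asub_id _ (PV_monom tm) pC); apply: opm => //; apply: IHs.
  move: BC dE; rewrite disjoint_sym setUC => CB dE.
  have [-> CE CEB pB] := subst_domain pC CB dE; rewrite setUC.
  by rewrite (asub_id _ (PV_monom sm) pB); apply: opm; rewrite 1?disjoint_sym //; apply: IHt.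
elim: xm pA => {A x} [i|c A B s t AB sm IHs tm IHt|A B s t AB sm IHs tm IHt] pA.
- by move: pA; rewrite inE asub_avar eq_sym => /eqP->; rewrite eqxx setDv set0U.
- apply: step sm tm IHs IHt pA => // [B' C' u v|u v]; last exact: asub_abra.
  exact: monom_bra.
- apply: step sm tm IHs IHt pA => // [B' C' u v|u v]; last exact: asub_amul.
  exact: monom_mul.
Qed.

Lemma PV_asub p y A E x : PV A x -> p \in A -> PV E y -> [disjoint A :\ p & E] ->
  PV ((A :\ p) :|: E) (asub p y x).
Proof.
move=> xA pA yE dE.
apply: (lspan_map (f := asub p y)) xA => [||w wm].
- exact/linear_at0/asub_linear.
- exact: asub_linear.
apply: (lspan_map (f := fun y => asub p y w)) yE => [|a u v|u um].
- apply: (linear_at0 (h := fun y => asub p y w)) => a u v.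
  exact: asub_linear2 (PV_monom wm) pA.
- exact: asub_linear2 (PV_monom wm) pA.
- exact/PV_monom/asub_monom.
Qed.

(** [q] can only occur in what is inserted for [p], so the outer substitution acts there. *)
Lemma asub_comp p q y w A x : PV A x -> q \notin A ->
  asub q w (asub p y x) = asub p (asub q w y) x.
Proof.
move=> xA qA.
apply: (lspan_eq (f := fun x => asub q w (asub p y x)) _ _ _ _ _ xA);
  try by [exact/linear_at0/asub_linear | exact: asub_linear].
- by rewrite !(linear_at0 (asub_linear _ _)).
- by move=> a u v; rewrite !asub_linear.
move=> {x xA} u um; elim: um qA => {A u} [i|c A B s t AB sm IHs tm IHt|A B s t AB sm IHs tm IHt].
- rewrite inE !asub_avar; case: (eqVneq i p) => // ip; rewrite asub_avar eq_sym.
  by move/negPf->.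
- by rewrite inE negb_or !asub_abra => /andP[/IHs-> /IHt->].
- by rewrite inE negb_or !asub_amul => /andP[/IHs-> /IHt->].
Qed.

Lemma asub_asub p y w x : asub p w (asub p y x) = asub p (asub p w y) x.
Proof.
elim/free_algW: x => v; elim/free_algW: y => u; elim/free_algW: w => t.
rewrite !asubE; congr alg_class.
elim: v => //= [i|v IHv s IHs|a v IHv|c v IHv s IHs|v IHv s IHs]; rewrite ?IHv ?IHs //.
by case: (boolP (i == p)) => //= /negPf->.
Qed.

End FreeAlgebraOps.

(** * Evaluation of multilinear products and substitutions *)

Section EvaluationAlgebra.
Variables (R : comPzRingType) (n : nat).
Local Notation T := 'I_n.
Local Notation FA := (free_alg R n).
Implicit Types (x y w f g : FA) (c : color) (i p : T) (A B C D E S V : {set T}).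

Lemma conv_supp (w : {set T} -> {set T} -> R) (f g : {set T} -> R) A B V :
  (forall S, S != A -> f S = 0) -> (forall S, S != B -> g S = 0) ->
  [disjoint A & B] ->
  conv w f g V = (V == A :|: B)%:R * (w A B * f A * g B).
Proof.
move=> fA gB AB; rewrite /conv (bigD1 A) //= [X in _ + X]big1 ?addr0; last first.
  by move=> S SA; rewrite big1 // => S' _; rewrite fA ?mulr0 ?mul0r.
rewrite big_mkcond (bigD1 B) //= [X in _ + X]big1 ?addr0; last first.
  by move=> S SB; rewrite gB // mulr0; case: ifP.
by rewrite /part2 AB /= eq_sym; case: eqP => _; rewrite ?mul1r ?mul0r.
Qed.

Section Weights.
Variables (z : {set T} -> {set T} -> R) (s : color -> {set T} -> {set T} -> R).
Hypothesis wt : weight_axioms z s.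

Lemma aev_abra c x y V :
  aev z s (abra c x y) V = conv (s c) (aev z s x) (aev z s y) V.
Proof. by rewrite aevE. Qed.

Lemma aev_amul x y V : aev z s (amul x y) V = conv z (aev z s x) (aev z s y) V.
Proof. by rewrite aevE. Qed.

Lemma aev_avar i V : aev z s (avar R i) V = (V == [set i])%:R.
Proof. by rewrite aevE. Qed.

(** Evaluation respects multidegree, so a convolution of multilinear elements reduces to a single
    splitting. *)
Lemma aev_supp A x S : PV A x -> S != A -> aev z s x S = 0.
Proof.
move=> xA SA.
apply: (lspan_eq (f := fun x => aev z s x S : R^o) (g := fun=> 0) _ _ _ _ _ xA) => //.
- exact: (aev0 wt S).
- exact: (aev_linear wt S).
- by move=> a u v; rewrite scaler0 addr0.
move=> {x xA} u um; elim: um S SA => {A u} [i|c A B u v AB _ IHu _ IHv|A B u v AB _ IHu _ IHv] S SA.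
- by rewrite aev_avar (negPf SA).
- by rewrite aev_abra (conv_supp _ _ IHu IHv AB) (negPf SA) mul0r.
- by rewrite aev_amul (conv_supp _ _ IHu IHv AB) (negPf SA) mul0r.
Qed.

Lemma aev_abra_at c A B x y : [disjoint A & B] -> PV A x -> PV B y ->
  aev z s (abra c x y) (A :|: B) = s c A B * aev z s x A * aev z s y B.
Proof.
move=> AB xA yB; rewrite aev_abra.
by rewrite (conv_supp _ _ (fun S => aev_supp xA (S := S))
  (fun S => aev_supp yB (S := S)) AB) eqxx mul1r.
Qed.

Lemma aev_amul_at A B x y : [disjoint A & B] -> PV A x -> PV B y ->
  aev z s (amul x y) (A :|: B) = z A B * aev z s x A * aev z s y B.
Proof.
move=> AB xA yB; rewrite aev_amul.
by rewrite (conv_supp _ _ (fun S => aev_supp xA (S := S))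
  (fun S => aev_supp yB (S := S)) AB) eqxx mul1r.
Qed.

(* [expand D p A] undoes the contraction of [p |: D] to the vertex [p]. *)
Definition expand D p A := (A :\: D) :|: (if p \in A then D else set0).

Lemma expand_disjoint D p A B : [disjoint A & B] ->
  [disjoint expand D p A & expand D p B].
Proof.
rewrite -!setI_eq0 => /eqP/setP AB; apply/eqP/setP => k.
move: (AB k) (AB p); rewrite !inE.
by case: (p \in A); case: (p \in B); rewrite ?inE; case: (k \in A); case: (k \in B);
  case: (k \in D).
Qed.

Lemma expandU D p A B : expand D p (A :|: B) = expand D p A :|: expand D p B.
Proof.
apply/setP => k; rewrite !inE.
by case: (p \in A); case: (p \in B); rewrite ?inE; case: (k \in A); case: (k \in B);
  case: (k \in D).
Qed.

Lemma expand_in D p A : [disjoint A & D] -> p \in A -> expand D p A = A :|: D.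
Proof. by move=> AD pA; rewrite /expand pA (setDidPl AD). Qed.

Lemma expand_notin D p A : [disjoint A & D] -> p \notin A -> expand D p A = A.
Proof. by move=> AD /negPf pA; rewrite /expand pA (setDidPl AD) setU0. Qed.

End Weights.

Definition zexp D p (z : {set T} -> {set T} -> R) A B := z (expand D p A) (expand D p B).
Definition sexp D p (s : color -> {set T} -> {set T} -> R) c A B :=
  s c (expand D p A) (expand D p B).

Lemma expand_weight_axioms D p z s : weight_axioms z s ->
  weight_axioms (zexp D p z) (sexp D p s).
Proof.
case=> zC sN zU sU; split=> [A B|c A B|A B C AB AC BC|c A B C AB AC BC].
- by move/(expand_disjoint D p); apply: zC.
- by move/(expand_disjoint D p); apply: sN.
- by rewrite /zexp expandU zU ?expand_disjoint.
- by rewrite /sexp /zexp expandU sU ?expand_disjoint.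
Qed.

Lemma aev_exp_notin z s D p B x : weight_axioms z s -> p \notin B ->
  [disjoint B & D] -> aev (zexp D p z) (sexp D p s) x B = aev z s x B.
Proof.
move=> wt pB BD; apply: ev_local => A A' _ AAB.
have exp_id S : S \subset B -> expand D p S = S.
  move=> SB; apply: expand_notin; first exact: disjointWl SB BD.
  by apply: contra pB; apply: subsetP.
by rewrite /zexp /sexp !exp_id ?(subset_trans _ AAB) ?subsetUl ?subsetUr.
Qed.

Lemma PV_asubU D p C x y : PV C x -> p \in C -> [disjoint C & D] ->
  PV (p |: D) y -> PV (C :|: D) (asub p y x).
Proof.
move=> xC pC CD yD; have -> : C :|: D = C :\ p :|: (p |: D).
  by rewrite setUA [_ :|: [set p]]setUC setD1K.
apply: PV_asub => //; move: CD; rewrite -!setI_eq0 => /eqP/setP CD.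
apply/eqP/setP => k; move: (CD k); rewrite !inE.
by case: (k == p); case: (k \in C); case: (k \in D).
Qed.

(** The splittings made by the outer element never separate [p] from [D]. It therefore sees the
    weights in which the block [p |: D] is contracted to [p], and the inserted element contributes
    its own value on that block. *)
Lemma aev_asub z s D p C x y : weight_axioms z s -> PV C x -> p \in C ->
  [disjoint C & D] -> PV (p |: D) y ->
  aev z s (asub p y x) (C :|: D) =
  aev (zexp D p z) (sexp D p s) x C * aev z s y (p |: D).
Proof.
move=> wt xC pC CD yD; have wt' := expand_weight_axioms D p wt.
apply: (lspan_eq (f := fun x => aev z s (asub p y x) (C :|: D) : R^o)
  (g := fun x => aev (zexp D p z) (sexp D p s) x C * aev z s y (p |: D) : R^o)
  _ _ _ _ _ xC).
- by rewrite (linear_at0 (asub_linear p y)) aev0.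
- by move=> a u v; rewrite asub_linear; apply: (aev_linear wt).
- by rewrite aev0 ?mul0r.
- by move=> a u v; rewrite (aev_linear wt') mulrDl -mulrA.
move=> {x xC} u um.
have step (op : FA -> FA -> FA) (w : {set T} -> {set T} -> R) A B u1 u2 :
    (forall v1 v2, asub p y (op v1 v2) = op (asub p y v1) (asub p y v2)) ->
    (forall A B x y, [disjoint A & B] -> PV A x -> PV B y ->
      aev z s (op x y) (A :|: B) = w A B * aev z s x A * aev z s y B) ->
    (forall A B x y, [disjoint A & B] -> PV A x -> PV B y ->
      aev (zexp D p z) (sexp D p s) (op x y) (A :|: B) =
      w (expand D p A) (expand D p B) * aev (zexp D p z) (sexp D p s) x A
      * aev (zexp D p z) (sexp D p s) y B) ->
    [disjoint A & B] -> PV A u1 -> PV B u2 -> [disjoint A :|: B & D] ->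
    p \in A :|: B ->
    (p \in A -> [disjoint A & D] -> aev z s (asub p y u1) (A :|: D) =
      aev (zexp D p z) (sexp D p s) u1 A * aev z s y (p |: D)) ->
    (p \in B -> [disjoint B & D] -> aev z s (asub p y u2) (B :|: D) =
      aev (zexp D p z) (sexp D p s) u2 B * aev z s y (p |: D)) ->
    aev z s (asub p y (op u1 u2)) (A :|: B :|: D) =
    aev (zexp D p z) (sexp D p s) (op u1 u2) (A :|: B) * aev z s y (p |: D).
  move=> opE opz opz' AB u1A u2B ABD; rewrite inE opE => pAB IH1 IH2.
  have AD := disjointWl (subsetUl A B) ABD; have BD := disjointWl (subsetUr A B) ABD.
  rewrite (opz' _ _ _ _ AB) //; case/orP: pAB => [pA|pB].
    have pB : p \notin B by rewrite (disjointFr AB).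
    have ADB : [disjoint A :|: D & B].
      by rewrite disjoint_setUl AB disjoint_sym BD.
    have uAD : PV (A :|: D) (asub p y u1) by apply: PV_asubU.
    rewrite (asub_id _ u2B pB) setUAC opz // IH1 // (@aev_exp_notin z s D p B u2) //.
    by rewrite expand_in // expand_notin //; ring.
  have pA : p \notin A by rewrite (disjointFl AB).
  have ABD' : [disjoint A & B :|: D].
    by rewrite disjoint_setUr AB AD.
  have uBD : PV (B :|: D) (asub p y u2) by apply: PV_asubU.
  rewrite (asub_id _ u1A pA) -setUA opz // IH2 // (@aev_exp_notin z s D p A u1) //.
  by rewrite expand_notin // expand_in //; ring.
elim: um pC CD => {C u} [i|c A B u v AB um IHu vm IHv|A B u v AB um IHu vm IHv] pC CD.
- move: pC; rewrite inE asub_avar eq_sym => /eqP->.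
  by rewrite eqxx (aev_avar wt') eqxx mul1r.
- apply: (step _ (s c)) => //; try exact: PV_monom; first exact: asub_abra.
    by move=> *; apply: aev_abra_at.
  by move=> *; apply: (aev_abra_at wt').
- apply: (step _ z) => //; try exact: PV_monom; first exact: asub_amul.
    by move=> *; apply: aev_amul_at.
  by move=> *; apply: (aev_amul_at wt').
Qed.

End EvaluationAlgebra.

(** * Evaluation on forests *)

Section ForestEvaluation.
Variables (R : comPzRingType) (n : nat).
Local Notation T := 'I_n.
Local Notation FA := (free_alg R n).
Implicit Types (x y w f g : FA) (c : color) (i p u v : T) (A B C D E S V Y : {set T}).
Implicit Types (F H : {set T * T}).

Definition fz F : {set T} -> {set T} -> R := zwt R (arc_edges F).
Definition fs F : color -> {set T} -> {set T} -> R := swt R (arc_edges F).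
Definition fev F x V : R := aev (fz F) (fs F) x V.

Lemma fwt F : weight_axioms (fz F) (fs F). Proof. exact: edge_weight_axioms. Qed.

Definition fcross F A B := [set a in F | crosses A B (arc_color a, a)].

Lemma in_fcross F A B a :
  (a \in fcross F A B) = (a \in F) && crosses A B (arc_color a, a).
Proof. by rewrite inE. Qed.

Lemma crossings_arcs F A B : crossings (arc_edges F) A B = #|fcross F A B|.
Proof.
rewrite /crossings /arc_edges count_map -sum1_count -sum1_card big_enum_cond /=.
by apply: eq_bigl => a; rewrite inE.
Qed.

Lemma fzE F A B : fz F A B = (fcross F A B == set0)%:R.
Proof. by rewrite /fz /zwt crossings_arcs cards_eq0. Qed.

Lemma fs_neq0 F c A B : fs F c A B != 0 ->
  exists2 a, fcross F A B = [set a] & arc_color a = c.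
Proof.
rewrite /fs /swt crossings_arcs; case: (#|_| =P 1%N) => [/eqP/cards1P[a aE]|_]; last first.
  by rewrite mul0r eqxx.
rewrite mul1r => oc; exists a => //; apply: contraNeq oc => ac; apply/eqP.
rewrite /orientation big_map big_enum_cond /= big1 // => b /andP[bF bc].
have bN : ~~ crosses A B (arc_color b, b).
  apply: contra ac => bx; have : b \in fcross F A B by rewrite inE bF.
  by rewrite aE inE => /eqP <-.
by move: bN; rewrite negb_or => /andP[/negPf-> /negPf->]; rewrite subrr.
Qed.

Lemma fs_eq1 F c A B a : fcross F A B = [set a] -> arc_color a = c ->
  a.1 \in A -> a.2 \in B -> [disjoint A & B] -> fs F c A B = 1.
Proof.
move=> aE ac a1 a2 AB; rewrite /fs /swt crossings_arcs aE cards1 eqxx mul1r.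
have : a \in fcross F A B by rewrite aE inE.
rewrite inE => /andP[aF _].
rewrite /orientation big_map big_enum_cond /= (bigD1 a) /=; last by rewrite aF ac eqxx.
rewrite /between /= a1 a2 (disjointFr AB a1) subr0 big1 ?addr0 // => b.
case/andP=> /andP[bF _] ba; have bN : ~~ crosses A B (arc_color b, b).
  apply: contra ba => bx; have : b \in fcross F A B by rewrite inE bF.
  by rewrite aE inE.
by move: bN; rewrite negb_or /between /= => /andP[/negPf-> /negPf->]; rewrite subrr.
Qed.

Lemma fev_restr F x V : fev F x V = fev (restr V F) x V.
Proof.
rewrite /fev /aev -!/(gev _ _ _) gev_filter; apply: gev_perm.
rewrite /arc_edges filter_map; apply/perm_map/uniq_perm => [||a].
- exact/filter_uniq/enum_uniq.
- exact: enum_uniq.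
by rewrite mem_filter !mem_enum [in RHS]inE andbC.
Qed.

Lemma mul_neq0 (a b : R) : a * b != 0 -> a != 0 /\ b != 0.
Proof.
by move=> ab; split; apply: contraNneq ab => ->; rewrite ?mul0r ?mulr0.
Qed.

Definition linked F u v := connect (fun a b => ((a, b) \in F) || ((b, a) \in F)) u v.

Lemma linked_sub F F' u v : F \subset F' -> linked F u v -> linked F' u v.
Proof.
move=> /subsetP FF'; apply: connect_sub => a b ab; apply: connect1.
by case/orP: ab => /FF'->; rewrite ?orbT.
Qed.

Lemma linked_sym F u v : linked F u v = linked F v u.
Proof. by apply: sym_connect_sym => a b; rewrite orbC. Qed.

(** Each bracket requires an arc between its two parts, so by induction a nonzero value makes the
    whole vertex set connected. *)
Lemma lie_linked F Y y : lie_monom Y y -> fev F y Y != 0 ->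
  forall u v, u \in Y -> v \in Y -> linked (restr Y F) u v.
Proof.
elim=> {Y y} [i _ u v|c A B s t AB sm IHs tm IHt].
  by rewrite !inE => /eqP-> /eqP->; apply: connect0.
rewrite /fev (aev_abra_at (fwt F)) //; do ?exact/PV_monom/lie_monomW.
case/mul_neq0=> /mul_neq0[/fs_neq0[[a b] abE _] /IHs sA] /IHt tB.
have : (a, b) \in fcross F A B by rewrite abE inE.
rewrite inE => /andP[abF abx].
have restrS S : S \subset A :|: B -> restr S F \subset restr (A :|: B) F.
  move=> /subsetP SAB; apply/subsetP => -[k l]; rewrite !in_restr.
  by case/and3P=> -> /SAB-> /SAB->.
have lA u v : u \in A -> v \in A -> linked (restr (A :|: B) F) u v.
  by move=> uA vA; apply: linked_sub (sA u v uA vA); apply/restrS/subsetUl.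
have lB u v : u \in B -> v \in B -> linked (restr (A :|: B) F) u v.
  by move=> uB vB; apply: linked_sub (tB u v uB vB); apply/restrS/subsetUr.
have [k [l [kA lB' kl]]] : exists k l, [/\ k \in A, l \in B &
    linked (restr (A :|: B) F) k l].
  case/orP: abx => /andP[/= aS bS]; [exists a, b|exists b, a]; split=> //;
  by apply: connect1; rewrite !in_restr abF !inE aS bS ?orbT.
have lAB u v : u \in A -> v \in B -> linked (restr (A :|: B) F) u v.
  move=> uA vB; apply: connect_trans (lA u k uA kA) _.
  exact: connect_trans kl (lB l v lB' vB).
move=> u v; rewrite !inE => /orP[uS|uS] /orP[vS|vS]; auto.
by rewrite linked_sym; apply: lAB.
Qed.

End ForestEvaluation.

(** * Straightening monomials *)

Section Straightening.
Variables (R : comPzRingType) (n : nat).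
Local Notation T := 'I_n.
Local Notation FA := (free_alg R n).
Implicit Types (x y w f g s t : FA) (c d : color) (p q m : T).
Implicit Types (A B C D E S U V Y : {set T}).

Inductive nmono : {set T} -> FA -> Prop :=
| nmono_lie A x : lie_monom A x -> nmono A x
| nmono_mul A B x y : [disjoint A & B] -> nmono A x -> nmono B y ->
    nmono (A :|: B) (amul x y).

Lemma nmono_mul_span A B x y : [disjoint A & B] -> lspan (nmono A) x ->
  lspan (nmono B) y -> lspan (nmono (A :|: B)) (amul x y).
Proof.
move=> AB; apply: lspan2 => [u a|u a|u v xm ym]; [exact: amul_linearl|exact: amul_linearr|].
exact/lspan_gen/nmono_mul.
Qed.

(** The Leibniz rule, used in both arguments, pulls products out of the bracket until only Lie
    monomials are bracketed. *)
Lemma nmono_bra c A B x y : [disjoint A & B] -> nmono A x -> nmono B y ->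
  lspan (nmono (A :|: B)) (abra c x y).
Proof.
move=> AB xm; elim: xm B y AB => {A x} [A x xl|A1 A2 x1 x2 A12 x1m IH1 x2m IH2] B y AB ym.
  elim: ym AB => {B y} [B y yl|B1 B2 y1 y2 B12 y1m IH1 y2m IH2] AB.
    exact/lspan_gen/nmono_lie/lie_bra.
  have AB1 := disjointWr (subsetUl B1 B2) AB.
  have AB2 := disjointWr (subsetUr B1 B2) AB.
  rewrite abra_leibniz; apply: lspanD.
    rewrite setUA; apply: nmono_mul_span; [|exact: IH1|exact: lspan_gen].
    by rewrite disjoint_setUl AB2.
  rewrite setUCA; apply: nmono_mul_span; [|exact: lspan_gen|exact: IH2].
  by rewrite disjoint_setUr B12 disjoint_sym AB1.
have A1B := disjointWl (subsetUl A1 A2) AB.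
have A2B := disjointWl (subsetUr A1 A2) AB.
rewrite abra_anti abra_leibniz opprD.
have mulN (u v : FA) : amul (- u) v = - amul u v.
  have := amul_linearl v (-1) u 0; rewrite !scaleN1r !addr0 => ->.
  by rewrite (linear_at0 (amul_linearl v)) addr0.
have mulNr (u v : FA) : amul u (- v) = - amul u v by rewrite amulC mulN amulC.
rewrite -mulN -abra_anti -mulNr -abra_anti; apply: lspanD.
  rewrite setUAC; apply: nmono_mul_span; [|exact: IH1|exact: lspan_gen].
  by rewrite disjoint_setUl A12 disjoint_sym A2B.
rewrite -setUA; apply: nmono_mul_span; [|exact: lspan_gen|exact: IH2].
by rewrite disjoint_setUr A12 A1B.
Qed.

Lemma PV_nmono A x : PV A x -> lspan (nmono A) x.
Proof.
apply: lspan_trans => {x} x.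
elim=> {A x} [i|c A B x y AB _ IHx _ IHy|A B x y AB _ IHx _ IHy].
- exact/lspan_gen/nmono_lie/lie_var.
- move: IHx IHy; apply: lspan2 => [u a|u a|u v]; [exact: abra_linearl|exact: abra_linearr|].
  exact: nmono_bra.
- exact: nmono_mul_span.
Qed.

Lemma nmonoW A x : nmono A x -> monom A x.
Proof.
by elim=> {A x} [A x /lie_monomW|A B x y AB _ xm _ ym] //; apply: monom_mul.
Qed.

Variable v : T.
Local Notation xv := (avar R v).

Lemma setUD1 A B : v \notin B -> (A :|: B) :\ v = A :\ v :|: B.
Proof.
by move=> vB; rewrite setDUl; congr (_ :|: _); apply/setDidPl; rewrite disjoint_sym disjoints1.
Qed.

(** The final position of [v] beside the variables of [C]: alone, attached by blue(p, v) to a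
    variable [p], or heading a word red(v, y) that in turn replaces [v]. *)
Inductive split_gen C : FA -> Prop :=
| split_triv : C = set0 -> split_gen C xv
| split_blue p g : p \in C -> PV C g ->
    split_gen C (asub p (abra blue (avar R p) xv) g)
| split_red Y f y : Y \subset C -> lie_monom Y y -> PV (v |: (C :\: Y)) f ->
    split_gen C (asub v (abra red xv y) f).

Definition split C := lspan (split_gen C).

Lemma split_domain C Y Y' : v \notin Y -> [disjoint C & Y] -> Y' \subset C ->
  v |: (C :|: Y) :\: Y' = (v |: C :\: Y') :|: Y /\ [disjoint v |: C :\: Y' & Y].
Proof.
move=> vY CY Y'C; split.
  rewrite setDUl -setUA; congr (_ :|: (_ :|: _)); apply/setDidPl.
  by rewrite disjoint_sym; apply: disjointWl CY.
by rewrite disjoint_setUl disjoints1 vY; apply: disjointWl CY; apply: subsetDl.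
Qed.

(** Bracketing with [y] commutes with either substitution, since neither [p] nor [v] occurs in [y].
    Only when [x] is [v] itself is something to be straightened, and that is the hypothesis
    [base]. *)
Lemma split_bra C Y y c x : v \notin C -> v \notin Y -> [disjoint C & Y] ->
  monom Y y -> (forall d, split Y (abra d xv y)) -> split C x ->
  split (C :|: Y) (abra c x y).
Proof.
move=> vC vY CY ym base; apply: (lspan_map (f := abra c ^~ y)) => [||_ []].
- exact: (linear_at0 (abra_linearl c y)).
- exact: abra_linearl.
- by move=> ->; rewrite set0U; apply: base.
- move=> p g pC gC; have pY : p \notin Y by rewrite (disjointFr CY).
  rewrite /= -(asub_id (abra blue (avar R p) xv) (PV_monom ym) pY) -asub_abra.
  apply/lspan_gen/split_blue; first by rewrite inE pC.
  by apply: PV_bra => //; apply: PV_monom.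
move=> Y' f' y' Y'C y'l f'C.
rewrite /= -(asub_id (abra red xv y') (PV_monom ym) vY) -asub_abra.
apply: lspan_gen; apply: (@split_red _ Y') => //; first exact: subset_trans Y'C (subsetUl _ _).
have [-> dis] := split_domain vY CY Y'C.
by apply: PV_bra => //; apply: PV_monom.
Qed.

Lemma split_redv Y y : lie_monom Y y -> split Y (abra red xv y).
Proof.
move=> yl; have {1}-> : abra red xv y = asub v (abra red xv y) xv.
  by rewrite asub_avar eqxx.
apply: lspan_gen; apply: split_red => //.
by rewrite setDv setU0; apply/PV_monom/monom_var.
Qed.

(* Modulo brackets red(v, _), the operator blue(v, _) is a derivation. *)
Lemma split_base Y y d : lie_monom Y y -> v \notin Y -> split Y (abra d xv y).
Proof.
move=> yl; elim: yl d => {Y y} [q|d A B s t AB sl IHs tl IHt] [] vY.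
- exact/split_redv/lie_var.
- rewrite abra_anti; apply/lspanN.
  have -> : abra blue (avar R q) xv = asub q (abra blue (avar R q) xv) (avar R q).
    by rewrite asub_avar eqxx.
  by apply/lspan_gen/split_blue; rewrite ?inE //; apply/PV_monom/monom_var.
- exact/split_redv/lie_bra.
move: (vY); rewrite inE negb_or => /andP[vA vB].
have BA : [disjoint B & A] by rewrite disjoint_sym.
have st c c' : split (A :|: B) (abra c (abra c' xv s) t).
  by apply: split_bra => // [|d'|]; [apply: lie_monomW|apply: IHt|apply: IHs].
have ts c c' : split (A :|: B) (abra c s (abra c' xv t)).
  rewrite abra_anti setUC; apply/lspanN.
  by apply: split_bra => // [|d'|]; [apply: lie_monomW|apply: IHs|apply: IHt].
(* The outer bracket is blue: over a blue bracket this is Jacobi, over a red one the mixed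
   relation. *)
case: d; last by rewrite abra_jacobi; apply: lspanD; [exact: st|exact: ts].
rewrite abra_mixed; apply: lspanD; last by apply: lspanD; [exact: st|exact: ts].
apply: lspanD; last by apply: lspanD; [exact: st|exact: ts].
exact/lspanN/split_redv/lie_bra.
Qed.

Lemma split_lie V f : lie_monom V f -> v \in V -> split (V :\ v) f.
Proof.
elim=> {V f} [i|c A B s t AB sl IHs tl IHt].
  rewrite inE => /eqP <-; apply: lspan_gen; rewrite setDv.
  exact: split_triv.
rewrite inE => /orP[vA|vB].
  have vB : v \notin B by rewrite (disjointFr AB).
  rewrite setUD1 //.
  apply: split_bra => //.
  - by rewrite !inE eqxx.
  - exact: disjointWl (subD1set _ _) AB.
  - exact: lie_monomW.
  - by move=> d; apply: split_base.
  - exact: IHs.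
have vA : v \notin A by rewrite (disjointFl AB).
rewrite setUC setUD1 //.
rewrite abra_anti; apply/lspanN/split_bra => //.
- by rewrite !inE eqxx.
- by apply: disjointWl (subD1set _ _) _; rewrite disjoint_sym.
- exact: lie_monomW.
- by move=> d; apply: split_base.
- exact: IHt.
Qed.

Inductive msplit_gen C : FA -> Prop :=
| msplit_gen1 x : split_gen C x -> msplit_gen C x
| msplit_mul g : PV C g -> msplit_gen C (amul g xv).

Lemma msplit_amul C Y y x : v \notin C -> v \notin Y -> [disjoint C & Y] ->
  PV Y y -> lspan (msplit_gen C) x -> lspan (msplit_gen (C :|: Y)) (amul x y).
Proof.
move=> vC vY CY yY; apply: (lspan_map (f := fun x => amul x y)) => [||_ [_ []|]].
- exact: (linear_at0 (amul_linearl y)).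
- exact: amul_linearl.
- by move=> ->; rewrite set0U amulC; apply/lspan_gen/msplit_mul.
- move=> p g pC gC; have pY : p \notin Y by rewrite (disjointFr CY).
  rewrite /= -(asub_id (abra blue (avar R p) xv) yY pY) -asub_amul.
  apply/lspan_gen/msplit_gen1/split_blue; first by rewrite inE pC.
  exact: PV_mul.
- move=> Y' f' y' Y'C y'l f'C.
  rewrite /= -(asub_id (abra red xv y') yY vY) -asub_amul.
  apply: lspan_gen; apply: msplit_gen1; apply: (@split_red _ Y') => //; first exact: subset_trans Y'C (subsetUl _ _).
  by have [-> dis] := split_domain vY CY Y'C; apply: PV_mul.
move=> g gC; rewrite -amulA [amul xv y]amulC amulA.
by apply/lspan_gen/msplit_mul/PV_mul.
Qed.

Lemma PV_split V f : PV V f -> v \in V -> lspan (msplit_gen (V :\ v)) f.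
Proof.
move=> fV vV; apply: lspan_trans (PV_nmono fV) => {fV} w wm.
elim: wm vV => {V w} [A x xl vA|A B s t AB sm IHs tm IHt].
  by apply: lspanS (split_lie xl vA); apply: msplit_gen1.
rewrite inE => /orP[vA|vB].
  have vB : v \notin B by rewrite (disjointFr AB).
  rewrite setUD1 //.
  apply: msplit_amul => //.
  - by rewrite !inE eqxx.
  - exact: disjointWl (subD1set _ _) AB.
  - exact/PV_monom/nmonoW.
  - exact: IHs.
have vA : v \notin A by rewrite (disjointFl AB).
rewrite setUC setUD1 //.
rewrite amulC; apply: msplit_amul => //.
- by rewrite !inE eqxx.
- by apply: disjointWl (subD1set _ _) _; rewrite disjoint_sym.
- exact/PV_monom/nmonoW.
- exact: IHt.
Qed.

Inductive rword : {set T} -> FA -> Prop :=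
| rword0 : rword set0 xv
| rwordS U Y w y : [disjoint U & Y] -> v \notin Y -> lie_monom Y y ->
    rword U w -> rword (U :|: Y) (abra red w y).

Lemma rword_notin U w : rword U w -> v \notin U.
Proof. by elim=> {U w} [|U Y w y UY vY yl _ vU]; rewrite !inE // negb_or vU. Qed.

(** By Jacobi red(red(w, y'), y) = red(w, red(y', y)) + red(red(w, y), y'), so the letter containing
    [m] either absorbs the letter after it or moves past it. This removes the ambiguity in the order
    of the letters. *)
Lemma rword_last U w m : rword U w -> m \in U ->
  lspan (fun x => exists Y y w', [/\ m \in Y, Y \subset U, lie_monom Y y,
    rword (U :\: Y) w' & x = abra red w' y]) w.
Proof.
elim=> {U w} [|U Y w y UY vY yl rw IHw]; first by rewrite inE.
rewrite inE; have [mY _|mY /= ] := boolP (m \in Y).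
  apply: lspan_gen; exists Y, y, w; split=> //; first exact: subsetUr.
  by rewrite setDUl setDv setU0 (setDidPl UY).
rewrite orbF => /IHw; apply: (lspan_map (f := abra red ^~ y)).
- exact: (linear_at0 (abra_linearl red y)).
- exact: abra_linearl.
move=> _ [Y' [y' [w' [mY' Y'U y'l rw' ->]]]].
have -> : abra red (abra red w' y') y =
    abra red w' (abra red y' y) + abra red (abra red w' y) y'.
  by rewrite abra_jacobi [abra red y' _]abra_anti subrK.
have YY' : [disjoint Y' & Y] by apply: disjointWl UY.
have UYY' : [disjoint U :\: Y' & Y] by apply: disjointWl UY; apply: subsetDl.
apply: lspanD; apply: lspan_gen.
  exists (Y' :|: Y), (abra red y' y), w'; split=> //.
  - by rewrite inE mY'.
  - by rewrite setSU.
  - exact: lie_bra.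
  - suff -> : (U :|: Y) :\: (Y' :|: Y) = U :\: Y' by [].
    apply/setP => k; move: UY; rewrite -setI_eq0 => /eqP/setP/(_ k); rewrite !inE.
    by case: (k \in U); case: (k \in Y); case: (k \in Y').
exists Y', y', (abra red w' y); split=> //.
- exact: subset_trans Y'U (subsetUl _ _).
- suff -> : (U :|: Y) :\: Y' = (U :\: Y') :|: Y by apply: rwordS.
  rewrite setDUl; congr (_ :|: _); apply/setDidPl.
  by rewrite disjoint_sym.
Qed.

Inductive xgen V : FA -> Prop :=
| xgen_all U w : rword U w -> V = v |: U -> xgen V w
| xgen_mul U C w g : rword U w -> v \notin C -> [disjoint C & U] ->
    PV C g -> V = C :|: (v |: U) -> xgen V (amul g w)
| xgen_sub U C w p g : rword U w -> v \notin C -> [disjoint C & U] -> p \in C ->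
    PV C g -> V = C :|: (v |: U) ->
    xgen V (asub p (abra blue (avar R p) w) g).

Lemma asub_self p x : asub p (avar R p) x = x.
Proof.
elim/free_algW: x => u; rewrite asubE; congr alg_class.
elim: u => //= [i|? -> ? ->|? ? ->|? ? -> ? ->|? -> ? ->] //.
by case: eqP => // ->.
Qed.

(** The word [w] collected so far takes the place of [v]. Splitting at [v] either stops or appends a
    letter [y] to the word, and the variables of [y], of which there is at least one, leave [C]. *)
Lemma xgen_span_rec (b : nat) C U w f : (#|C| < b)%N -> v \notin C ->
  [disjoint C & U] -> rword U w -> PV (v |: C) f ->
  lspan (xgen (C :|: (v |: U))) (asub v w f).
Proof.
elim: b C U w f => // b IHb C U w f Cb vC CU rw fC.
have vU := rword_notin rw.
have := PV_split fC (setU11 _ _).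
have -> : (v |: C) :\ v = C by rewrite setU1K.
apply: (lspan_map (f := asub v w)) => [||_ [_ []|]].
- exact/linear_at0/asub_linear.
- exact: asub_linear.
- move=> ->; rewrite asub_avar eqxx set0U.
  by apply/lspan_gen/(xgen_all rw).
- move=> p g pC gC; have pv : p != v by apply: contraNneq vC => <-.
  rewrite (asub_comp _ _ _ gC) // asub_abra !asub_avar (negPf pv) eqxx.
  exact: lspan_gen (xgen_sub rw vC CU pC gC erefl).
- move=> Y f' y YC yl f'C; have vY : v \notin Y by apply: contra vC; apply: subsetP.
  rewrite asub_asub asub_abra asub_avar eqxx (asub_id _ (PV_monom (lie_monomW yl)) vY).
  have -> : C :|: (v |: U) = (C :\: Y) :|: (v |: (U :|: Y)).
    apply/setP => k; move/subsetP/(_ k): YC; rewrite !inE.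
    by case: (k \in Y) => [->|] //=; rewrite ?orbT ?orbF.
  apply: IHb => //.
  - have [k kY] := set0Pn _ (monom_neq0 (lie_monomW yl)).
    rewrite -ltnS; apply: leq_ltn_trans Cb; apply/proper_card/properP.
    split; first exact: subsetDl.
    by exists k; rewrite ?inE ?kY // (subsetP YC).
  - by rewrite inE negb_and vC orbT.
  - rewrite disjoint_setUr (disjointWl (subsetDl _ _) CU) /=.
    by rewrite disjoint_sym disjointD.
  - by apply: rwordS => //; rewrite disjoint_sym; apply: disjointWl YC _.
- move=> g gC; rewrite asub_amul asub_avar eqxx (asub_id _ gC) //.
  exact: lspan_gen (xgen_mul rw vC CU gC erefl).
Qed.

Lemma xgen_span V f : v \in V -> PV V f -> lspan (xgen V) f.
Proof.
move=> vV fV; have -> : V = (V :\ v) :|: (v |: set0).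
  by rewrite setU0 setUC setD1K.
rewrite -[f](asub_self v); apply: (xgen_span_rec (ltnSn _)).
- by rewrite !inE eqxx.
- by rewrite -setI_eq0 setI0.
- exact: rword0.
- by rewrite setD1K.
Qed.

End Straightening.

(** * Monomials dual to forests *)

Section RootedForests.
Variable n : nat.
Local Notation T := 'I_n.
Implicit Types (u v w m p : T) (A D S U V Y : {set T}) (F G H : {set T * T}).

Lemma restr_restr S S' F : S \subset S' -> restr S (restr S' F) = restr S F.
Proof.
move=> /subsetP SS'; apply/setP => -[a b]; rewrite !in_restr.
by case: (boolP (a \in S)) => [/SS'->|_]; case: (boolP (b \in S)) => [/SS'->|_];
  rewrite ?andbT ?andbF.
Qed.

(** The rooted tree obtained by placing [v] above all roots of the forest [H]. *)
Definition join v U H := H :|: [set a | (a.1 == v) && (a.2 \in U) && is_root H a.2].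

Lemma in_join v U H a b :
  ((a, b) \in join v U H) = ((a, b) \in H) || [&& a == v, b \in U & is_root H b].
Proof. by rewrite !inE /= andbA. Qed.

Lemma join_notin v U H a : forest U H -> v \notin U -> (a, v) \notin join v U H.
Proof.
case/forestP=> HU _ _ vU; rewrite in_join negb_or (negPf vU) andbF andbT.
by apply: contra vU => /HU[].
Qed.

Lemma join_parent v U H u : forest U H -> u \in U ->
  exists2 e, e \in v |: U & (e, u) \in join v U H.
Proof.
case/forestP=> HU _ _ uU; have [Hu|/parentP[e eu]] := boolP (is_root H u).
  by exists v; rewrite ?setU11 // in_join eqxx uU Hu orbT.
by exists e; rewrite ?in_join ?eu // inE (HU _ _ eu).1 orbT.
Qed.

Lemma join_closed v U H : forest U H -> v \notin U ->
  parent_closed (join v U H) v (v |: U).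
Proof.
move=> HU vU w; rewrite inE => /orP[/set1P->|wU _]; first by rewrite eqxx.
exact: join_parent.
Qed.

Lemma join_forest v U H : forest U H -> v \notin U -> forest (v |: U) (join v U H).
Proof.
move=> HU vU; have [HUU Hi Ha] := forestP _ _ HU.
apply/forestP; split=> [a b|a a' b|S S0].
- rewrite in_join => /orP[/HUU[aU bU]|/and3P[/eqP-> bU _]].
    by rewrite !inE aU bU !orbT.
  by rewrite !inE eqxx bU orbT.
- rewrite !in_join => /orP[ab|/and3P[/eqP-> _ br]] /orP[a'b|/and3P[/eqP-> _ br']] //.
  + exact: Hi ab a'b.
  + by have := rootN a br'; rewrite ab.
  + by have := rootN a' br; rewrite a'b.
have [vS|vS] := boolP (v \in S).
  by exists v => // u _; apply: join_notin.
have [w wS wr] := Ha S S0; exists w => // u uS; rewrite in_join negb_or wr //=.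
by apply: contra vS => /andP[/eqP <-].
Qed.

Lemma restr_join v U H : forest U H -> v \notin U -> restr U (join v U H) = H.
Proof.
case/forestP=> HU _ _ vU; apply/setP => -[a b]; rewrite in_restr in_join.
apply/idP/idP => [/and3P[/orP[//|/and3P[/eqP-> _ _]]]|ab].
  by rewrite (negPf vU).
by have [-> ->] := HU _ _ ab; rewrite ab.
Qed.

Lemma join_char v U F : forest (v |: U) F -> v \notin U ->
  (forall u, u \in U -> ~~ is_root F u) -> F = join v U (restr U F).
Proof.
move=> FV vU FU; have [FVV Fi Fa] := forestP _ _ FV.
have vr : is_root F v.
  have [|w wV wr] := Fa (v |: U); first by apply/set0Pn; exists v; apply: setU11.
  suff <- : w = v.
    by apply/is_rootP => a; apply/negP => aw; have [/wr] := FVV _ _ aw; rewrite aw.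
  move: wV; rewrite inE => /orP[/set1P//|/FU/parentP[a aw]].
  by have [/wr] := FVV _ _ aw; rewrite aw.
apply/setP => -[a b]; rewrite in_join in_restr.
apply/idP/idP => [ab|/orP[/and3P[]//|/and3P[/eqP-> bU br]]].
  have [] := FVV _ _ ab; rewrite !inE => /orP[/eqP av|aU] /orP[/eqP bv|bU].
  - by move: (rootN a vr); rewrite -bv ab.
  - apply/orP; right; rewrite av eqxx bU; apply/is_rootP => e.
    rewrite in_restr; apply: contra vU => /and3P[eb eU _].
    by rewrite -av (Fi _ _ _ ab eb).
  - by move: (rootN a vr); rewrite -bv ab.
  - by rewrite ab aU bU.
have /parentP[e eb] := FU b bU; have [] := FVV _ _ eb; rewrite inE.
case/orP=> [/set1P <-//|eU _].
by have := rootN e br; rewrite in_restr eb eU bU.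
Qed.

Definition comp F u := [set w | linked F u w].

Lemma comp_refl F u : u \in comp F u. Proof. by rewrite inE; apply: connect0. Qed.

Lemma comp_ind F u S : u \in S ->
  (forall a b, a \in S -> (a, b) \in F \/ (b, a) \in F -> b \in S) -> comp F u \subset S.
Proof.
move=> uS Scl; apply/subsetP => w; rewrite inE => /connectP[s].
elim: s u uS => [|x s IHs] u uS /=; first by move=> _ ->.
case/andP=> ux xs wE; apply: (IHs x _ xs wE); apply: Scl uS _.
exact/orP.
Qed.

Lemma comp_step F u a b : a \in comp F u -> (a, b) \in F \/ (b, a) \in F ->
  b \in comp F u.
Proof.
rewrite !inE /linked => ua /orP ab.
by apply: connect_trans ua _; apply: connect1.
Qed.

Lemma comp_subV V F u : forest V F -> u \in V -> comp F u \subset V.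
Proof.
by case/forestP=> FV _ _ uV; apply: comp_ind => // a b _ [] /FV[].
Qed.

Lemma comp_sub F F' u : F \subset F' -> comp F u \subset comp F' u.
Proof.
by move=> FF'; apply/subsetP => w; rewrite !inE; apply: linked_sub.
Qed.

Lemma comp_restr F u : comp F u \subset comp (restr (comp F u) F) u.
Proof.
suff h : comp F u \subset comp F u :&: comp (restr (comp F u) F) u.
  exact: subset_trans h (subsetIr _ _).
apply: comp_ind; first by rewrite inE !comp_refl.
move=> a b; rewrite inE => /andP[aF aR] ab; have bF := comp_step aF ab.
rewrite inE bF; apply: comp_step aR _.
by case: ab => ab; [left|right]; rewrite in_restr ab aF bF.
Qed.

Lemma comp_linked F u a b : a \in comp F u -> b \in comp F u -> linked F a b.
Proof. by rewrite !inE linked_sym /linked; apply: connect_trans. Qed.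

Lemma comp_split U F u : forest U F ->
  F = restr (U :\: comp F u) F :|: restr (comp F u) F.
Proof.
case/forestP=> FU _ _; apply/setP => -[a b]; rewrite inE !in_restr !in_setD.
have [ab|//] := boolP (_ \in F); have [-> ->] := FU _ _ ab; rewrite !andbT /=.
have [aC|aC] := boolP (a \in comp F u).
  by rewrite (comp_step aC (or_introl ab)).
have [bC|//] := boolP (b \in comp F u).
by rewrite (comp_step bC (or_intror ab)) in aC.
Qed.

(** The descendants of a root are stable under arcs in both directions, hence fill its connected
    component. *)
Lemma unique_root Y F d d' : forest Y F ->
  (forall u w, u \in Y -> w \in Y -> linked F u w) ->
  d \in Y -> d' \in Y -> is_root F d -> is_root F d' -> d = d'.
Proof.
move=> FY Yl dY d'Y dr d'r; have [_ Fi _] := forestP _ _ FY.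
have : d' \in reach F d.
  have : comp F d \subset reach F d.
    apply: comp_ind; first exact: reach_refl.
    move=> a b aD [ab|ba]; first exact: reach_step aD ab.
    have ad : a != d by apply: contraTneq ba => ->; apply: rootN.
    by have [p pD pa] := reach_parent_closed aD ad; rewrite (Fi _ _ _ ba pa).
  by move/subsetP; apply; rewrite inE; apply: Yl.
move=> d'D; apply/eqP; rewrite eq_sym; apply: contraTT d'r => d'd.
have [p _ pd] := reach_parent_closed d'D d'd.
by rewrite negb_forall; apply/existsP; exists p; rewrite negbK.
Qed.

Lemma ex_root Y F : forest Y F -> Y != set0 -> exists2 d, d \in Y & is_root F d.
Proof.
case/forestP=> FY _ Fa /Fa[d dY dr]; exists d => //; apply/is_rootP => a.
by apply/negP => ad; have [/dr] := FY _ _ ad; rewrite ad.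
Qed.

End RootedForests.

(** * Words dual to the trees with a given root *)

Section RedWords.
Variables (R : comPzRingType) (n : nat).
Local Notation T := 'I_n.
Local Notation FA := (free_alg R n).
Implicit Types (u v w m p : T) (x y : FA) (D S U V Y : {set T}).
Implicit Types (A F G H : {set T * T}).

Definition dual_family V (pi : {set T * T} -> FA) : Prop :=
  [/\ forall F, forest V F -> PV V (pi F),
      forall F F', forest V F -> forest V F' -> fev F' (pi F) V = (F' == F)%:R
    & forall x, PV V x -> lspan (fun y => exists2 F, forest V F & y = pi F) x].

Lemma fev_linear F V a : {morph (fun x : FA => fev F x V) : x y / a *: x + y >-> a * x + y}.
Proof. exact: aev_linear (fwt R F) V a. Qed.

Lemma fev0 F V : fev F (0 : FA) V = 0.
Proof. exact: aev0 (fwt R F) V. Qed.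

Lemma dual_expand V pi x : dual_family V pi -> PV V x ->
  x = \sum_(F | forest V F) fev F x V *: pi F.
Proof.
case=> _ piE pi_span /pi_span; apply: (dual_sum (f := fun F x => fev F x V)) => [F|F a u w|].
- exact: fev0.
- exact: fev_linear.
- by move=> F F' FV F'V; apply: piE.
Qed.

(** In the expansion along the dual family, coefficients at disconnected forests vanish by
    [lie_linked]. *)
Lemma dual_lie Y pi y : dual_family Y pi -> lie_monom Y y ->
  lspan (fun x => exists F, [/\ forest Y F,
    forall a b, a \in Y -> b \in Y -> linked F a b & x = pi F]) y.
Proof.
move=> pi_dual yl; rewrite (dual_expand pi_dual (PV_monom (lie_monomW yl))).
apply: lspan_sum => F FY; have [->|yF] := eqVneq (fev F y Y) 0.
  by rewrite scale0r; apply: lspan0.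
apply/lspanZ/lspan_gen; exists F; split=> //.
by have := lie_linked yl yF; rewrite restr_id.
Qed.

(** Trees on [v |: U] with root [v] correspond to forests on [U] through [join]; all other forests
    on [v |: U] must evaluate to zero. *)
Definition red_dual v U (eps : {set T * T} -> FA) : Prop :=
  [/\ forall H, forest U H -> PV (v |: U) (eps H),
      forall H A, forest U H -> forest (v |: U) A ->
        fev A (eps H) (v |: U) = (A == join v U H)%:R
    & forall x, rword v U x -> lspan (fun y => exists2 H, forest U H & y = eps H) x].

Lemma red_dual0 v : red_dual v set0 (fun=> avar R v).
Proof.
split=> [H _|H A H0 A0|x xw].
- by rewrite setU0; apply/PV_monom/monom_var.
- rewrite setU0 /fev (aev_avar (fwt R A)) eqxx.
  have v0 : v \notin (set0 : {set T}) by rewrite inE.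
  have AE : forall F, forest (v |: set0) F -> F = set0.
    move=> F FV; apply/setP => -[a b]; rewrite inE; apply/negP => ab.
    have [FVV _ _] := forestP _ _ FV; have [] := FVV _ _ ab.
    rewrite setU0 !inE => /eqP av /eqP bv.
    by have := forest_irrefl v FV; rewrite -{1}av -{1}bv ab.
  by rewrite (AE _ A0) (AE _ (join_forest H0 v0)) eqxx.
apply: lspan_gen; exists set0; first exact: forest0.
case: {-1}_ x / xw (erefl (set0 : {set T})) => // U Y w y UY _ /lie_monomW/monom_neq0 Y0 _.
by move/esym/eqP; rewrite setU_eq0 (negPf Y0) andbF.
Qed.

Section Step.
Variables (v m : T) (U : {set T}).
Variables (pi eps : {set T} -> {set T * T} -> FA).
Hypotheses (mU : m \in U) (U_lt : forall u, u \in U -> (u < v)%N).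
Hypothesis pi_dual : forall Y, Y \subset U -> Y != set0 -> dual_family Y (pi Y).
Hypothesis eps_dual : forall U', U' \proper U -> red_dual v U' (eps U').

Let vU : v \notin U.
Proof. by apply/negP => /U_lt; rewrite ltnn. Qed.

Definition rest H := U :\: comp H m.
(** The fixed vertex [m] marks the last letter of the word: its component in [H] supplies that
    letter, and the other components supply the shorter word before it. *)
Definition red_candidate H : FA :=
  abra red (eps (rest H) (restr (rest H) H)) (pi (comp H m) (restr (comp H m) H)).

Section Candidate.
Variable H : {set T * T}.
Hypothesis HU : forest U H.

Let Y := comp H m.
Let S := v |: rest H.

Let YU : Y \subset U. Proof. exact: comp_subV. Qed.
Let mY : m \in Y. Proof. exact: comp_refl. Qed.
Let vY : v \notin Y. Proof. by apply: contra vU; apply: subsetP. Qed.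

Let SY : [disjoint S & Y].
Proof.
by rewrite disjoint_setUl disjoints1 vY disjoint_sym disjointD.
Qed.

Let SYE : v |: U = S :|: Y.
Proof.
by rewrite -setUA /rest -{1}(setID U Y) (setIidPr YU) [Y :|: _]setUC.
Qed.

Let H1 := restr (rest H) H.
Let F := restr Y H.
Let H1r : forest (rest H) H1. Proof. exact: forest_restr HU. Qed.
Let FY : forest Y F. Proof. exact: forest_restr HU. Qed.
Let vr : v \notin rest H. Proof. by rewrite inE negb_and vU orbT. Qed.

Let rest_proper : rest H \proper U.
Proof.
apply/properP; split; first exact: subsetDl.
by exists m => //; rewrite inE negb_and mY.
Qed.

Let Y0 : Y != set0. Proof. by apply/set0Pn; exists m. Qed.

Let F_linked a b : a \in Y -> b \in Y -> linked F a b.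
Proof.
by move=> aY bY; apply: (@comp_linked _ _ m); apply: (subsetP (comp_restr H m)).
Qed.

Lemma red_candidate_PV : PV (v |: U) (red_candidate H).
Proof.
rewrite SYE; apply: PV_bra => //.
  by case: (eps_dual rest_proper) => h _ _; apply: h.
by case: (pi_dual YU Y0) => h _ _; apply: h.
Qed.

Lemma red_candidate_fev A : forest (v |: U) A -> fev A (red_candidate H) (v |: U) =
  fs R A red S Y * (restr S A == join v (rest H) H1)%:R * (restr Y A == F)%:R.
Proof.
move=> AV; have [epsP epsE _] := eps_dual rest_proper.
have [piP piE _] := pi_dual YU Y0.
rewrite SYE /fev (aev_abra_at (fwt R A)) //; [|exact: epsP|exact: piP].
rewrite -!/(fev A _ _) fev_restr epsE //; last exact: forest_restr AV.
by rewrite (fev_restr A (pi _ _)) piE //; apply: forest_restr AV.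
Qed.

Lemma red_candidate_diag : fev (join v U H) (red_candidate H) (v |: U) = 1.
Proof.
have [HUU Hi _] := forestP _ _ HU.
have root_restr S' b : (forall a, (a, b) \in H -> a \in S') -> b \in S' ->
    is_root (restr S' H) b = is_root H b.
  move=> bS' b_S'; apply/is_rootP/is_rootP => br a; have := br a; rewrite in_restr b_S' andbT.
    by apply: contra => ab; rewrite ab bS'.
  by apply: contra => /andP[].
have parentY a b : (a, b) \in H -> b \in Y -> a \in Y.
  by move=> ab bY; apply: comp_step bY (or_intror ab).
have childY a b : (a, b) \in H -> a \in Y -> b \in Y.
  by move=> ab bY; apply: comp_step bY (or_introl ab).
rewrite red_candidate_fev ?join_forest //.
have inS k : k \in U -> (k \in S) = (k \in rest H).
  by move=> kU; rewrite in_setU1; case: eqP kU => // ->; rewrite (negPf vU).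
have restU k : k \in rest H -> k \in U by rewrite in_setD => /andP[].
have rest_parent a b : (a, b) \in H -> b \in rest H -> a \in rest H.
  move=> ab; rewrite !in_setD (HUU _ _ ab).1 andbT => /andP[bY _].
  by apply: contra bY; apply: childY ab.
have -> : restr S (join v U H) = join v (rest H) H1.
  apply/setP => -[a b]; rewrite in_restr !in_join in_restr; apply/idP/idP.
    case/and3P=> /orP[ab|/and3P[/eqP-> bU br]] aS bS.
      by have [aU bU] := HUU _ _ ab; rewrite ab -!inS ?aS ?bS.
    rewrite (inS b) // in bS; rewrite eqxx bS root_restr ?br ?orbT // => e.
    by move/rest_parent; apply.
  case/orP=> [/and3P[ab aR bR]|/and3P[/eqP-> bR br]].
    by rewrite ab !inS ?restU ?aR.
  rewrite (inS b) ?restU // bR setU11 eqxx -(root_restr (rest H)) ?br ?orbT // => e.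
  by move/rest_parent; apply.
have -> : restr Y (join v U H) = F.
  apply/setP => -[a b]; rewrite !in_restr in_join.
  have [->|//] := eqVneq a v; last by rewrite orbF.
  by rewrite (negPf vY) !andbF.
rewrite !eqxx !mulr1; have [d dY dr] := ex_root FY Y0.
have dU := subsetP YU _ dY.
have Hd : is_root H d by rewrite -(root_restr Y) // => a ad; apply: parentY ad dY.
(* The component [Y] is entered only by the arc from [v] to its root [d], which is red because [v]
   is larger. *)
apply: (@fs_eq1 _ _ _ _ _ _ (v, d)) => //; last 2 first.
- exact: red_arc (U_lt dU).
- exact: setU11.
apply/setP => -[a b]; rewrite in_set1 in_fcross in_join /crosses /between /=.
apply/idP/idP => [/andP[/orP[ab|/and3P[/eqP-> bU br]]]|/eqP[-> ->]]; last first.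
- by rewrite eqxx dU Hd setU11 dY orbT.
- rewrite (negPf vY) orbF => /andP[_ bY].
  have bF : is_root F b by apply: root_sub (restr_sub _ _) br.
  by rewrite (unique_root FY F_linked bY dY bF dr) eqxx.
case/orP=> /andP[aS bS].
  by have := disjointFr SY aS; rewrite (parentY _ _ ab bS).
by have := disjointFr SY bS; rewrite (childY _ _ ab aS).
Qed.

(** A nonzero value leaves a single red arc between [S] and [Y]. If it starts at [v], the forest is
    [join v U H]; if it starts elsewhere in [S], the component of [m] becomes strictly larger. *)
Lemma red_candidate_tri A : forest (v |: U) A ->
  fev A (red_candidate H) (v |: U) != 0 ->
  exists2 H', forest U H' & A = join v U H' /\ (H' = H \/ (#|Y| < #|comp H' m|)%N).
Proof.
move=> AV; rewrite red_candidate_fev // => /mul_neq0[/mul_neq0[fs0]].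
have nat_neq0 (b : bool) : b%:R != 0 :> R -> b by case: b; rewrite // eqxx.
move=> /nat_neq0/eqP AS /nat_neq0/eqP AY.
have [[b d] abE acol] := fs_neq0 fs0.
have [AVV Ai _] := forestP _ _ AV; have AU : forest U (restr U A) by apply: forest_restr AV.
have SA e k : (e, k) \in restr S A -> (e, k) \in A by rewrite in_restr => /and3P[].
have rest_parent k : k \in rest H -> exists2 e, e \in S & (e, k) \in A.
  move=> kR; have [e eS ek] := join_parent v H1r kR; exists e => //.
  by apply: SA; rewrite AS.
have bdA : (b, d) \in A /\ crosses S Y (arc_color (b, d), (b, d)).
  by apply/andP; rewrite -in_fcross abE inE.
(* The opposite direction is excluded: an arc from [Y] into [v] would be blue, and any other vertex
   of [S] already has its parent in [S]. *)
have [bS dY] : b \in S /\ d \in Y.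
  case: bdA => bdA /orP[]/andP[] //= bY dS; have bU := subsetP YU _ bY; exfalso.
  move: dS; rewrite in_setU1 => /orP[/eqP dv|/rest_parent[e eS ed]].
    by move: acol; rewrite dv /arc_color /= U_lt.
  by move: bY; rewrite (Ai _ _ _ bdA ed) (disjointFr SY eS).
case: bdA => bdA _.
have dF : is_root F d.
  apply/is_rootP => e; rewrite -AY in_restr; apply/negP => /and3P[ed eY _].
  by have := disjointFr SY bS; rewrite (Ai _ _ _ bdA ed) eY.
have Aroot k : k \in U -> ~~ is_root A k.
  move=> kU; have : exists e, (e, k) \in A.
    have [kY|kY] := boolP (k \in Y); last first.
      have [|e _ ek] := rest_parent k; first by rewrite in_setD kY.
      by exists e.
    have [kF|/parentP[e]] := boolP (is_root F k).
      by exists b; rewrite (unique_root FY F_linked kY dY kF dF).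
    by rewrite -AY in_restr => /and3P[ek _ _]; exists e.
  by case=> e ek; rewrite negb_forall; apply/existsP; exists e; rewrite negbK.
exists (restr U A) => //; split; first exact: join_char.
have AR : restr (rest H) A = H1.
  rewrite -(restr_restr (S' := S)) ?subsetUr // AS; exact: restr_join.
move: bS; rewrite in_setU1 => /orP[/eqP bv|bR].
  left; rewrite (comp_split m HU) -/(rest H) -/Y -/F -/H1 -AR -AY.
  apply/setP => -[e k]; rewrite in_setU !in_restr; have [ek|//] := boolP (_ \in A) => /=.
  rewrite !in_setD; have [eY|eY] := boolP (e \in Y); have [kY|kY] := boolP (k \in Y);
    rewrite /= ?andbF ?orbF ?(subsetP YU _ eY) ?(subsetP YU _ kY) //=.
  - apply/negP => kU; have : (e, k) \in fcross A S Y.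
      by rewrite in_fcross ek /crosses /between /= eY !in_setU1 !in_setD kY kU !orbT.
    by rewrite abE in_set1 => /eqP[ev _]; rewrite ev bv (negPf vY) in eY.
  - rewrite andbT; apply/negP => eU; have : (e, k) \in fcross A S Y.
      by rewrite in_fcross ek /crosses /between /= kY !in_setU1 !in_setD eY eU !orbT.
    by rewrite abE in_set1 => /eqP[ev _]; rewrite ev bv (negPf vU) in eU.
right; apply/proper_card/properP; split.
  apply: subset_trans (comp_restr H m) _; rewrite -/Y -/F -AY.
  apply: comp_sub; apply/subsetP => -[e k]; rewrite !in_restr => /and3P[-> eY kY].
  by rewrite (subsetP YU _ eY) (subsetP YU _ kY).
exists b; last by move: bR; rewrite in_setD => /andP[].
have bU : b \in U by move: bR; rewrite in_setD => /andP[].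
apply: (@comp_step _ _ _ d); last by right; rewrite in_restr bdA bU (subsetP YU).
apply: (subsetP (comp_sub m _)) (subsetP (comp_restr H m) _ dY).
rewrite -/Y -/F -AY; apply/subsetP => -[e k]; rewrite !in_restr => /and3P[-> eY kY].
by rewrite (subsetP YU _ eY) (subsetP YU _ kY).
Qed.

End Candidate.
Lemma red_candidate_build Y H1 F : m \in Y -> Y \subset U -> forest Y F ->
  (forall a b, a \in Y -> b \in Y -> linked F a b) -> forest (U :\: Y) H1 ->
  forest U (H1 :|: F) /\
  red_candidate (H1 :|: F) = abra red (eps (U :\: Y) H1) (pi Y F).
Proof.
move=> mY YU FY Fl H1Y; have dis : [disjoint U :\: Y & Y].
  by rewrite disjoint_sym disjointD.
have UE : U = (U :\: Y) :|: Y by rewrite -{1}(setID U Y) (setIidPr YU) setUC.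
have HU : forest U (H1 :|: F) by rewrite UE; apply: forestU.
have [FYY _ _] := forestP _ _ FY; have [H1YY _ _] := forestP _ _ H1Y.
have compE : comp (H1 :|: F) m = Y.
  apply/eqP; rewrite eqEsubset; apply/andP; split.
    apply: comp_ind => // a b aY; rewrite !in_setU.
    by case=> /orP[/H1YY[]|/FYY[] //]; rewrite !in_setD aY.
  apply/subsetP => a aY; apply: (subsetP (comp_sub m (subsetUr H1 F))).
  by rewrite inE; apply: Fl.
split=> //; rewrite /red_candidate /rest compE; congr (abra red (eps _ _) (pi _ _)).
  apply/setP => -[a b]; rewrite in_restr in_setU; apply/idP/idP.
    case/and3P=> /orP[//|/FYY[aY _]]; by rewrite in_setD aY.
  by move=> ab; have [-> ->] := H1YY _ _ ab; rewrite ab.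
apply/setP => -[a b]; rewrite in_restr in_setU; apply/idP/idP.
  case/and3P=> /orP[/H1YY[aY _]|//]; move: aY; rewrite in_setD => /andP[/negPf->] //.
by move=> ab; have [-> ->] := FYY _ _ ab; rewrite ab orbT.
Qed.

Lemma red_dual_step : exists e, red_dual v U e.
Proof.
have [||||p [p_span p_dual p_x]] := @triangular_dual R FA {set T * T} (forest U)
  (fun H => #|comp H m|) red_candidate (fun H x => fev (join v U H) x (v |: U)).
- by move=> H; apply: fev0.
- by move=> H; apply: fev_linear.
- exact: red_candidate_diag.
- move=> H H' HU H'U HH' rk; apply/eqP; apply: contraTT HH' => HH'.
  have [H'' H''U [JE]] := red_candidate_tri HU (join_forest H'U vU) HH'.
  have <- : H' = H'' by rewrite -(restr_join H'U vU) JE restr_join.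
  by case=> [->|]; rewrite ?eqxx // ltnNge rk.
exists p; split=> [H HU|H A HU AV|x xw].
- by apply: lspan_trans (p_span H HU) => _ [H' H'U ->]; apply: red_candidate_PV.
- have [AE|AN] := eqVneq A (join v U (restr U A)).
    have AU : forest U (restr U A) by apply: forest_restr AV.
    rewrite {1}AE p_dual //; congr (_%:R); congr nat_of_bool.
    apply/eqP/eqP => [AH|->]; first by rewrite AE AH.
    exact: restr_join.
  (* A forest that is not a tree rooted at [v] vanishes on every candidate, hence on the span
     containing the dual elements. *)
  have -> : (A == join v U H) = false.
    by apply: contraNF AN => /eqP->; rewrite restr_join.
  apply: (lspan_eq (f := fun x => fev A x (v |: U) : R^o) (g := fun=> 0)
    _ _ _ _ _ (p_span H HU)) => //.
  + exact: fev0.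
  + exact: fev_linear.
  + by move=> a u w; rewrite scaler0 addr0.
  move=> _ [H' H'U ->]; apply/eqP; apply: contraNT AN => AN.
  have [H'' H''U [-> _]] := red_candidate_tri H'U AV AN.
  by rewrite restr_join.
(* With the letter of [m] last and only connected forests in its expansion, each resulting bracket
   is literally a candidate. *)
apply: lspan_trans (rword_last xw mU) => _ [Y [y [w [mY YU yl ww ->]]]].
have Y0 : Y != set0 by apply/set0Pn; exists m.
have UY_proper : U :\: Y \proper U.
  by apply/properP; split; [exact: subsetDl|exists m; rewrite // in_setD mY].
have [_ _ eps_span] := eps_dual UY_proper.
apply: lspan2 (eps_span _ ww) (dual_lie (pi_dual YU Y0) yl).
- exact: abra_linearl.
- exact: abra_linearr.
move=> _ _ [H1 H1Y ->] [F [FY Fl ->]].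
have [HU <-] := red_candidate_build mY YU FY Fl H1Y; exact: p_x.
Qed.

End Step.

Lemma red_dual_exists v U pi : (forall u, u \in U -> (u < v)%N) ->
  (forall Y, Y \subset U -> Y != set0 -> dual_family Y (pi Y)) ->
  exists eps, red_dual v U eps.
Proof.
move: {2}(#|U|.+1) (ltnSn #|U|) => N; elim: N U => // N IHN U UN U_lt pi_dual.
have [->|/set0Pn[m mU]] := eqVneq U set0; first by exists (fun=> avar R v); apply: red_dual0.
have /choice[eps epsP] : forall U', exists e, U' \proper U -> red_dual v U' e.
  move=> U'; have [U'U|] := boolP (U' \proper U); last by exists (fun=> 0).
  have [|u /(subsetP (proper_sub U'U))/U_lt //|Y /subset_trans YU' Y0|e eP] := IHN U'.
  - by apply: leq_trans (proper_card U'U) _.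
  - by apply: pi_dual => //; apply/YU'/proper_sub.
  by exists e.
exact: (red_dual_step mU U_lt pi_dual epsP).
Qed.

End RedWords.

(** * Elements dual to all forests on a vertex set *)

Section DualBasis.
Variables (R : comPzRingType) (n : nat).
Local Notation T := 'I_n.
Local Notation FA := (free_alg R n).
Implicit Types (u v w m p : T) (x y : FA) (C D S U Y : {set T}).
Implicit Types (A F G H : {set T * T}).

Section Step.
Variables (V : {set T}) (v : T).
Hypotheses (vV : v \in V) (v_max : forall u, u \in V -> (u <= v)%N).
Variables (pi eps : {set T} -> {set T * T} -> FA).
Hypothesis pi_dual : forall Y, (#|Y| < #|V|)%N -> Y != set0 -> dual_family Y (pi Y).
Hypothesis eps_dual : forall U, U \subset V :\ v -> red_dual v U (eps U).

Definition below_v F := reach F v :\ v.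
Definition beside F := V :\: reach F v.

(** The cases follow the place of [v]: everything lies below it, it has a parent [p], or its tree
    stands apart from the rest. The first is separate because nothing multilinear exists on the
    empty set to serve as the factor [g]. *)
Definition dual_candidate F : FA :=
  let e := eps (below_v F) (restr (below_v F) F) in
  let g := pi (beside F) (restr (beside F) F) in
  if beside F == set0 then e
  else if [pick p | (p, v) \in F] is Some p
       then asub p (abra blue (avar R p) e) g
       else amul g e.

Section Shape.
Variables (C U : {set T}) (G H : {set T * T}).
Hypotheses (vC : v \notin C) (vU : v \notin U) (CU : [disjoint C & U]).
Hypothesis VE : V = C :|: (v |: U).
Hypotheses (GC : forest C G) (HU : forest U H).

Let D := v |: U.

Let CD : [disjoint C & D].
Proof. by rewrite disjoint_setUr CU disjoint_sym disjoints1 vC. Qed.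

Let UV : U \subset V :\ v.
Proof. by rewrite subsetD1 vU VE (subset_trans (subsetUr [set v] U) (subsetUr _ _)). Qed.

Let CV : (#|C| < #|V|)%N.
Proof.
by apply/proper_card/properP; split; [rewrite VE subsetUl|exists v].
Qed.

Let J := join v U H.
Let JD : forest D J. Proof. exact: join_forest. Qed.

Lemma fev_unlinked A : C != set0 -> forest V A ->
  fev A (amul (pi C G) (eps U H)) V =
  fz R A C D * (restr C A == G)%:R * (restr D A == J)%:R.
Proof.
move=> C0 AV; have [piP piE _] := pi_dual CV C0; have [epsP epsE _] := eps_dual UV.
rewrite VE /fev (aev_amul_at (fwt R A)) //; [|exact: piP|exact: epsP].
rewrite -!/(fev A _ _) fev_restr piE //; last exact: forest_restr AV.
by rewrite (fev_restr A (eps _ _)) epsE //; apply: forest_restr AV.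
Qed.

Lemma fev_all A : C = set0 -> forest V A -> fev A (eps U H) V = (A == J)%:R.
Proof.
move=> C0 AV; have [_ epsE _] := eps_dual UV; rewrite VE C0 set0U epsE //.
by move: AV; rewrite VE C0 set0U.
Qed.

Lemma fev_sub p A : p \in C -> forest V A ->
  fev A (asub p (abra blue (avar R p) (eps U H)) (pi C G)) V =
  aev (zexp D p (fz R A)) (sexp D p (fs R A)) (pi C G) C *
  (fs R A blue [set p] D * (restr D A == J)%:R).
Proof.
move=> pC AV; have C0 : C != set0 by apply/set0Pn; exists p.
have [piP piE _] := pi_dual CV C0; have [epsP epsE _] := eps_dual UV.
have pD : [disjoint [set p] & D] by rewrite disjoints1 (disjointFr CD pC).
have pP : PV [set p] (avar R p) by apply/PV_monom/monom_var.
rewrite [in LHS]VE /fev (aev_asub (fwt R A)) //; [|exact: piP|].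
  congr (_ * _); rewrite (aev_abra_at (fwt R A)) //; last exact: epsP.
  rewrite (aev_avar (fwt R A)) eqxx mulr1; congr (_ * _).
  rewrite -/(fev A _ _) fev_restr epsE //; exact: forest_restr AV.
by apply: PV_bra => //; apply: epsP.
Qed.

Lemma forest_split A : forest V A -> fcross A C D = set0 ->
  A = restr C A :|: restr D A.
Proof.
case/forestP=> AVV _ _ A0; apply/setP => -[a b]; rewrite in_setU !in_restr.
have VD w : w \in V -> (w \in C) || (w \in D) by rewrite VE in_setU.
have [ab|//] := boolP (_ \in A) => /=; have [/VD + /VD] := AVV _ _ ab.
have : (a, b) \notin fcross A C D by rewrite A0 in_set0.
rewrite in_fcross ab /crosses /between /=.
by case: (a \in C); case: (b \in C); case: (a \in D); case: (b \in D).
Qed.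

Lemma unlinked_forest : forest V (G :|: J).
Proof. by rewrite VE; apply: forestU. Qed.

Lemma unlinked_reach : reach (G :|: J) v = D.
Proof.
have [GCC _ _] := forestP _ _ GC; have [JDD _ _] := forestP _ _ JD.
apply/eqP; rewrite eqEsubset; apply/andP; split.
  apply: reach_ind => [|a b aD]; first exact: setU11.
  rewrite in_setU => /orP[/GCC[aC _]|/JDD[]//].
  by rewrite (disjointFr CD aC) in aD.
apply: parent_closed_reach unlinked_forest _ => w wD wv.
have [e eD ew] := join_closed HU vU wD wv.
by exists e; rewrite // in_setU ew orbT.
Qed.

Lemma restr_unlinked : restr C (G :|: J) = G /\ restr U (G :|: J) = H.
Proof.
have [GCC _ _] := forestP _ _ GC; have [JDD _ _] := forestP _ _ JD.
split; apply/setP => -[a b]; rewrite in_restr in_setU.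
  apply/idP/idP => [/and3P[/orP[//|/JDD[aD _]] aC _]|ab].
    by rewrite (disjointFr CD aC) in aD.
  by have [-> ->] := GCC _ _ ab; rewrite ab.
rewrite -[H in RHS](restr_join HU vU) in_restr -/J.
have [/GCC[aC _]|//] := boolP ((a, b) \in G).
by rewrite (disjointFr CU aC) /= !andbF.
Qed.

Lemma unlinked_root : is_root (G :|: J) v.
Proof.
apply/is_rootP => a; rewrite in_setU negb_or join_notin // andbT.
by apply: contra vC; case/forestP: GC => h _ _ /h[].
Qed.

Lemma restrD_unlinked : restr D (G :|: J) = J.
Proof.
have [GCC _ _] := forestP _ _ GC; have [JDD _ _] := forestP _ _ JD.
apply/setP => -[a b]; rewrite in_restr in_setU; apply/idP/idP.
  by case/and3P=> /orP[/GCC[aC _]|//] aD _; rewrite (disjointFr CD aC) in aD.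
by move=> ab; have [-> ->] := JDD _ _ ab; rewrite ab orbT.
Qed.

Lemma fev_unlinked_diag : C != set0 ->
  fev (G :|: J) (amul (pi C G) (eps U H)) V = 1.
Proof.
move=> C0; rewrite fev_unlinked //; last exact: unlinked_forest.
have [-> _] := restr_unlinked; rewrite restrD_unlinked !eqxx !mulr1 fzE.
have [GCC _ _] := forestP _ _ GC; have [JDD _ _] := forestP _ _ JD.
suff -> : fcross (G :|: J) C D = set0 by rewrite eqxx.
apply/setP => -[a b]; rewrite in_set0 in_fcross in_setU /crosses /between /=.
apply/negP => /andP[/orP[/GCC|/JDD][aS bS]] /orP[]/andP[h1 h2].
- by have := disjointFr CD bS; rewrite h2.
- by have := disjointFr CD aS; rewrite h1.
- by have := disjointFr CD h1; rewrite aS.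
- by have := disjointFr CD h2; rewrite bS.
Qed.

Lemma candidate_unlinked : C != set0 ->
  dual_candidate (G :|: J) = amul (pi C G) (eps U H).
Proof.
move=> /negPf C0; have [GE HE] := restr_unlinked.
have besideE : beside (G :|: J) = C.
  by rewrite /beside unlinked_reach VE setDUl setDv setU0; apply/setDidPl.
have belowE : below_v (G :|: J) = U by rewrite /below_v unlinked_reach setU1K.
rewrite /dual_candidate besideE belowE GE HE C0.
by case: pickP => // p; rewrite (negPf (rootN p unlinked_root)).
Qed.

Lemma candidate_all : C = set0 -> dual_candidate (G :|: J) = eps U H.
Proof.
move=> C0; have [_ HE] := restr_unlinked.
have besideE : beside (G :|: J) = set0.
  by rewrite /beside unlinked_reach VE C0 set0U setDv.
have belowE : below_v (G :|: J) = U by rewrite /below_v unlinked_reach setU1K.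
by rewrite /dual_candidate besideE belowE HE eqxx.
Qed.

Section Linked.
Variable p : T.
Hypothesis pC : p \in C.

Definition linked_forest := (p, v) |: (G :|: J).

Lemma linked_forestP : forest V linked_forest.
Proof.
apply: forest_add unlinked_forest _ _ unlinked_root _.
- by rewrite VE in_setU pC.
- by rewrite VE !inE eqxx orbT.
- by rewrite unlinked_reach (disjointFr CD pC).
Qed.

Lemma linked_reach : reach linked_forest v = D.
Proof.
apply/eqP; rewrite eqEsubset; apply/andP; split; last first.
  by rewrite -unlinked_reach; apply/reach_sub/subsetUr.
apply: reach_ind => [|a b aD]; first exact: setU11.
rewrite in_setU1 => /orP[/eqP[_ ->]|ab]; first exact: setU11.
by rewrite -unlinked_reach in aD *; apply: reach_step aD ab.
Qed.

Lemma restr_linked : restr C linked_forest = G /\ restr U linked_forest = H.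
Proof.
have [GE HE] := restr_unlinked; split; [rewrite -[RHS]GE|rewrite -[RHS]HE];
  apply/setP => -[a b]; rewrite !in_restr in_setU1 xpair_eqE; have [->|_] := eqVneq b v;
  rewrite ?(negPf vC) ?(negPf vU) ?andbF //=.
Qed.

Lemma linked_parent q : ((q, v) \in linked_forest) = (q == p).
Proof.
by rewrite in_setU1 (negPf (rootN q unlinked_root)) orbF xpair_eqE eqxx andbT.
Qed.

(* When [v |: U] is everything below [v] and [p] is the parent of [v],
   contracting [p |: D] to [p] does not create or destroy crossings in [C]. *)
Section Contraction.
Variable A : {set T * T}.
Hypotheses (AV : forest V A) (DE : D = reach A v) (pvA : (p, v) \in A).

Lemma below_closed a b : a \in D -> (a, b) \in A -> b \in D.
Proof. by rewrite DE; apply: reach_step. Qed.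

Lemma entry_root a b : a \notin D -> b \in D -> (a, b) \in A -> b = v.
Proof.
have [_ Ai _] := forestP _ _ AV.
move=> aD bD ab; apply/eqP; apply: contraNT aD => bv; move: bD; rewrite DE => bD.
by have [e eD eb] := reach_parent_closed bD bv; rewrite (Ai _ _ _ ab eb).
Qed.

Lemma CorD w : w \in V -> (w \in C) || (w \in D).
Proof. by rewrite VE in_setU. Qed.

Lemma entry_arc a b : a \in C -> (a, b) \in A -> b \notin C -> a = p /\ b = v.
Proof.
have [AVV Ai _] := forestP _ _ AV; move=> aC ab bC; have bD : b \in D.
  by have [_ /CorD] := AVV _ _ ab; rewrite (negPf bC).
have bv : b = v by apply: entry_root bD ab; rewrite (disjointFr CD aC).
by split=> //; apply: (Ai _ _ v); rewrite // -bv.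
Qed.

Lemma aev_contract :
  aev (zexp D p (fz R A)) (sexp D p (fs R A)) (pi C G) C = fev A (pi C G) C.
Proof.
have [AVV Ai _] := forestP _ _ AV; have pD : p \notin D by rewrite (disjointFr CD pC).
apply: ev_local => X Z XZ; rewrite subUset => /andP[XC ZC].
have XD : [disjoint X & D] by apply: disjointWl XC CD.
have ZD : [disjoint Z & D] by apply: disjointWl ZC CD.
have betweenE (X' Z' : {set T}) a : X' \subset C -> Z' \subset C -> [disjoint X' & Z'] -> a \in A ->
    between (expand D p X') (expand D p Z') (arc_color a, a) =
    between X' Z' (arc_color a, a).
  case: a => a b X'C Z'C X'Z' ab; rewrite /between /=.
  have X'D : [disjoint X' & D] by apply: disjointWl X'C CD.
  have Z'D : [disjoint Z' & D] by apply: disjointWl Z'C CD.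
  have in_exp w : w \in C -> (w \in expand D p X') = (w \in X').
    move=> wC; have wD : w \notin D by rewrite (disjointFr CD wC).
    have [pX|pX] := boolP (p \in X'); first by rewrite expand_in // in_setU (negPf wD) orbF.
    by rewrite expand_notin.
  have in_exp' w : w \in C -> (w \in expand D p Z') = (w \in Z').
    move=> wC; have wD : w \notin D by rewrite (disjointFr CD wC).
    have [pX|pX] := boolP (p \in Z'); first by rewrite expand_in // in_setU (negPf wD) orbF.
    by rewrite expand_notin.
  have exp_D (W : {set T}) w : W \subset C -> w \in D -> (w \in expand D p W) = (p \in W).
    move=> WC wD; have wC : w \notin C by rewrite (disjointFl CD wD).
    have WD : [disjoint W & D] by apply: disjointWl WC CD.
    have [pW|pW] := boolP (p \in W); first by rewrite expand_in // in_setU wD orbT.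
    by rewrite expand_notin //; apply: contraNF wC; apply: (subsetP WC).
  have notC (W : {set T}) w : W \subset C -> w \in D -> w \in W = false.
    move=> WC wD; apply/negbTE/negP => /(subsetP WC) wC.
    by rewrite (disjointFr CD wC) in wD.
  have pXZ : (p \in X') && (p \in Z') = false.
    by apply/negP => /andP[pX]; rewrite (disjointFr X'Z' pX).
  have [aV bV] := AVV _ _ ab.
  have [aC|aC] := boolP (a \in C).
    have [bC|bC] := boolP (b \in C); first by rewrite in_exp // in_exp'.
    have [-> ->] := entry_arc aC ab bC; have vD : v \in D by apply: setU11.
    by rewrite in_exp // exp_D // pXZ (notC Z') // andbF.
  have aD : a \in D by have := CorD aV; rewrite (negPf aC).
  have bD := below_closed aD ab.
  by rewrite (exp_D X') // (exp_D Z') // pXZ (notC X' a) // (notC Z' b).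
have crossE a : a \in A -> crosses (expand D p X) (expand D p Z) (arc_color a, a) =
    crosses X Z (arc_color a, a).
  by move=> aA; rewrite /crosses !betweenE // disjoint_sym.
have fcE : fcross A (expand D p X) (expand D p Z) = fcross A X Z.
  apply/setP => a; rewrite !in_fcross; have [aA|//] := boolP (a \in A).
  by rewrite crossE.
split=> [|c]; first by rewrite /zexp !fzE fcE.
rewrite /sexp /fs /swt !crossings_arcs fcE; congr (_ * _).
rewrite /orientation !big_map !big_enum_cond /=; apply: eq_bigr => a /andP[aA _].
by rewrite !betweenE // disjoint_sym.
Qed.

End Contraction.

(** A nonzero value forces the tree [J] on [D], so [D] is contained in [reach A v]. If they are
    equal, [aev_contract] evaluates the outer factor and determines [A]; if not, more vertices lie
    below [v]. *)
Lemma fev_sub_tri A : forest V A ->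
  fev A (asub p (abra blue (avar R p) (eps U H)) (pi C G)) V != 0 ->
  A = linked_forest \/ (#|D| < #|reach A v|)%N.
Proof.
move=> AV; rewrite fev_sub // => /mul_neq0[ev0 /mul_neq0[fs0 AD0]].
have nat_neq0 (b : bool) : b%:R != 0 :> R -> b by case: b; rewrite // eqxx.
have {AD0} AD : restr D A = J by apply/eqP/nat_neq0.
have [AVV Ai _] := forestP _ _ AV.
have D_closed w : w \in D -> w != v -> exists2 e, e \in D & (e, w) \in A.
  move=> wD wv; have [e eD ew] := join_closed HU vU wD wv.
  by exists e => //; move: ew; rewrite -/J -AD in_restr => /and3P[].
have DA : D \subset reach A v by apply: parent_closed_reach AV _ => w; apply: D_closed.
have [DE|DN] := eqVneq D (reach A v); last first.
  by right; apply: proper_card; rewrite properEneq DN.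
left; have pD : p \notin D by rewrite (disjointFr CD pC).
(* Arcs entering the full set of descendants of [v] end at [v], so the crossing arc demanded by the
   blue bracket is the one from [p] to [v]. *)
have pvA : (p, v) \in A.
  have [[a b] abE _] := fs_neq0 fs0.
  have : (a, b) \in fcross A [set p] D by rewrite abE in_set1.
  rewrite in_fcross => /andP[ab /orP[]/andP[]] /=; rewrite in_set1.
    by move=> /eqP ap bD; rewrite -(entry_root AV DE _ bD ab) -?ap // ap.
  by move=> aD /eqP bp; rewrite -bp (below_closed DE aD ab) in pD.
have piC : restr C A = G.
  have C0 : C != set0 by apply/set0Pn; exists p.
  have [_ piE _] := pi_dual CV C0.
  move: ev0; rewrite (aev_contract AV DE pvA) fev_restr piE //; last exact: forest_restr AV.
  by move/nat_neq0/eqP.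
apply/setP => -[a b]; rewrite in_setU1 in_setU -piC -AD !in_restr.
apply/idP/idP => [ab|/orP[/eqP[-> ->]//|/orP[]/and3P[]//]].
rewrite ab /=; have [aV bV] := AVV _ _ ab.
have [aC|aC] := boolP (a \in C).
  have [bC|bC] := boolP (b \in C); first by rewrite orbT.
  by have [-> ->] := entry_arc AV DE pvA aC ab bC; rewrite eqxx.
have aD : a \in D by have := CorD aV; rewrite (negPf aC).
by rewrite aD (below_closed DE aD ab) !orbT.
Qed.

Lemma restrD_linked : restr D linked_forest = J.
Proof.
have [GCC _ _] := forestP _ _ GC; have [JDD _ _] := forestP _ _ JD.
apply/setP => -[a b]; rewrite in_restr in_setU1 in_setU; apply/idP/idP.
  case/and3P=> /orP[/eqP[-> _]|/orP[/GCC[aC _]|//]] aD _.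
    by rewrite (disjointFr CD pC) in aD.
  by rewrite (disjointFr CD aC) in aD.
by move=> ab; have [-> ->] := JDD _ _ ab; rewrite ab !orbT.
Qed.

Lemma fev_sub_diag :
  fev linked_forest (asub p (abra blue (avar R p) (eps U H)) (pi C G)) V = 1.
Proof.
have FV := linked_forestP; have pvF : (p, v) \in linked_forest by apply: setU11.
have C0 : C != set0 by apply/set0Pn; exists p.
have [_ piE _] := pi_dual CV C0.
rewrite fev_sub // (aev_contract FV _ pvF) ?linked_reach // fev_restr.
rewrite piE //; last exact: forest_restr FV.
have [-> _] := restr_linked; rewrite restrD_linked !eqxx mul1r mulr1.
have pV : p \in V by rewrite VE in_setU pC.
have pv : p != v by apply: contraNneq vC => <-.
apply: (@fs_eq1 _ _ _ _ _ _ (p, v)); rewrite ?set11 //.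
- have DF : D = reach linked_forest v by rewrite linked_reach.
  have pD : p \notin D by rewrite (disjointFr CD pC).
  apply/setP => -[a b]; rewrite in_set1 in_fcross; apply/idP/idP => [|/eqP abE].
    case/andP=> ab /orP[]/andP[] /=; rewrite in_set1.
      move=> /eqP ap bD; rewrite xpair_eqE ap eqxx.
      rewrite -ap in pD; rewrite (entry_root FV DF pD bD ab).
      by rewrite eqxx.
    by move=> aD /eqP bp; rewrite -bp (below_closed DF aD ab) in pD.
  by rewrite abE pvF /crosses /between /= set11 setU11.
- by rewrite blue_arc // ltn_neqAle pv v_max.
- exact: setU11.
- by rewrite disjoints1 (disjointFr CD pC).
Qed.

Lemma candidate_linked :
  dual_candidate linked_forest = asub p (abra blue (avar R p) (eps U H)) (pi C G).
Proof.
have [GE HE] := restr_linked.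
have besideE : beside linked_forest = C.
  by rewrite /beside linked_reach VE setDUl setDv setU0; apply/setDidPl.
have belowE : below_v linked_forest = U by rewrite /below_v linked_reach setU1K.
have /negPf C0 : C != set0 by apply/set0Pn; exists p.
rewrite /dual_candidate besideE belowE GE HE C0.
case: pickP => [q|/(_ p)]; rewrite linked_parent ?eqxx // => /eqP->.
by [].
Qed.

End Linked.
End Shape.

Lemma forest_unlinked F : forest V F -> is_root F v ->
  F = restr (beside F) F :|: join v (below_v F) (restr (below_v F) F).
Proof.
move=> FV vF; have UE : v |: below_v F = reach F v by exact/setD1K/reach_refl.
rewrite {1}(reach_split FV vF) setUC -UE; congr (restr _ _ :|: _); first by rewrite UE.
rewrite [LHS](@join_char _ v (below_v F)) ?setD11 //.
- by rewrite restr_restr // subsetUr.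
- exact: forest_restr FV.
move=> u; rewrite in_setD1 => /andP[uv uD]; have [e eD eu] := reach_parent_closed uD uv.
rewrite negb_forall; apply/existsP; exists e.
by rewrite negbK in_restr eu UE eD.
Qed.

(** Deleting the arc into [v] leaves its descendants unchanged and reduces to the case in which [v]
    is a root. *)
Lemma forest_linked F p : forest V F -> (p, v) \in F ->
  p \in beside F /\
  F = linked_forest (below_v F) (restr (beside F) F) (restr (below_v F) F) p.
Proof.
move=> FV pvF; have [FVV Fi _] := forestP _ _ FV.
have pC : p \in beside F by rewrite in_setD (forest_acyclic FV pvF) (FVV _ _ pvF).1.
split=> //; set F' := F :\ (p, v).
have F'V : forest V F'.
  by apply: (forest_sub FV) => [|a b]; [apply: subD1set|rewrite in_setD1 => /andP[_ /FVV]].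
have F'r : is_root F' v.
  apply/is_rootP => a; rewrite in_setD1 xpair_eqE eqxx andbT negb_and negbK.
  by case: (boolP (_ \in F)) => [/Fi/(_ pvF)->|]; rewrite ?eqxx ?orbT.
have reachE : reach F' v = reach F v.
  apply/eqP; rewrite eqEsubset reach_sub ?subD1set //.
  apply: (parent_closed_reach F'V) => w wD wv.
  have [e eD ew] := reach_parent_closed wD wv; exists e => //.
  by rewrite in_setD1 ew xpair_eqE (negPf wv) andbF.
have restrE S : v \notin S -> restr S F' = restr S F.
  move=> vS; apply/setP => -[a b]; rewrite !in_restr in_setD1 xpair_eqE.
  by have [->|_] := eqVneq b v; rewrite ?(negPf vS) ?andbF.
have := forest_unlinked F'V F'r; rewrite /below_v /beside reachE.
rewrite !restrE ?setD11 // ?in_setD ?reach_refl // => F'E.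
by rewrite /linked_forest -F'E setD1K.
Qed.

(** A forest and its candidate are given by the same data [C], [U], [G], [H], [p]. The generators
    [xgen] decompose along these data too, which is how spanning is transferred to the
    candidates. *)
Variant shape : {set T * T} -> FA -> Prop :=
| shape_all U H : v \notin U -> V = v |: U -> forest U H ->
    shape (join v U H) (eps U H)
| shape_unlinked C U G H : C != set0 -> v \notin C -> v \notin U ->
    [disjoint C & U] -> V = C :|: (v |: U) -> forest C G -> forest U H ->
    shape (G :|: join v U H) (amul (pi C G) (eps U H))
| shape_linked C U G H p : v \notin C -> v \notin U ->
    [disjoint C & U] -> V = C :|: (v |: U) -> forest C G -> forest U H ->
    p \in C ->
    shape (linked_forest U G H p) (asub p (abra blue (avar R p) (eps U H)) (pi C G)).

Lemma forest_shape F : forest V F -> shape F (dual_candidate F).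
Proof.
move=> FV.
have UE : v |: below_v F = reach F v by exact/setD1K/reach_refl.
have vC : v \notin beside F by rewrite in_setD reach_refl.
have vU : v \notin below_v F by rewrite setD11.
have CU : [disjoint beside F & below_v F].
  by rewrite disjoint_sym; apply: disjointWl (subD1set _ _) (disjointD _ _).
have VE : V = beside F :|: (v |: below_v F).
  by rewrite UE -{1}(setID V (reach F v)) (setIidPr (reach_subV FV vV)) setUC.
have GC : forest (beside F) (restr (beside F) F) by apply: forest_restr FV.
have HU : forest (below_v F) (restr (below_v F) F) by apply: forest_restr FV.
have [Fr|/parentP[p pF]] := boolP (is_root F v); last first.
  have [pC FE] := forest_linked FV pF.
  rewrite {1 2}FE (candidate_linked vC vU CU VE GC HU pC).
  exact: shape_linked.
have FE := forest_unlinked FV Fr.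
have [C0|C0] := eqVneq (beside F) set0.
  rewrite {1 2}FE (candidate_all vC vU CU VE GC HU C0).
  have -> : restr (beside F) F = set0.
    by apply/setP => -[a b]; rewrite in_restr C0 !in_set0 !andbF.
  by rewrite set0U; apply: shape_all => //; rewrite {1}VE C0 set0U.
rewrite {1 2}FE (candidate_unlinked vC vU CU VE GC HU C0).
exact: shape_unlinked.
Qed.

Lemma shape_forest F x : shape F x -> forest V F /\ x = dual_candidate F.
Proof.
case=> {F x} [U H vU VE HU|C U G H C0 vC vU CU VE GC HU|C U G H p vC vU CU VE GC HU pC].
- have v0 : v \notin (set0 : {set T}) by rewrite in_set0.
  have dU : [disjoint (set0 : {set T}) & U] by rewrite -setI_eq0 set0I.
  have VE' : V = set0 :|: (v |: U) by rewrite set0U.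
  rewrite -(candidate_all v0 vU dU VE' (forest0 set0) HU) // set0U.
  by split=> //; rewrite [X in forest X]VE; apply: join_forest.
- split; first exact: unlinked_forest VE GC HU.
  by rewrite (candidate_unlinked vC vU CU VE GC HU).
- split; first exact: linked_forestP VE GC HU _ pC.
  by rewrite (candidate_linked vC vU CU VE GC HU).
Qed.

Let sub_V C U : V = C :|: (v |: U) -> v \notin C -> v \notin U ->
  (#|C| < #|V|)%N /\ U \subset V :\ v.
Proof.
move=> VE vC vU; split.
  by apply/proper_card/properP; split; [rewrite VE subsetUl|exists v].
by rewrite subsetD1 vU VE (subset_trans (subsetUr [set v] U) (subsetUr _ _)).
Qed.

Lemma shape_PV F x : shape F x -> PV V x.
Proof.
case=> {F x} [U H vU VE HU|C U G H C0 vC vU CU VE GC HU|C U G H p vC vU CU VE GC HU pC].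
- have UV : U \subset V :\ v by rewrite subsetD1 vU VE subsetUr.
  by have [epsP _ _] := eps_dual UV; rewrite [V in PV V]VE; apply: epsP.
- have [CV UV] := sub_V VE vC vU; have [epsP _ _] := eps_dual UV.
  have [piP _ _] := pi_dual CV C0; rewrite [V in PV V]VE; apply: PV_mul.
  + by rewrite disjoint_setUr CU disjoint_sym disjoints1 vC.
  + exact: piP.
  + exact: epsP.
- have [CV UV] := sub_V VE vC vU; have [epsP _ _] := eps_dual UV.
  have C0 : C != set0 by apply/set0Pn; exists p.
  have [piP _ _] := pi_dual CV C0; rewrite [V in PV V]VE.
  have CD : [disjoint C & v |: U].
    by rewrite disjoint_setUr CU disjoint_sym disjoints1 vC.
  apply: PV_asubU => //; first exact: piP.
  apply: PV_bra; [|exact/PV_monom/monom_var|exact: epsP].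
  by rewrite disjoints1 (disjointFr CD pC).
Qed.

Lemma shape_diag F x : shape F x -> fev F x V = 1.
Proof.
case=> {F x} [U H vU VE HU|C U G H C0 vC vU CU VE GC HU|C U G H p vC vU CU VE GC HU pC].
- have VE' : V = set0 :|: (v |: U) by rewrite set0U.
  rewrite (fev_all vU VE' HU) ?eqxx // VE.
  exact: join_forest.
- exact: fev_unlinked_diag.
- exact: fev_sub_diag.
Qed.

(** Only in the linked case can another forest give a nonzero value, and it then has more vertices
    below [v]; hence the rank used in [dual_step]. *)
Lemma shape_tri F x A : shape F x -> forest V A -> fev A x V != 0 ->
  A = F \/ (#|reach F v| < #|reach A v|)%N.
Proof.
have nat_neq0 (b : bool) : b%:R != 0 :> R -> b by case: b; rewrite // eqxx.
case=> {F x} [U H vU VE HU|C U G H C0 vC vU CU VE GC HU|C U G H p vC vU CU VE GC HU pC] AV.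
- have VE' : V = set0 :|: (v |: U) by rewrite set0U.
  by rewrite (fev_all vU VE' HU) // => /nat_neq0/eqP; left.
- rewrite (fev_unlinked vC vU CU VE GC HU) // fzE.
  case/mul_neq0=> /mul_neq0[/nat_neq0/eqP A0 /nat_neq0/eqP AC /nat_neq0/eqP AD].
  by left; rewrite (forest_split VE AV A0) AC AD.
- move/(fev_sub_tri vC vU CU VE GC HU pC AV).
  by rewrite (linked_reach vC vU CU VE GC HU p).
Qed.

Lemma xgen_shape x : xgen v V x -> lspan (fun y => exists F, shape F y) x.
Proof.
case=> {x} [U w rw VE|U C w g rw vC CU gC VE|U C w p g rw vC CU pC gC VE];
  have vU := rword_notin rw.
- have UV : U \subset V :\ v by rewrite subsetD1 vU VE subsetUr.
  have [_ _ epsS] := eps_dual UV.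
  apply: lspanS (epsS _ rw) => _ [H HU ->]; exists (join v U H); exact: shape_all.
(* For empty [C] the factor [g] is zero, as [PV set0] has no generators. *)
- have [C0|C0] := eqVneq C set0.
    have -> : g = 0.
      apply: (lspan_min (P := fun g : FA => g = 0) _ _ gC) => [|u um].
        by split=> // a u1 u2 -> ->; rewrite scaler0 addr0.
      by have := monom_neq0 um; rewrite C0 eqxx.
    by rewrite (linear_at0 (amul_linearl w)); apply: lspan0.
  have [CV UV] := sub_V VE vC vU; have [_ _ epsS] := eps_dual UV.
  have [_ _ piS] := pi_dual CV C0.
  apply: lspan2 (piS _ gC) (epsS _ rw) => [u a|u a|_ _ [G GC ->] [H HU ->]].
  + exact: amul_linearl.
  + exact: amul_linearr.
  by apply: lspan_gen; exists (G :|: join v U H); apply: shape_unlinked.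
- have C0 : C != set0 by apply/set0Pn; exists p.
  have [CV UV] := sub_V VE vC vU; have [_ _ epsS] := eps_dual UV.
  have [_ _ piS] := pi_dual CV C0.
  apply: (lspan_map (f := asub p (abra blue (avar R p) w))) (piS _ gC) => [||_ [G GC ->]].
  + exact/linear_at0/asub_linear.
  + exact: asub_linear.
  have piG : PV C (pi C G) by have [piP _ _] := pi_dual CV C0; apply: piP.
  pose h (u : FA) := asub p (abra blue (avar R p) u) (pi C G).
  have lin a : {morph h : s t / a *: s + t}.
    by move=> s t; rewrite /h abra_linearr (asub_linear2 _ _ _ piG pC).
  apply: (lspan_map (f := h)) (epsS _ rw); [exact: linear_at0 lin|exact: lin|].
  move=> _ [H HU ->]; rewrite /h.
  by apply: lspan_gen; exists (linked_forest U G H p); apply: shape_linked.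
Qed.

Lemma dual_step : exists pi' : {set T * T} -> FA, dual_family V pi'.
Proof.
have [||||p [p_span p_dual p_x]] := @triangular_dual R FA {set T * T} (forest V)
  (fun F => #|reach F v|) dual_candidate (fun F x => fev F x V).
- by move=> F; apply: fev0.
- by move=> F; apply: fev_linear.
- by move=> F /forest_shape/shape_diag.
- move=> F F' FV F'V FF' rk; apply/eqP; apply: contraTT FF' => FF'.
  have [->|] := shape_tri (forest_shape FV) F'V FF'; first by rewrite eqxx.
  by rewrite ltnNge rk.
exists p; split=> [F FV||x xV].
- by apply: lspan_trans (p_span F FV) => _ [F' /forest_shape/shape_PV xV ->].
- by move=> F F' FV F'V; apply: p_dual.
apply: lspan_trans (xgen_span vV xV) => y /xgen_shape.
apply: lspan_trans => z [F /shape_forest[FV ->]]; exact: p_x.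
Qed.

End Step.

(** Strong induction on the size of [V] with the maximal vertex as [v], which makes all colours at
    [v] known. The empty set is left out: it has one forest but no nonzero multilinear element. *)
Lemma dual_exists V : V != set0 ->
  exists pi : {set T * T} -> FA, dual_family V pi.
Proof.
move: {2}(#|V|.+1) (ltnSn #|V|) => N; elim: N V => // N IHN V VN V0.
have [v vV v_max] := ex_max_vertex V0.
have /choice[pi piP] : forall Y, exists pi : {set T * T} -> FA,
    (#|Y| < #|V|)%N -> Y != set0 -> dual_family Y pi.
  move=> Y; have [YV|] := boolP (#|Y| < #|V|)%N; last by exists (fun=> 0).
  have [Y0|Y0] := eqVneq Y set0; first by exists (fun=> 0) => _ /negP[]; apply/eqP.
  by have [pi piP] := IHN Y (leq_trans YV VN) Y0; exists pi.
have /choice[eps epsP] : forall U, exists e : {set T * T} -> FA, U \subset V :\ v -> red_dual v U e.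
  move=> U; have [UV|] := boolP (U \subset V :\ v); last by exists (fun=> 0).
  have [|Y YU Y0|e eP] := @red_dual_exists R n v U pi; last by exists e.
    move=> u /(subsetP UV); rewrite in_setD1 => /andP[uv /v_max].
    by rewrite leq_eqVlt (negPf (uv : u != v :> nat)).
  apply: piP => //; apply: leq_ltn_trans (subset_leq_card (subset_trans YU UV)) _.
  by rewrite [X in (_ < X)%N](cardsD1 v) vV.
exact: (dual_step vV v_max piP epsP).
Qed.

End DualBasis.

(** * Evaluation of tree monomials *)

Section TreeForm.
Variables (R : comPzRingType) (n : nat).
Local Notation T := 'I_n.
Local Notation cedge := (color * (T * T))%type.
Implicit Types (A B C : {set T}) (e : cedge) (es : seq cedge) (k : nat) (i : T).
Implicit Types (lv : seq (T * vertex)) (nd : seq (color * vertex)).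

Definition lpos lv i : vertex := nth [::] (unzip2 lv) (index i (unzip1 lv)).
Definition lnadir lv e : vertex := common_prefix (lpos lv e.2.1) (lpos lv e.2.2).
Definition lrev lv e : bool :=
  (branch (lnadir lv e) (lpos lv e.2.1) == 1%N) &&
  (branch (lnadir lv e) (lpos lv e.2.2) == 0%N).

(** The form on bare lists of leaf positions and nodes, which makes sense for subtrees whose leaves
    do not exhaust the labels. *)
Definition tree_form lv nd es : R :=
  if all (fun e => (e.1, lnadir lv e) \in nd) es
     && perm_eq [seq lnadir lv e | e <- es] (unzip2 nd)
  then (-1) ^+ count (lrev lv) es else 0.

Lemma lpos_catl lv1 lv2 i : i \in unzip1 lv1 -> lpos (lv1 ++ lv2) i = lpos lv1 i.
Proof.
move=> i1; rewrite /lpos /unzip1 /unzip2 !map_cat index_cat i1 nth_cat.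
by rewrite size_map -(size_map fst lv1) index_mem i1.
Qed.

Lemma lpos_catr lv1 lv2 i : i \notin unzip1 lv1 -> lpos (lv1 ++ lv2) i = lpos lv2 i.
Proof.
move=> /negPf i1; rewrite /lpos /unzip1 /unzip2 !map_cat index_cat i1 nth_cat.
by rewrite !size_map ltnNge leq_addr addKn.
Qed.

Lemma unzip1_below (X : Type) k (s : seq (X * vertex)) : unzip1 (below k s) = unzip1 s.
Proof. by rewrite /unzip1 -map_comp; apply: eq_map. Qed.

Lemma unzip2_below (X : Type) k (s : seq (X * vertex)) :
  unzip2 (below k s) = [seq k :: v | v <- unzip2 s].
Proof. by rewrite /unzip2 -!map_comp; apply: eq_map. Qed.

Lemma lpos_below k lv i : i \in unzip1 lv -> lpos (below k lv) i = k :: lpos lv i.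
Proof.
move=> iS; rewrite /lpos unzip1_below unzip2_below (nth_map [::]) //.
by rewrite size_map -(size_map fst) index_mem.
Qed.

Lemma lpos_in lv i : i \in unzip1 lv -> lpos lv i \in unzip2 lv.
Proof.
by move=> iS; apply: mem_nth; rewrite size_map -(size_map fst) index_mem.
Qed.

Lemma tree_form_perm lv nd es es' : perm_eq es es' ->
  tree_form lv nd es = tree_form lv nd es'.
Proof.
move=> ees'; rewrite /tree_form (perm_all _ ees') (permP ees').
by rewrite (permPl (perm_map (lnadir lv) ees')).
Qed.

Lemma eq_tree_form lv lv' nd es :
  (forall e, e \in es -> lpos lv e.2.1 = lpos lv' e.2.1 /\ lpos lv e.2.2 = lpos lv' e.2.2) ->
  tree_form lv nd es = tree_form lv' nd es.
Proof.
move=> E; rewrite /tree_form.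
have nE e : e \in es -> lnadir lv e = lnadir lv' e.
  by move=> /E[e1 e2]; rewrite /lnadir e1 e2.
have -> : [seq lnadir lv e | e <- es] = [seq lnadir lv' e | e <- es].
  exact/eq_in_map.
have -> : count (lrev lv) es = count (lrev lv') es.
  by apply: eq_in_count => e ee; rewrite /lrev nE //; have [-> ->] := E e ee.
by congr (if _ && _ then _ else _); apply: eq_in_all => e ee; rewrite nE.
Qed.

Lemma tree_form_below k lv nd es :
  all (fun e => (e.2.1 \in unzip1 lv) && (e.2.2 \in unzip1 lv)) es ->
  tree_form (below k lv) (below k nd) es = tree_form lv nd es.
Proof.
move=> /allP es_lv.
have nE e : e \in es -> lnadir (below k lv) e = k :: lnadir lv e.
  by move/es_lv => /andP[e1 e2]; rewrite /lnadir !lpos_below //= eqxx.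
rewrite /tree_form; congr (if _ && _ then _ ^+ _ else _).
- apply: eq_in_all => e ee; rewrite nE // (mem_map (f := fun p => (p.1, k :: p.2)) _ nd (e.1, _)) //.
  by move=> [a b] [a' b'] [-> ->].
- have -> : [seq lnadir (below k lv) e | e <- es] = [seq k :: v | v <- [seq lnadir lv e | e <- es]].
    by rewrite -map_comp; apply/eq_in_map.
  rewrite unzip2_below; apply/idP/idP; last exact: perm_map.
  by apply: perm_map_inj => a b [].
- apply: eq_in_count => e ee; have /andP[e1 e2] := es_lv _ ee.
  by rewrite /lrev nE // !lpos_below.
Qed.

Lemma perm_split (X : eqType) (P : pred X) (s1 s2 t1 t2 : seq X) :
  all P s1 -> all P t1 -> all (predC P) s2 -> all (predC P) t2 ->
  perm_eq (s1 ++ s2) (t1 ++ t2) = perm_eq s1 t1 && perm_eq s2 t2.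
Proof.
move=> P1 Q1 P2 Q2; apply/idP/andP => [st|[st1 st2]]; last exact: perm_cat.
have C2 (s : seq X) : all (predC P) s -> filter P s = [::].
  by rewrite all_predC has_filter negbK => /eqP.
have C1 (s : seq X) : all P s -> filter (predC P) s = [::].
  move=> Ps; apply/eqP; rewrite -[_ == _]negbK -has_filter -all_predC.
  by rewrite (eq_all (a2 := P)) // => x /=; rewrite negbK.
split.
  have := perm_filter P st; rewrite !filter_cat (C2 s2) // (C2 t2) // !cats0.
  by rewrite (all_filterP P1) (all_filterP Q1).
have := perm_filter (predC P) st; rewrite !filter_cat (C1 s1) // (C1 t1) //.
by rewrite (all_filterP P2) (all_filterP Q2).
Qed.

Definition starts (P : pred nat) (v : vertex) : bool :=
  if v is a :: _ then P a else false.

Lemma starts_prefix P u v : starts P u ->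
  common_prefix u v = [::] \/ starts P (common_prefix u v).
Proof.
by case: u => // a u Pa; case: v => [|b v] /=; [left|case: eqP; [right|left]].
Qed.

(** * Factorization of the form at the root of a subtree *)

Section Glue.
Variables (lv1 lv2 : seq (T * vertex)) (nd1 nd2 rt : seq (color * vertex)).
Variables (P1 P2 : pred nat) (A B : {set T}).
Hypotheses (A1 : A =i unzip1 lv1) (B2 : B =i unzip1 lv2) (AB : [disjoint A & B]).
Hypothesis P12 : forall a, P1 a -> ~~ P2 a.
Hypotheses (lvP1 : all (starts P1) (unzip2 lv1)) (lvP2 : all (starts P2) (unzip2 lv2)).
Hypotheses (ndP1 : all (starts P1) (unzip2 nd1)) (ndP2 : all (starts P2) (unzip2 nd2)).
Hypothesis rt0 : all (pred1 [::]) (unzip2 rt).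
Hypothesis rt_split : rt = [::] \/ forall e,
  (inside A e -> lnadir lv1 e != [::]) /\ (inside B e -> lnadir lv2 e != [::]).

Let lv := lv1 ++ lv2.
Let nd := rt ++ nd1 ++ nd2.

Let posA i : i \in A -> lpos lv i = lpos lv1 i.
Proof. by rewrite A1; apply: lpos_catl. Qed.

Let posB i : i \in B -> lpos lv i = lpos lv2 i.
Proof. by move=> iB; apply: lpos_catr; rewrite -A1 (disjointFl AB iB). Qed.

Let startsA i : i \in A -> starts P1 (lpos lv i).
Proof. by move=> iA; rewrite posA //; apply/(allP lvP1)/lpos_in; rewrite -A1. Qed.

Let startsB i : i \in B -> starts P2 (lpos lv i).
Proof. by move=> iB; rewrite posB //; apply/(allP lvP2)/lpos_in; rewrite -B2. Qed.

Let starts12 v : starts P1 v -> ~~ starts P2 v.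
Proof. by case: v => // a v; apply: P12. Qed.

Let memP (N : seq (color * vertex)) P c v :
  all (starts P) (unzip2 N) -> ~~ starts P v -> (c, v) \notin N.
Proof.
by move=> /allP NP; apply: contra => cv; apply: NP; apply/mapP; exists (c, v).
Qed.

Let mem_rt c v : v != [::] -> (c, v) \notin rt.
Proof.
move=> v0; apply: contra v0 => cv; have /(allP rt0) : v \in unzip2 rt.
  by apply/mapP; exists (c, v).
by case: v {cv}.
Qed.

(** For a product [rt] is empty, and an edge inside one part may have the empty vertex as nadir,
    which is then in neither list of nodes. For a bracket [rt] contains that vertex, and [rt_split]
    excludes such edges. *)
Lemma glue_nadirA e : inside A e ->
  ((e.1, lnadir lv e) \in nd) = ((e.1, lnadir lv1 e) \in nd1).
Proof.
move=> eA; have /andP[e1 e2] := eA.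
have nE : lnadir lv e = lnadir lv1 e by rewrite /lnadir !posA.
have := starts_prefix (lpos lv e.2.2) (startsA e1); rewrite -/(lnadir lv e) nE.
rewrite !mem_cat; case=> [n0|nP].
  case: rt_split => [->|/(_ e)[/(_ eA)]]; last by rewrite n0.
  by rewrite n0 /= (negPf (memP _ ndP2 _)) ?orbF.
have n0 : lnadir lv1 e != [::] by case: (lnadir lv1 e) nP.
by rewrite (negPf (mem_rt _ n0)) (negPf (memP _ ndP2 (starts12 nP))) orbF.
Qed.

Lemma glue_nadirB e : inside B e ->
  ((e.1, lnadir lv e) \in nd) = ((e.1, lnadir lv2 e) \in nd2).
Proof.
move=> eB; have /andP[e1 e2] := eB.
have nE : lnadir lv e = lnadir lv2 e by rewrite /lnadir !posB.
have := starts_prefix (lpos lv e.2.2) (startsB e1); rewrite -/(lnadir lv e) nE.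
rewrite !mem_cat; case=> [n0|nP].
  case: rt_split => [->|/(_ e)[_ /(_ eB)]]; last by rewrite n0.
  by rewrite n0 /= (negPf (memP _ ndP1 _)).
have n0 : lnadir lv2 e != [::] by case: (lnadir lv2 e) nP.
have nP1 : ~~ starts P1 (lnadir lv2 e) by apply: contraL nP; apply: starts12.
by rewrite (negPf (mem_rt _ n0)) (negPf (memP _ ndP1 nP1)).
Qed.

Lemma crossing_nadir e : crosses A B e -> lnadir lv e = [::].
Proof.
have h i j : i \in A -> j \in B -> common_prefix (lpos lv i) (lpos lv j) = [::] /\
    common_prefix (lpos lv j) (lpos lv i) = [::].
  move=> /startsA + /startsB; case: (lpos lv i) => // a u; case: (lpos lv j) => // b v /=.
  by move=> /P12 + Pb; rewrite [b == a]eq_sym; case: eqP => // ->; rewrite Pb.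
by case/orP=> /andP[e1 e2]; [case: (h _ _ e1 e2)|case: (h _ _ e2 e1)].
Qed.

Lemma glue_nadirX e : crosses A B e ->
  ((e.1, lnadir lv e) \in nd) = ((e.1, [::]) \in rt).
Proof.
move=> eX; rewrite crossing_nadir // !mem_cat.
by rewrite (negPf (memP _ ndP1 _)) // (negPf (memP _ ndP2 _)) // !orbF.
Qed.

Lemma perm_inside es : all (inside (A :|: B)) es ->
  perm_eq es (filter (crosses A B) es ++ (filter (inside A) es ++ filter (inside B) es)).
Proof.
have AN i : (i \in A) && (i \in B) = false by case: (boolP (i \in A)) => // /(disjointFr AB).
move=> /allP esAB; set es' := filter (predC (crosses A B)) es.
rewrite perm_sym; apply: (perm_trans (y := filter (crosses A B) es ++ es')); last first.
  exact/permPl/perm_filterC.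
rewrite perm_cat2l.
have EA : filter (inside A) es = filter (inside A) es'.
  rewrite -filter_predI; apply: eq_in_filter => e _ /=.
  move: (AN e.2.1) (AN e.2.2); rewrite /inside /crosses /between.
  by do 4!case: (_ \in _).
have EB : filter (inside B) es = filter (predC (inside A)) es'.
  rewrite -filter_predI; apply: eq_in_filter => e /esAB /=.
  move: (AN e.2.1) (AN e.2.2); rewrite /inside /crosses /between !in_setU.
  by do 4!case: (_ \in _).
by rewrite EA EB; apply/permPl/perm_filterC.
Qed.

(** Crossing edges have the root as nadir, while the nodes of the two parts are told apart by their
    first index. The bijection condition thus splits into one condition per part and a count of
    crossing edges against [rt]. *)
Lemma tree_form_glue es : all (inside (A :|: B)) es ->
  tree_form lv nd es =
  tree_form lv1 nd1 (filter (inside A) es) * tree_form lv2 nd2 (filter (inside B) es) *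
  (let X := filter (crosses A B) es in
   if all (fun e => (e.1, [::]) \in rt) X && (size X == size rt)
   then (-1) ^+ count (lrev lv) X else 0).
Proof.
move=> /perm_inside es_split; rewrite (tree_form_perm _ _ es_split) /=.
set X := filter (crosses A B) es; set a := filter (inside A) es.
set b := filter (inside B) es.
have aA e : e \in a -> inside A e by rewrite mem_filter => /andP[].
have bB e : e \in b -> inside B e by rewrite mem_filter => /andP[].
have XX e : e \in X -> crosses A B e by rewrite mem_filter => /andP[].
rewrite -(eq_tree_form (lv := lv) (lv' := lv1)) => [|e /aA/andP[e1 e2]]; last by rewrite !posA.
rewrite -(eq_tree_form (lv := lv) (lv' := lv2)) => [|e /bB/andP[e1 e2]]; last by rewrite !posB.
rewrite /tree_form !all_cat !count_cat !map_cat.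
have -> : all (fun e => (e.1, lnadir lv e) \in nd) X = all (fun e => (e.1, [::]) \in rt) X.
  by apply: eq_in_all => e /XX; apply: glue_nadirX.
have -> : all (fun e => (e.1, lnadir lv e) \in nd) a =
    all (fun e => (e.1, lnadir lv e) \in nd1) a.
  apply: eq_in_all => e /aA eA; rewrite glue_nadirA // /lnadir.
  by have /andP[e1 e2] := eA; rewrite !posA.
have -> : all (fun e => (e.1, lnadir lv e) \in nd) b =
    all (fun e => (e.1, lnadir lv e) \in nd2) b.
  apply: eq_in_all => e /bB eB; rewrite glue_nadirB // /lnadir.
  by have /andP[e1 e2] := eB; rewrite !posB.
have [aall|_] := boolP (all _ a); last by rewrite andbF !mul0r.
have [ball|_] := boolP (all _ b); last by rewrite !andbF mulr0 mul0r.
rewrite andbT /=; have [Xall|_] /= := boolP (all _ X); last by rewrite mulr0.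
have startsa : all (starts P1) (map (lnadir lv) a).
  apply/allP => _ /mapP[e ea ->]; apply: (allP ndP1); apply/mapP.
  by exists (e.1, lnadir lv e) => //; apply: (allP aall).
have startsb : all (starts P2) (map (lnadir lv) b).
  apply/allP => _ /mapP[e eb ->]; apply: (allP ndP2); apply/mapP.
  by exists (e.1, lnadir lv e) => //; apply: (allP ball).
have sC s : all (starts P2) s -> all (predC (starts P1)) s.
  by apply: sub_all => v /=; apply: contraL; apply: starts12.
have s0 P s : all (starts P) s -> all (predC (pred1 [::])) s by apply: sub_all => -[].
have nilX : map (lnadir lv) X = nseq (size X) [::].
  apply: (@eq_from_nth _ [::]) => [|i]; rewrite ?size_map ?size_nseq // => iX.
  case: X XX iX Xall => // e0 X' XX iX _.
  by rewrite (nth_map e0) // nth_nseq iX crossing_nadir // XX // mem_nth.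
have nilrt : unzip2 rt = nseq (size rt) [::].
  rewrite -(size_map snd); exact/all_pred1P.
rewrite /nd /unzip2 !map_cat -!/(unzip2 _) (perm_split (P := pred1 [::])) //; last 3 first.
- by rewrite nilX all_nseq orbT.
- by rewrite all_cat (s0 P1) // (s0 P2).
- by rewrite all_cat (s0 P1) // (s0 P2).
rewrite (perm_split (P := starts P1)) ?sC //.
have -> : perm_eq (map (lnadir lv) X) (unzip2 rt) = (size X == size rt).
  rewrite nilX nilrt; apply/idP/eqP => [/perm_size|->]; first by rewrite !size_nseq.
  exact: perm_refl.
case: (size X == _); last by rewrite mulr0.
case: (perm_eq _ _); last by rewrite !mul0r.
case: (perm_eq _ _); last by rewrite mulr0 mul0r.
by rewrite !exprD mulrC.
Qed.

End Glue.

Scheme odd_tree_mut := Induction for odd_tree Sort Prop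
with even_tree_mut := Induction for even_tree Sort Prop.
Combined Scheme trees_ind from odd_tree_mut, even_tree_mut.

Lemma all_starts_below (X : Type) (P : pred nat) k (s : seq (X * vertex)) : P k ->
  all (starts P) (unzip2 (below k s)).
Proof. by move=> Pk; rewrite unzip2_below all_map; apply/allP. Qed.

Lemma leaf_labels :
  (forall t : odd_tree n, unzip1 (odd_leaf_vertices t) = odd_leaves t) /\
  (forall (t : even_tree n) k, unzip1 (leaf_vertices_from k t) = leaves t).
Proof.
apply: trees_ind => //= [c l IHl r IHr|o IHo k|o IHo t IHt k].
- by rewrite /unzip1 map_cat -!/(unzip1 _) !unzip1_below IHl IHr.
- by rewrite unzip1_below.
- by rewrite /unzip1 map_cat -!/(unzip1 _) unzip1_below IHo IHt.
Qed.

Lemma starts_from (t : even_tree n) k :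
  all (starts (leq k)) (unzip2 (leaf_vertices_from k t)) /\
  all (starts (leq k)) (unzip2 (nodes_from k t)).
Proof.
elim: t k => [o|o t IHt] k /=; first by split; apply: all_starts_below.
have [lt nt] := IHt k.+1; rewrite /unzip2 !map_cat !all_cat -!/(unzip2 _).
rewrite !all_starts_below //=.
by split; [apply: sub_all lt|apply: sub_all nt] => -[|a v] //= /ltnW.
Qed.

Lemma disjoint_seq (s1 s2 : seq T) :
  ~~ has (mem s1) s2 -> [disjoint [set i in s1] & [set i in s2]].
Proof.
move=> s12; rewrite -setI_eq0; apply/eqP/setP => i; rewrite !inE.
by apply/negP => /andP[i1 i2]; move/hasPn/(_ i i2): s12; rewrite /= i1.
Qed.

Lemma set_cat (s1 s2 : seq T) : [set i in s1 ++ s2] = [set i in s1] :|: [set i in s2].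
Proof. by apply/setP => i; rewrite !inE mem_cat. Qed.

Lemma monomial_monom (x : expr R n) : monomial x -> uniq (vars x) ->
  monom [set i in vars x] (alg_class x).
Proof.
elim: x => //= [i _ _|c x IHx y IHy /andP[mx my]|x IHx y IHy /andP[mx my]].
- have -> : [set j in [:: i]] = [set i] by apply/setP => j; rewrite !inE.
  exact: monom_var.
- rewrite cat_uniq => /and3P[/(IHx mx) mlx xy /(IHy my) mly].
  by rewrite set_cat -abraE; apply: monom_bra => //; apply: disjoint_seq.
- rewrite cat_uniq => /and3P[/(IHx mx) mlx xy /(IHy my) mly].
  by rewrite set_cat -amulE; apply: monom_mul => //; apply: disjoint_seq.
Qed.

Lemma monom_monomial A (a : free_alg R n) : monom A a -> exists x : expr R n,
  [/\ monomial x, uniq (vars x), [set i in vars x] = A & a = alg_class x].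
Proof.
have dis (x y : expr R n) : [disjoint [set i in vars x] & [set i in vars y]] ->
    uniq (vars x) -> uniq (vars y) -> uniq (vars x ++ vars y).
  move=> xy ux uy; rewrite cat_uniq ux uy andbT; apply/hasPn => i iy /=.
  by have := disjointFl xy (x := i); rewrite !inE => /(_ iy)->.
elim=> {A a} [i|c A B _ _ AB _ [x [mx ux xA ->]] _ [y [my uy yB ->]]
             |A B _ _ AB _ [x [mx ux xA ->]] _ [y [my uy yB ->]]].
- by exists (Var i); split=> //; apply/setP => j; rewrite !inE.
- exists (Bra c x y); rewrite /= mx my set_cat xA yB abraE; split=> //.
  by apply: dis => //; rewrite xA yB.
- exists (Mul x y); rewrite /= mx my set_cat xA yB amulE; split=> //.
  by apply: dis => //; rewrite xA yB.
Qed.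

Lemma crossing_factor_mul es A B (lv : seq (T * vertex)) :
  zwt R es A B =
  (let X := filter (crosses A B) es in
   if all (fun e => (e.1, [::]) \in ([::] : seq (color * vertex))) X && (size X == 0%N)
   then (-1) ^+ count (lrev lv) X else 0).
Proof.
rewrite /= /zwt /crossings -size_filter.
by case: (filter _ es) => //= e X; rewrite andbF.
Qed.

(** The bracket weight is the factor left over by [tree_form_glue]: a unique crossing edge of colour
    [c], with sign -1 if it runs from right to left. *)
Lemma crossing_factor_bra c es A B (lv : seq (T * vertex)) :
  [disjoint A & B] -> (forall e, crosses A B e -> lrev lv e = between B A e) ->
  swt R es c A B =
  (let X := filter (crosses A B) es in
   if all (fun e => (e.1, [::]) \in [:: (c, [::] : vertex)]) X && (size X == 1%N)
   then (-1) ^+ count (lrev lv) X else 0).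
Proof.
move=> AB revE; have -> : swt R es c A B = swt R (filter (crosses A B) es) c A B.
  rewrite /swt; congr (_ * _).
    by rewrite /crossings count_filter; congr ((_ == _)%:R); apply: eq_count => e /=; rewrite andbb.
  rewrite /orientation big_filter_cond (bigID (crosses A B)) /= [X in _ + X]big1 ?addr0.
    by apply: eq_bigl => e; rewrite andbC.
  by move=> e /andP[_]; rewrite negb_or => /andP[/negPf-> /negPf->]; rewrite subrr.
have: all (crosses A B) (filter (crosses A B) es) by apply: filter_all.
rewrite /=; case: (filter _ es) => [|e [|e' X]] eX.
- by rewrite /swt /crossings /= mul0r.
- move: eX; rewrite /= andbT => eX; rewrite mem_seq1 xpair_eqE eqxx andbT.
  rewrite /swt /crossings /orientation /= eX big_cons big_nil mul1r.
  case: eqP => _ /=; last by [].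
  rewrite addn0 addr0 revE //.
  case/orP: eX => /andP[e1 e2]; rewrite /between e1 e2.
    by rewrite (disjointFr AB e1) subr0 expr0.
  by rewrite (disjointFl AB e1) sub0r expr1.
- have -> : swt R (e :: e' :: X) c A B = 0.
    by move: eX; rewrite /swt /crossings /= => /and3P[-> -> _]; rewrite mul0r.
  by rewrite andbF.
Qed.

(** By mutual induction, the evaluation of a bracket or product is a weight times the values on its
    parts, which is the factorization of the form. The index [k] is arbitrary because the tail of a
    product starts at [k.+1]. *)
Lemma tree_eval :
  (forall t : odd_tree n, uniq (odd_leaves t) ->
    forall es, all (fun e => e.2.1 != e.2.2) es ->
    aev (zwt R es) (swt R es) (alg_class (odd_tree_expr R t)) [set i in odd_leaves t] =
    tree_form (odd_leaf_vertices t) (odd_nodes t)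
      (filter (inside [set i in odd_leaves t]) es)) /\
  (forall t : even_tree n, uniq (leaves t) ->
    forall k es, all (fun e => e.2.1 != e.2.2) es ->
    aev (zwt R es) (swt R es) (alg_class (tree_expr R t)) [set i in leaves t] =
    tree_form (leaf_vertices_from k t) (nodes_from k t)
      (filter (inside [set i in leaves t]) es)).
Proof.
have [olab lab] := leaf_labels.
have omon (t : odd_tree n) : uniq (odd_leaves t) ->
    PV [set i in odd_leaves t] (alg_class (odd_tree_expr R t)).
  have [mt <-] := odd_tree_exprP R t.
  by move=> ut; apply/PV_monom/monomial_monom.
have mon (t : even_tree n) : uniq (leaves t) ->
    PV [set i in leaves t] (alg_class (tree_expr R t)).
  have [mt <-] := tree_exprP R t.
  by move=> ut; apply/PV_monom/monomial_monom.
have inside_sub A B (es : seq cedge) : A \subset B ->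
    filter (inside A) (filter (inside B) es) = filter (inside A) es.
  move=> /subsetP AB; rewrite -filter_predI; apply: eq_filter => e /=.
  rewrite /inside; have [/AB->|//] := boolP (e.2.1 \in A).
  by have [/AB->|] := boolP (e.2.2 \in A).
have cross_sub A B (es : seq cedge) :
    filter (crosses A B) (filter (inside (A :|: B)) es) = filter (crosses A B) es.
  rewrite -filter_predI; apply: eq_filter => e /=.
  rewrite /inside /crosses /between !in_setU.
  by do 4!case: (_ \in _).
have belowE A k lv nd (es : seq cedge) : A =i unzip1 lv ->
    tree_form (below k lv) (below k nd) (filter (inside A) es) =
    tree_form lv nd (filter (inside A) es).
  move=> AE; apply: tree_form_below; apply/allP => e.
  by rewrite mem_filter /inside !AE => /andP[].
apply: trees_ind => [i|c l IHl r IHr|o IHo|o IHo t IHt].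
- move=> _ es /allP es_loop; have -> : [set j in odd_leaves (Leaf i)] = [set i].
    by apply/setP => j; rewrite !inE.
  have -> : filter (inside [set i]) es = [::].
    apply/eqP; rewrite -[_ == _]negbK -has_filter; apply/hasPn => e /es_loop.
    apply: contra; rewrite /inside !in_set1.
    by move=> /andP[/eqP-> /eqP->].
  by rewrite [alg_class _]/(avar R i) (aev_avar (edge_weight_axioms R es)) eqxx.
- rewrite [odd_leaves _]/= cat_uniq => /and3P[ul lr ur] es es_loop.
  rewrite set_cat; set A := [set i in leaves l]; set B := [set i in leaves r].
  have AB : [disjoint A & B] by apply: disjoint_seq.
  rewrite [odd_tree_expr _ _]/= -abraE.
  rewrite (aev_abra_at (edge_weight_axioms R es)) //; try exact: mon.
  rewrite (IHl ul 0%N) // (IHr ur 0%N) // -/A -/B.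
  rewrite [odd_leaf_vertices _]/= [odd_nodes _]/=.
  have Al : A =i unzip1 (below 0 (leaf_vertices_from 0 l)).
    by move=> i; rewrite unzip1_below lab inE.
  have Br : B =i unzip1 (below 1 (leaf_vertices_from 0 r)).
    by move=> i; rewrite unzip1_below lab inE.
  have lrevE e : crosses A B e ->
      lrev (below 0 (leaf_vertices_from 0 l) ++ below 1 (leaf_vertices_from 0 r)) e =
      between B A e.
    have lA i : i \in A -> lpos (below 0 (leaf_vertices_from 0 l) ++
        below 1 (leaf_vertices_from 0 r)) i = 0%N :: lpos (leaf_vertices_from 0 l) i.
      by rewrite Al => iA; rewrite lpos_catl // lpos_below // -(unzip1_below 0).
    have lB i : i \in B -> lpos (below 0 (leaf_vertices_from 0 l) ++
        below 1 (leaf_vertices_from 0 r)) i = 1%N :: lpos (leaf_vertices_from 0 r) i.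
      move=> iB; rewrite lpos_catr -?Al ?(disjointFl AB iB) //.
      by rewrite lpos_below // -(unzip1_below 1) -Br.
    rewrite /lrev /lnadir /between => /orP[]/andP[e1 e2].
      by rewrite !(lA _ e1) !(lB _ e2) /branch /= (disjointFr AB e1).
    by rewrite !(lA _ e2) !(lB _ e1) /branch /= e1 e2.
  rewrite (@tree_form_glue (below 0 (leaf_vertices_from 0 l)) (below 1 (leaf_vertices_from 0 r))
    (below 0 (nodes_from 0 l)) (below 1 (nodes_from 0 r)) [:: (c, [::])]
    (pred1 0%N) (pred1 1%N) A B) //;
    try by apply: all_starts_below; rewrite /= ?eqxx.
  + rewrite !belowE //; try by move=> i; rewrite lab inE.
    rewrite !inside_sub ?subsetUl ?subsetUr // cross_sub.
    by rewrite -(crossing_factor_bra c es AB lrevE) [RHS]mulrC mulrA.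
  + by move=> a /eqP->.
  + right=> e; rewrite /inside /lnadir !Al !Br !unzip1_below.
    by split=> /andP[e1 e2]; rewrite !lpos_below.
  + exact: filter_all.
- move=> u k es es_loop; rewrite [leaves _]/= [tree_expr _ _]/= IHo //=.
  by rewrite belowE // => i; rewrite olab inE.
- rewrite [leaves _]/= cat_uniq => /and3P[uo ot ut] k es es_loop.
  rewrite set_cat; set A := [set i in odd_leaves o]; set B := [set i in leaves t].
  have AB : [disjoint A & B] by apply: disjoint_seq.
  rewrite [tree_expr _ _]/= -amulE.
  rewrite (aev_amul_at (edge_weight_axioms R es)) //;
    [|exact: omon|exact: mon].
  rewrite (IHo uo) // (IHt ut k.+1) // -/A -/B.
  rewrite [leaf_vertices_from _ _]/= [nodes_from _ _]/=.
  have Ao : A =i unzip1 (below k (odd_leaf_vertices o)).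
    by move=> i; rewrite unzip1_below olab inE.
  have Bt : B =i unzip1 (leaf_vertices_from k.+1 t).
    by move=> i; rewrite lab inE.
  have [lt nt] := starts_from t k.+1.
  rewrite (@tree_form_glue (below k (odd_leaf_vertices o)) (leaf_vertices_from k.+1 t)
    (below k (odd_nodes o)) (nodes_from k.+1 t) [::] (pred1 k) (leq k.+1) A B) //;
    try by apply: all_starts_below; rewrite /= ?eqxx.
  + rewrite belowE //; last by move=> i; rewrite olab inE.
    rewrite !inside_sub ?subsetUl ?subsetUr // cross_sub.
    by rewrite -crossing_factor_mul [RHS]mulrC mulrA.
  + by move=> a /eqP->; rewrite ltnn.
  + by left.
  + exact: filter_all.
Qed.

End TreeForm.

(** * Comparison with the form on trees, and conclusion *)

Section MainPairing.
Variables (R : comPzRingType) (n : nat).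
Local Notation T := 'I_n.
Local Notation FA := (free_alg R n).

Lemma P2_PV (a : FA) :
  lspan (fun a => exists2 x : expr R n, multilinear x & a = alg_class x) a <-> PV setT a.
Proof.
split.
  apply: lspanS => _ [x /andP[mx vx] ->].
  have -> : setT = [set i in vars x].
    by apply/setP => i; rewrite !inE (perm_mem vx) mem_enum.
  by apply: monomial_monom; rewrite // (perm_uniq vx) enum_uniq.
apply: lspanS => u /monom_monomial[x [mx ux xT ->]]; exists x => //.
rewrite /multilinear mx; apply: uniq_perm => //; first exact: enum_uniq.
by move=> i; rewrite mem_enum; move/setP/(_ i): xT; rewrite !inE.
Qed.

Lemma pairing_tree (G : graph n) (t : tree n) :
  pairing (graph_class R G) (tree_class R t) = com_form R G t.
Proof.
rewrite pairing_class /=; have [_ eval] := tree_eval R n.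
have tE := valP t; have ut : uniq (leaves (val t)) by rewrite (perm_uniq tE) enum_uniq.
have TE : setT = [set i in leaves (val t)].
  by apply/setP => i; rewrite !inE (perm_mem tE) mem_enum.
rewrite [in LHS]TE (eval _ ut 0%N) ?all_map; last by apply/allP => e _; apply: (valP e).
rewrite -TE (_ : filter _ _ = elist G); last first.
  by apply/all_filterP/allP => e _; rewrite /inside !in_setT.
by rewrite /tree_form /com_form /elist all_map count_map -map_comp.
Qed.

Lemma pairing_forest (F : {set T * T}) (p : P2 R n) : forest setT F ->
  pairing (qF R F) p = fev F (val p) setT.
Proof.
move=> FV; rewrite /qF /qE pairing_class /fev /fz /fs /aev -!/(gev _ _ _).
apply/gev_perm/elist_list_graph/allP => _ /mapP[[i j] ij ->] /=.
move: ij; rewrite mem_enum => ij; apply: contraTneq ij => ->.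
exact: forest_irrefl FV.
Qed.

End MainPairing.

Theorem theorem10p21 (R : comPzRingType) (n : nat) (n_gt0 : (0 < n)%N) :
  exists B : Q2 R n -> P2 R n -> R,
    (forall (G : graph n) (T : tree n),
        B (graph_class R G) (tree_class R T) = com_form R G T)
    /\ perfect_pairing B.
Proof.
exists (@pairing R n); split; first exact: pairing_tree.
have T0 : [set: 'I_n] != set0 by apply/set0Pn; exists (Ordinal n_gt0); rewrite in_setT.
have [pi [piP piE pi_span]] := dual_exists R T0.
have pi_in F : forest setT F -> pi F \in in_lspan
    (fun a : free_alg R n => exists2 x, multilinear x & a = alg_class x).
  by move=> FV; apply/in_lspanP/P2_PV/piP.
(* Outside forests [pi F] need not be multilinear; there the default 0 stands in. *)
pose p F : P2 R n := insubd (0 : P2 R n) (pi F).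
have pE F : forest setT F -> val (p F) = pi F.
  by move=> FV; rewrite /p insubdK //; apply: pi_in.
apply: (@perfect_dual_bases R _ _ _ (forest setT) _ (@qF R n) p).
- exact: pairing_linearl.
- exact: pairing_linearr.
- exact: Q2_forest_span.
- move=> y; have /in_lspanP/P2_PV/pi_span := valP y.
  (* The family spans inside the ambient algebra; [W] transports this to the submodule, whose
     inclusion is injective. *)
  pose W (a : free_alg R n) := exists2 z : P2 R n, val z = a &
    lspan (fun v => exists2 F, forest setT F & v = p F) z.
  case/(lspan_min (P := W)) => [|_ [F FV ->]|z /val_inj<-] //.
    split=> [|c _ _ [z <- z_span] [z' <- z'_span]].
      by exists 0; [exact: linear0|exact: lspan0].
    by exists (c *: z + z'); [exact: linearP|exact: lspan_comb].
  by exists (p F); [exact: pE|apply: lspan_gen; exists F].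
- by move=> F F' FV F'V; rewrite pairing_forest // pE // piE.
Qed.
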